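(* Let $q\in(0,1)$ and $\alpha>-1$. The orthogonality measure $\tilde\mu^{(\alpha)}$ of the modified $q$-Laguerre polynomials is supported on the set of positive roots of the function $J_{\alpha+1}^{(2)}(2\sqrt z;q)$. For every positive root $\zeta$ of $J_{\alpha+1}^{(2)}(2\sqrt z;q)$, $$\tilde\mu^{(\alpha)}(\{\zeta\})=\Bigg(\sum_{n=0}^\infty\tilde P_n^{(\alpha)}(\zeta)^2\Bigg)^{-1}=-\tilde{\mathfrak{W}}^{(\alpha)}(\zeta)\Bigg(\frac{\mathrm{d}\tilde{\mathfrak{F}}^{(\alpha)}(\zeta)}{\mathrm{d}z}\Bigg)^{-1},$$ where $$\tilde{\mathfrak{W}}^{(\alpha)}(z)=\tilde w^{(\alpha)}(z)\,\tilde{\mathfrak{F}}^{(\alpha)}(z)$$ and $\tilde w^{(\alpha)}(z)$ is the corresponding Weyl function.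
   Context: Fix $q\in(0,1)$ and $\alpha>-1$. $(a;q)_n=\prod_{k=0}^{n-1}(1-aq^k)$ for $n\in\mathbb{N}_0\cup\{\infty\}$. ${}_0\phi_1(-;b;q,x)=\sum_{k=0}^\infty\frac{q^{k(k-1)}}{(b;q)_k(q;q)_k}x^k$, and the Jackson $q$-Bessel function is $$J_\nu^{(2)}(x;q)=\frac{(q^{\nu+1};q)_\infty}{(q;q)_\infty}\Big(\frac x2\Big)^\nu{}_0\phi_1\Big(-;q^{\nu+1};q,-\frac{q^{\nu+1}x^2}{4}\Big).$$ Put $$\gamma(u,v;q)=\frac{(q^u;q)_\infty}{(q^{u+v};q)_\infty},\qquad r_n^{(\alpha)}=\frac{1-\gamma(n+1,\alpha+1;q)}{1-\gamma(n,\alpha+1;q)},\quad n\ge0$$ (note $\gamma(0,\alpha+1;q)=0$), and $$\tilde\lambda_n^{(\alpha)}=\frac{q^{-2n-\alpha-1}(1-q^{n+\alpha+1})}{r_n^{(\alpha)}},\qquad\tilde\mu_n^{(\alpha)}=q^{-2n-\alpha}(1-q^n)\,r_n^{(\alpha)},\quad n\ge0 ,$$ $\tilde a_n=\sqrt{\tilde\lambda_n^{(\alpha)}\tilde\mu_{n+1}^{(\alpha)}}$, $\tilde b_n=\tilde\lambda_n^{(\alpha)}+\tilde\mu_n^{(\alpha)}$. The orthonormal modified $q$-Laguerre polynomials $\tilde P_n^{(\alpha)}$ are given by $\tilde P_0^{(\alpha)}=1$, $\tilde P_1^{(\alpha)}(x)=(x-\tilde b_0)/\tilde a_0$, $x\tilde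 P_n^{(\alpha)}=\tilde a_{n-1}\tilde P_{n-1}^{(\alpha)}+\tilde b_n\tilde P_n^{(\alpha)}+\tilde a_n\tilde P_{n+1}^{(\alpha)}$, $n\ge1$. The Jacobi operator $\tilde J^{(\alpha)}$ is the closure in $\ell^2(\mathbb{N}_0)$ of the action on finitely supported sequences of the symmetric tridiagonal matrix with diagonal $\tilde b_n$ and off-diagonal $\tilde a_n$. It is self-adjoint and positive with trace class inverse, so there is a unique Borel probability measure $\tilde\mu^{(\alpha)}$ on $\mathbb{R}$ for which $(\tilde P_n^{(\alpha)})$ is orthonormal (the orthogonality measure). Its spectrum consists of simple eigenvalues $0<\zeta_1^{(\alpha)}<\zeta_2^{(\alpha)}<\cdots$ with $\sum_k1/\zeta_k^{(\alpha)}<\infty$, and its characteristic function is $\tilde{\mathfrak{F}}^{(\alpha)}(z)=\prod_{k=1}^\infty(1-z/\zeta_k^{(\alpha)})$. The Weyl function is $\tilde w^{(\alpha)}(z)=\int_{\mathbb{R}}\frac{\mathrm{d}\tilde\mu^{(\alpha)}(x)}{x-z}$, a meromorphic function on $\mathbb{C}$; the product $\tilde{\mathfrak{W}}^{(\alpha)}$ has only removable singularities and is regarded as an entire function. *)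

(* Defs.v *)
From HB Require Import structures.
From mathcomp Require Import all_boot all_order all_algebra.
From mathcomp Require Import all_classical all_reals all_analysis.
From mathcomp.real_closed Require Import complex.
Set Implicit Arguments.
Unset Strict Implicit.
Unset Printing Implicit Defensive.
Import Order.TTheory GRing.Theory Num.Theory.
Import numFieldNormedType.Exports.
Local Open Scope classical_set_scope.
Local Open Scope ring_scope.

Section qseries.
Variable R : realType.
Implicit Types (q a b u v nu x : R) (n k : nat).

Definition qpoch q a n : R := \prod_(k < n) (1 - a * q ^+ k).

Definition qpoch_inf q a : R := limn (qpoch q a).

Definition phi01 q b x : R :=
  limn (series (fun k : nat =>
    q ^+ (k * k.-1) / (qpoch q b k * qpoch q q k) * x ^+ k)).

(* Only meant for x >= 0, because of the real power (x / 2) `^ nu. *)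
Definition qBesselJ q nu x : R :=
  qpoch_inf q (q `^ (nu + 1)) / qpoch_inf q q * (x / 2) `^ nu *
  phi01 q (q `^ (nu + 1)) (- (q `^ (nu + 1) * x ^+ 2 / 4)).

Definition positive_roots q (alpha : R) : set R :=
  [set x | 0 < x /\ qBesselJ q (alpha + 1) (2 * Num.sqrt x) = 0].

Definition qgamma q u v : R :=
  qpoch_inf q (q `^ u) / qpoch_inf q (q `^ (u + v)).

End qseries.

Section modified_qLaguerre.
Variables (R : realType) (q alpha : R).
Implicit Type n : nat.

Definition mql_r n : R :=
  (1 - qgamma q n.+1%:R (alpha + 1)) / (1 - qgamma q n%:R (alpha + 1)).

Definition mql_lambda n : R :=
  q `^ (- (2 * n%:R) - alpha - 1) * (1 - q `^ (n%:R + alpha + 1)) / mql_r n.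

Definition mql_mu n : R :=
  q `^ (- (2 * n%:R) - alpha) * (1 - q ^+ n) * mql_r n.

Definition mql_a n : R := Num.sqrt (mql_lambda n * mql_mu n.+1).

Definition mql_b n : R := mql_lambda n + mql_mu n.

Fixpoint mql_P n : {poly R} :=
  if n is m.+1 then
    if m is k.+1 then
      (mql_a m)^-1 *: (('X - (mql_b m)%:P) * mql_P m - mql_a k *: mql_P k)
    else (mql_a 0)^-1 *: ('X - (mql_b 0)%:P)
  else 1.

(* [measurableTypeR R] is R with its Borel sigma-algebra. The integrals are
   extended-real valued; the diagonal case makes every P_n square integrable. *)
Definition orthogonality_measure
    (mu : probability (measurableTypeR R) R) : Prop :=
  forall m n,
    (\int[mu]_x ((mql_P m).[x] * (mql_P n).[x])%:E = ((m == n)%:R : R)%:E)%E.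

End modified_qLaguerre.

(* R[i], seen as an abstract numFieldType so as to carry the norm topology. *)
Definition Cplx (R : realType) : numFieldType := R[i].

Section jacobi_operator.
Variables (R : realType) (a b : nat -> R).
Local Notation C := (Cplx R).
Local Notation "x %:C" := (real_complex R x : Cplx R).
Implicit Types (x y v : nat -> C) (z : C).

Definition sqnorm x : \bar R :=
  (\sum_(0 <= n <oo) ((complex.Re (x n)) ^+ 2 + (complex.Im (x n)) ^+ 2)%:E)%E.

Definition in_l2 x : Prop := (sqnorm x < +oo)%E.

Definition finitely_supported x : Prop :=
  exists N : nat, forall n, (N <= n)%N -> x n = 0.

Definition jacobi_mul x : nat -> C := fun n =>
  (if n is m.+1 then (a m)%:C * x m else 0)
  + (b n)%:C * x n + (a n)%:C * x n.+1.

(* [jacobi_graph x y] : x is in the domain of the Jacobi operator, and is mapped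
   to y; this is the closure in l^2 x l^2 of the graph of [jacobi_mul] on
   finitely supported sequences. *)
Definition jacobi_graph x y : Prop :=
  [/\ in_l2 x, in_l2 y &
   exists s : nat -> nat -> C,
     [/\ forall k, finitely_supported (s k),
         sqnorm (fun n => s k n - x n) @[k --> \oo] --> 0%E &
         sqnorm (fun n => jacobi_mul (s k) n - y n) @[k --> \oo] --> 0%E]].

Definition jacobi_resolvent_set : set C :=
  [set z |
    (forall y, in_l2 y ->
       exists! x, jacobi_graph x (fun n => z * x n + y n)) /\
    (exists c : R, forall x y, in_l2 y ->
       jacobi_graph x (fun n => z * x n + y n) ->
       (sqnorm x <= c%:E * sqnorm y)%E)].

Definition jacobi_spectrum : set C := ~` jacobi_resolvent_set.

(* The k-th term is the (k+1)-st eigenvalue. *)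
Definition spectrum_enumeration (zeta : nat -> R) : Prop :=
  [/\ forall k, 0 < zeta k,
      forall k l, (k < l)%N -> zeta k < zeta l &
      jacobi_spectrum = range (fun k => (zeta k)%:C)].

End jacobi_operator.

Section characteristic_and_weyl_functions.
Variables (R : realType) (mu : probability (measurableTypeR R) R).
Variable zeta : nat -> R.
Local Notation C := (Cplx R).
Local Notation "x %:C" := (real_complex R x : Cplx R).
Implicit Type z : C.

Definition charF z : C :=
  limn (fun n : nat => \prod_(k < n) (1 - z / (zeta k)%:C)).

Definition weylw z : C :=
  Complex (\int[mu]_x complex.Re (x%:C - z)^-1)
          (\int[mu]_x complex.Im (x%:C - z)^-1).

(* The product w F with its removable singularities removed: where w F is
   continuous, the punctured limit is its value. *)
Definition weylW z : C := lim (weylw z' * charF z' @[z' --> z^']).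

End characteristic_and_weyl_functions.

(* Main.v *)
(* The Jacobi matrix is that of a birth-death process with rates lam, mu, so that
   P_n(x) = (-1)^n sqrt(rho_n) pi_n(x) with pi_n(0) = 1 and rho_n of order q^-n.
   The pi_n are a Geronimus transform of the q-Laguerre polynomials with parameter
   alpha + 1, hence pi_n(x) tends to phi(x) = 0phi1(-; q^(alpha+2); q, -q^(alpha+2) x),
   whose positive zeros are those of J_(alpha+1)(2 sqrt x).
   - The L^2 norm of pi_n is rho_n^(-1/2), which tends to 0, so by Fatou phi = 0
     almost everywhere.
   - At a zero x of phi, pi_n(x) = O(q^(2n)); by Christoffel-Darboux the kernel
     sum_n P_n(x) P_n(t), whose integral is 1, vanishes at the other zeros t, which
     gives the mass of {x}.
   - Bessel's inequality for the kernel polynomials ell_n bounds the sum of the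
     inverse zeros by the trace of the inverse Jacobi operator.
   - A zero x is an eigenvalue, with eigenvector P_n(x). A point z with
     phi(z) <> 0 lies in the resolvent set: P_n(z) and the functions of the second
     kind int P_n(t) / (t - z) dm(t) form a Green kernel of geometric decay. So the
     zeta_k are exactly the zeros of phi, and F converges with simple zeros.
   - Near a zero x, w(z) = m{x} / (x - z) + O(1) and F(z) = (1 - z / x) H(z) with H
     continuous and H(x) <> 0; hence W(x) = m{x} H(x) / x and F'(x) = - H(x) / x. *)
Require Import Defs.
From HB Require Import structures.
From mathcomp Require Import all_boot all_order all_algebra.
From mathcomp Require Import all_classical all_reals all_analysis.
From mathcomp.real_closed Require Import complex.
From mathcomp Require Import measurable_realfun ring lra.
Set Implicit Arguments.
Unset Strict Implicit.
Unset Printing Implicit Defensive.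
Import Order.TTheory GRing.Theory Num.Theory.
Import numFieldNormedType.Exports.
Local Open Scope classical_set_scope.
Local Open Scope ring_scope.

(** The measure is given only by its orthonormality relations and the points [zeta k] only by the
    spectrum, so the support, the masses and the identification of the spectrum with the zeros of
    phi all have to come from explicit estimates on [P_n]. These need little q-analysis. As [lam n]
    and [rho n] are of exact order q^(-2n) and q^(-n), the factors [eta n] in pi_(n+1) - pi_n = - x
    eta_n ell_n are O(q^(2n)). At a zero of phi this is the decay of pi_n; off the zeros, the second
    solution is O(q^(3n)) relative to P_n. The spectrum is enumerated by real numbers, so only real
    z have to be tested; the matrix being real, every equation then splits into real and imaginary
    parts. Lipschitz bounds stand in for holomorphy: on each disc H is a limit of finite products
    that are bounded and Lipschitz uniformly in their length, which is all that the limit defining W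
    and the derivative of F require. *)

(** * Null sequences and geometric tails *)

Section sequences.
Variable R : realType.
Implicit Types (u v : nat -> R) (c C l r : R).

Lemma cvgn0_le u : u @ \oo --> (0 : R) ->
  forall e, 0 < e -> exists N, forall n, (N <= n)%N -> `|u n| <= e.
Proof.
move=> /cvgrPdist_le u0 e e0; have [N _ Nu] := u0 _ e0.
by exists N => n Nn; have := Nu _ Nn; rewrite sub0r normrN.
Qed.

Lemma cvgn_dist_le u l : u @ \oo --> l ->
  forall e, 0 < e -> exists N, forall n, (N <= n)%N -> `|u n - l| <= e.
Proof.
move=> ul; apply: cvgn0_le; rewrite -(subrr l).
by apply: cvgB => //; exact: cvg_cst.
Qed.

Lemma cvgn0I u : (forall e, 0 < e -> exists N, forall n, (N <= n)%N -> `|u n| <= e) ->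
  u @ \oo --> (0 : R).
Proof.
move=> H; apply/cvgrPdist_le => e e0; have [N Nu] := H _ e0.
by exists N => // n /= Nn; rewrite sub0r normrN Nu.
Qed.

Lemma cvgn0Z u c : u @ \oo --> (0 : R) -> c * u n @[n --> \oo] --> (0 : R).
Proof.
move=> h; apply: cvgn0I => e e0; have c1 : 0 < `|c| + 1 by rewrite ltr_pwDr.
have [N HN] := cvgn0_le h (divr_gt0 e0 c1); exists N => n /HN.
rewrite ler_pdivlMr// => H; rewrite normrM mulrC; apply: le_trans H.
by rewrite ler_wpM2l// lerDl.
Qed.

Lemma cvgn_sqr u l : u @ \oo --> l -> u n ^+ 2 @[n --> \oo] --> l ^+ 2.
Proof.
by move=> h; rewrite expr2; under eq_fun do rewrite expr2; exact: cvgM.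
Qed.

Lemma cvgn_le u l C : u @ \oo --> l -> (forall n, u n <= C) -> l <= C.
Proof.
move=> ul uC; apply/ler_addgt0Pr => e e0; have [N HN] := cvgn_dist_le ul e0.
have := HN N (leqnn _); rewrite ler_norml => /andP[h _].
by have := uC N; lra.
Qed.

Lemma cvgn_sum (f : nat -> nat -> R) (l : nat -> R) K :
  (forall k, f k @ \oo --> l k) ->
  \sum_(k < K) f k n @[n --> \oo] --> \sum_(k < K) l k.
Proof.
move=> fl; elim: K => [|K IH].
  by rewrite big_ord0; under eq_fun do rewrite big_ord0; exact: cvg_cst.
rewrite big_ord_recr/=; under eq_fun do rewrite big_ord_recr/=.
by apply: cvgD.
Qed.

Lemma cvgn_sub0 u l : u n - l @[n --> \oo] --> (0 : R) -> u @ \oo --> l.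
Proof.
move=> h; apply/cvgrPdist_le => e e0; have [N HN] := cvgn0_le h e0.
by exists N => // n /= /HN; rewrite distrC.
Qed.

Lemma cvgn0B u v : u @ \oo --> (0 : R) -> v @ \oo --> (0 : R) ->
  u n - v n @[n --> \oo] --> (0 : R).
Proof.
move=> u0 v0; apply: cvgn0I => e e0; have e20 : 0 < e / 2 by rewrite divr_gt0.
have [N HN] := cvgn0_le u0 e20; have [M HM] := cvgn0_le v0 e20.
exists (maxn N M) => n; rewrite geq_max => /andP[/HN h1 /HM h2].
by apply: le_trans (ler_normB _ _) _; lra.
Qed.

Lemma cvgn_bounded u l : u @ \oo --> l -> exists2 C, 0 < C & forall n, `|u n| <= C.
Proof.
move=> ul; have [N HN] := cvgn_dist_le ul ltr01.
exists (`|l| + 1 + \sum_(i < N) `|u i|).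
  by rewrite -addrA ltr_wpDl// ltr_pwDl// sumr_ge0.
move=> n; have [Nn|nN] := leqP N n.
  rewrite -[u n](subrK l); apply: le_trans (ler_normD _ _) _.
  by rewrite addrC -[leLHS]addr0 !lerD ?HN// sumr_ge0.
rewrite (bigD1 (Ordinal nN))//= addrCA lerDl addr_ge0 ?addr_ge0//.
exact: sumr_ge0.
Qed.

(** Telescoping to infinity: as [u] tends to 0, [u n] is minus the sum of the later increments. The
    decay of pi_n at a zero, of Q_n / P_n off the zeros, of the tail of the Green function and of
    [gamC] is obtained in this way. *)
Lemma geometric_tail u C r N : 0 <= r < 1 ->
  (forall n, (N <= n)%N -> `|u n.+1 - u n| <= C * r ^+ n) -> u @ \oo --> (0 : R) ->
  forall n, (N <= n)%N -> `|u n| <= C / (1 - r) * r ^+ n.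
Proof.
move=> /andP[r0 r1] Hu u0 n Nn.
have C0 : 0 <= C * r ^+ n by apply: le_trans (Hu _ Nn).
have r1' : 0 < 1 - r by rewrite subr_gt0.
(* The second summand is the geometric sum that bounds the next [m] increments. *)
have H m : `|u n| <= `|u (n + m)%N| + C / (1 - r) * r ^+ n * (1 - r ^+ m).
  elim: m => [|m IH]; first by rewrite addn0 expr0 subrr mulr0 addr0.
  apply: le_trans IH _.
  have := Hu (n + m)%N (leq_trans Nn (leq_addr _ _)).
  rewrite -addnS => Hm.
  have : `|u (n + m)%N| <= `|u (n + m.+1)%N| + C * r ^+ (n + m).
    rewrite -[u (n + m)%N](subKr (u (n + m.+1)%N)).
    by apply: le_trans (ler_normB _ _) _; rewrite lerD2l.
  suff -> : C / (1 - r) * r ^+ n * (1 - r ^+ m.+1) =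
    C * r ^+ (n + m) + C / (1 - r) * r ^+ n * (1 - r ^+ m) by move=> ?; lra.
  by rewrite exprD exprS; field; rewrite gt_eqF.
apply/ler_addgt0Pl => e e0; have [M HM] := cvgn0_le u0 e0.
apply: le_trans (H M) _; apply: lerD; first by rewrite HM// leq_addl.
rewrite ler_piMr// ?gerBl ?exprn_ge0// mulrAC divr_ge0// ltW//.
Qed.

End sequences.

(** * Birth-death polynomials *)

Section birth_death.
Variables (R : realType) (lam mu : nat -> R).
Implicit Types (x t : R) (n : nat).

(* bdpair n x = (pi_n(x), pi_n(x) - pi_(n-1)(x)) for the polynomials with birth
   rates lam and death rates mu, normalized by pi_n(0) = 1; bdP n is the
   orthonormal polynomial, and bdell n is orthonormal, up to scaling, with
   respect to x dm(x). *)
Fixpoint bdpair n x : R * R :=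
  if n is m.+1 then
    let d := (mu m * (bdpair m x).2 - x * (bdpair m x).1) / lam m in
    ((bdpair m x).1 + d, d)
  else (1, 0).

Definition bdpi n x := (bdpair n x).1.
Definition bdstep n x := (bdpair n x).2.
(** The symmetrizing weights of the chain, determined by detailed balance between [n] and [n.+1]. *)
Definition bdrho n := \prod_(i < n) (lam i / mu i.+1).
Definition bdA n := \sum_(j < n.+1) bdrho j.
(** The n-th diagonal entry of the inverse Jacobi operator is rho_n times the sum over k >= n of 1 /
    (lam_k rho_k). Exchanging the two sums in the trace leaves A_k / (lam_k rho_k) as the
    contribution of k. *)
Definition bdeta n := bdA n / (lam n * bdrho n).
Definition bdell n x := (\sum_(j < n.+1) bdrho j * bdpi j x) / bdA n.
Definition bdP n x := (-1) ^+ n * Num.sqrt (bdrho n) * bdpi n x.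
Definition bda n := Num.sqrt (lam n * mu n.+1).
Definition bdb n := lam n + mu n.

Hypotheses (lam_gt0 : forall n, 0 < lam n) (mu_gt0 : forall n, 0 < mu n.+1).
Hypothesis mu0 : mu 0 = 0.

Let lam_neq0 n : lam n != 0. Proof. by rewrite gt_eqF. Qed.
Let mu_neq0 n : mu n.+1 != 0. Proof. by rewrite gt_eqF. Qed.

Lemma bdpi0 x : bdpi 0 x = 1. Proof. by []. Qed.

Lemma bdpiS n x : bdpi n.+1 x = bdpi n x + bdstep n.+1 x. Proof. by []. Qed.

Lemma lam_bdstep n x :
  lam n * bdstep n.+1 x = mu n * bdstep n x - x * bdpi n x.
Proof. by rewrite /bdstep /bdpi/= mulrC divfK. Qed.

Lemma bdrho0 : bdrho 0 = 1. Proof. by rewrite /bdrho big_ord0. Qed.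

Lemma bdrhoS n : bdrho n.+1 = bdrho n * (lam n / mu n.+1).
Proof. by rewrite /bdrho big_ord_recr. Qed.

Lemma bdrho_gt0 n : 0 < bdrho n.
Proof.
elim: n => [|n IH]; first by rewrite bdrho0.
by rewrite bdrhoS mulr_gt0// divr_gt0.
Qed.

Lemma bdA_gt0 n : 0 < bdA n.
Proof.
rewrite /bdA big_ord_recl ltr_pwDl ?bdrho_gt0// sumr_ge0// => i _.
by rewrite ltW// bdrho_gt0.
Qed.

Let rho_neq0 n : bdrho n != 0. Proof. by rewrite gt_eqF// bdrho_gt0. Qed.
Let A_neq0 n : bdA n != 0. Proof. by rewrite gt_eqF// bdA_gt0. Qed.

Lemma bdeta_gt0 n : 0 < bdeta n.
Proof. by rewrite divr_gt0 ?bdA_gt0// mulr_gt0// bdrho_gt0. Qed.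

Lemma mu_bdrho n : mu n.+1 * bdrho n.+1 = lam n * bdrho n.
Proof. by rewrite bdrhoS; field. Qed.

Lemma bdA_ell n x : bdA n * bdell n x = \sum_(j < n.+1) bdrho j * bdpi j x.
Proof. by rewrite /bdell mulrC divfK. Qed.

Lemma bdA_ellS n x : bdA n.+1 * bdell n.+1 x =
  bdA n * bdell n x + bdrho n.+1 * bdpi n.+1 x.
Proof. by rewrite !bdA_ell big_ord_recr. Qed.

(** The recurrence is a conservation law: by detailed balance the flux on the left changes by - x
    rho_n pi_n at each step, and [mu 0 = 0] lets no flux in at the origin. *)
Lemma bdflux n x :
  lam n * bdrho n * bdstep n.+1 x = - x * (bdA n * bdell n x).
Proof.
elim: n => [|n IH]; rewrite mulrAC lam_bdstep.
  by rewrite mu0 bdA_ell big_ord_recl big_ord0 bdrho0 bdpi0; ring.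
by rewrite bdA_ellS [RHS]mulrDr -IH -mu_bdrho; ring.
Qed.

Lemma bdpi_sub n x : bdpi n.+1 x - bdpi n x = - (x * bdeta n * bdell n x).
Proof.
rewrite bdpiS addrAC subrr add0r.
apply: (mulfI (mulf_neq0 (lam_neq0 n) (rho_neq0 n))).
by rewrite bdflux /bdeta; field; rewrite lam_neq0 rho_neq0.
Qed.

(** For x <= 0 the recurrence keeps all increments nonnegative. In the limit this excludes zeros of
    phi on the negative half-line and at 0. *)
Lemma bdpi_ge1 n x : x <= 0 -> 1 <= bdpi n x.
Proof.
move=> x0; suff [] : 1 <= bdpi n x /\ 0 <= bdstep n x by [].
elim: n => [|n [IH1 IH2]]; first by rewrite bdpi0.
have mun : 0 <= mu n by case: (n) => [|m]; [rewrite mu0|exact: ltW].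
have d0 : 0 <= bdstep n.+1 x.
  rewrite -(pmulr_rge0 _ (lam_gt0 n)) lam_bdstep subr_ge0.
  apply: (@le_trans _ _ 0); last exact: mulr_ge0.
  by rewrite mulr_le0_ge0// (le_trans ler01).
by rewrite bdpiS; split=> //; rewrite -[leLHS]addr0 lerD.
Qed.

Lemma bdpi_christoffel_darboux n x t :
  (x - t) * \sum_(j < n.+1) bdrho j * bdpi j x * bdpi j t =
  lam n * bdrho n * (bdpi n.+1 t * bdpi n x - bdpi n.+1 x * bdpi n t).
Proof.
have H k y : lam k * bdrho k * bdpi k.+1 y =
    lam k * bdrho k * bdpi k y + mu k * bdrho k * bdstep k y
    - y * bdrho k * bdpi k y.
  rewrite bdpiS mulrDr -addrA; congr (_ + _).
  by rewrite mulrAC lam_bdstep; ring.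
elim: n => [|n IH]; rewrite big_ord_recr/= [RHS]mulrBr !mulrA !H.
  by rewrite big_ord0 mu0; ring.
by rewrite mulrDr {}IH mu_bdrho !bdpiS; ring.
Qed.

(** Abel summation: rho_j pi_j is the increment of A_j ell_j, while pi_j decreases by x eta_j ell_j.
    It moves the norm of the eigenvector from the pi_j to the ell_j, where Bessel's inequality can
    be applied. *)
Lemma bd_sum_sqr n x :
  \sum_(j < n.+1) bdrho j * bdpi j x ^+ 2 =
  x * (\sum_(j < n.+1) bdA j * bdeta j * bdell j x ^+ 2) +
  bdA n * bdell n x * bdpi n.+1 x.
Proof.
have S k : bdpi k.+1 x = bdpi k x - x * bdeta k * bdell k x.
  by rewrite -bdpi_sub addrC subrK.
elim: n => [|n IH].
  rewrite !big_ord_recl !big_ord0 S bdA_ell big_ord_recl big_ord0 bdpi0 bdrho0.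
  rewrite /bdell /bdA !(big_ord_recl, big_ord0) bdrho0 bdpi0.
  by field.
rewrite big_ord_recr/= {}IH [in RHS]big_ord_recr/= bdA_ellS.
rewrite (S n.+1) expr2; set p := bdpi n.+1 x; set e := bdell n.+1 x.
have -> : bdA n.+1 * bdeta n.+1 * e ^+ 2 = bdeta n.+1 * e * (bdA n.+1 * e).
  by ring.
by rewrite /e bdA_ellS -/e -/p; ring.
Qed.

Lemma sqr_bdP n x : bdP n x ^+ 2 = bdrho n * bdpi n x ^+ 2.
Proof.
by rewrite /bdP !exprMn sqr_sqrtr ?ltW ?bdrho_gt0// sqrr_sign mul1r.
Qed.

Lemma mul_bdP n x t : bdP n x * bdP n t = bdrho n * bdpi n x * bdpi n t.
Proof.
have := sqr_sqrtr (ltW (bdrho_gt0 n)); rewrite expr2 => e.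
rewrite /bdP -[in RHS]e.
transitivity (((-1) ^+ n) ^+ 2 * (Num.sqrt (bdrho n) * Num.sqrt (bdrho n) *
  bdpi n x * bdpi n t)); first by ring.
by rewrite sqrr_sign mul1r.
Qed.

Lemma bda_sqrt_rho n : bda n * Num.sqrt (bdrho n) = mu n.+1 * Num.sqrt (bdrho n.+1).
Proof.
have l0 := lam_gt0 n; have m0 := mu_gt0 n; have r0 := bdrho_gt0 n.
rewrite /bda -sqrtrM ?mulr_ge0 ?ltW//.
rewrite -{2}(ger0_norm (ltW m0)) -sqrtr_sqr -sqrtrM ?sqr_ge0//.
by rewrite bdrhoS; congr Num.sqrt; field.
Qed.

Lemma bda_sqrt_rhoS n :
  bda n * Num.sqrt (bdrho n.+1) = lam n * Num.sqrt (bdrho n).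
Proof.
have l0 := lam_gt0 n; have m0 := mu_gt0 n; have r0 := bdrho_gt0 n.
rewrite /bda -sqrtrM ?mulr_ge0 ?ltW//.
rewrite -{2}(ger0_norm (ltW l0)) -sqrtr_sqr -sqrtrM ?sqr_ge0//.
by rewrite bdrhoS; congr Num.sqrt; field.
Qed.

Lemma bda_gt0 n : 0 < bda n.
Proof. by rewrite sqrtr_gt0 mulr_gt0. Qed.

Lemma bdP0 x : bdP 0 x = 1.
Proof. by rewrite /bdP expr0 bdrho0 sqrtr1 bdpi0 !mulr1. Qed.

(** The recurrence of pi_n has off-diagonal coefficients - lam_n and - mu_n; the sign (-1)^n in
    [bdP] turns them into the positive entries [bda] of the Jacobi matrix. *)
Lemma bdP_rec n x :
  x * bdP n x = (if n is m.+1 then bda m * bdP m x else 0)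
                + bdb n * bdP n x + bda n * bdP n.+1 x.
Proof.
have aS : bda n * bdP n.+1 x =
    - (-1) ^+ n * Num.sqrt (bdrho n) * (lam n * bdpi n x + lam n * bdstep n.+1 x).
  have e := bda_sqrt_rhoS n; rewrite -mulrDr -bdpiS.
  transitivity (- (-1) ^+ n * (bda n * Num.sqrt (bdrho n.+1)) * bdpi n.+1 x).
    by rewrite /bdP exprS; ring.
  by rewrite e; ring.
rewrite aS lam_bdstep {aS} /bdb.
case: n => [|n]; first by rewrite mu0 /bdP; ring.
have -> : bda n * bdP n x = - (-1) ^+ n.+1 * (mu n.+1 * Num.sqrt (bdrho n.+1))
    * (bdpi n.+1 x - bdstep n.+1 x).
  by rewrite -bda_sqrt_rho bdpiS addrK /bdP exprS; ring.
by rewrite /bdP; ring.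
Qed.

End birth_death.

(** * Chains with geometric rates and their behaviour at the zeros of the limit *)

Section geometric_chains.
Variables (R : realType) (lam mu : nat -> R).
Implicit Types (x t : R) (n : nat).
Local Notation pi := (bdpi lam mu).
Local Notation rho := (bdrho lam mu).
Local Notation A := (bdA lam mu).
Local Notation eta := (bdeta lam mu).
Local Notation ell := (bdell lam mu).
Local Notation P := (bdP lam mu).

(** What the spectral analysis takes from the concrete coefficients: signs, [mu 0 = 0], and
    two-sided bounds making lam_n and rho_n of exact order q^(-2n) and q^(-n). The other input is
    the pointwise limit [phi]. *)
Record geometric_chain (q c C : R) : Prop := GeometricChain {
  chain_q : 0 < q < 1;
  chain_c : 0 < c;
  chain_lam_gt0 : forall n, 0 < lam n;
  chain_mu_gt0 : forall n, 0 < mu n.+1;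
  chain_mu0 : mu 0 = 0;
  chain_lam : forall n, c <= lam n * (q ^+ 2) ^+ n <= C;
  chain_rho : forall n, c <= rho n * q ^+ n <= C }.

Variables (q c C : R) (phi : R -> R).
Hypothesis G : geometric_chain q c C.
Hypothesis pi_phi : forall x, pi n x @[n --> \oo] --> phi x.

Let q0 : 0 < q. Proof. by have /andP[] := chain_q G. Qed.
Let q1 : q < 1. Proof. by have /andP[] := chain_q G. Qed.
Let q01 : 0 <= q ^+ 2 < 1.
Proof. by rewrite exprn_ge0 ?ltW//= exprn_ilt1// ltW. Qed.
Let qn0 n : 0 < q ^+ n. Proof. by rewrite exprn_gt0. Qed.
Let c0 : 0 < c. Proof. exact: chain_c G. Qed.
Let rho_gt0 n : 0 < rho n.
Proof. by apply: bdrho_gt0; [exact: chain_lam_gt0 G|exact: chain_mu_gt0 G]. Qed.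
Let A_gt0 n : 0 < A n.
Proof. by apply: bdA_gt0; [exact: chain_lam_gt0 G|exact: chain_mu_gt0 G]. Qed.
Let eta_gt0 n : 0 < eta n.
Proof. by apply: bdeta_gt0; [exact: chain_lam_gt0 G|exact: chain_mu_gt0 G]. Qed.
Let C0 : 0 < C.
Proof. by have /andP[h1 h2] := chain_lam G 0; apply: lt_le_trans (le_trans h1 h2). Qed.

Lemma chain_inv_rho n : (rho n)^-1 <= c^-1 * q ^+ n.
Proof.
have /andP[h _] := chain_rho G n.
rewrite -[leLHS]mul1r ler_pdivrMr// -mulrA [_ * rho n]mulrC.
by rewrite ler_pdivlMl// mulr1.
Qed.

Lemma chain_inv_rho_cvg0 : (rho n)^-1 @[n --> \oo] --> (0 : R).
Proof.
apply: (@squeeze_cvgr _ _ _ _ (fun=> 0) (fun n => c^-1 * q ^+ n)).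
- by apply: nearW => n; rewrite chain_inv_rho invr_ge0 ltW.
- exact: cvg_cst.
- by apply: cvg_geometric; rewrite ger0_norm// ltW.
Qed.

Lemma chain_A n : A n * q ^+ n <= C / (1 - q).
Proof.
elim: n => [|n IH].
  rewrite /bdA big_ord_recl big_ord0 addr0.
  have /andP[_ h] := chain_rho G 0; apply: le_trans h _.
  by rewrite ler_pdivlMr ?subr_gt0// ler_piMr// ?(ltW C0)// gerBl (ltW q0).
rewrite /bdA big_ord_recr/= mulrDl exprS.
have /andP[_ h] := chain_rho G n.+1; rewrite exprS in h.
apply: (@le_trans _ _ (C / (1 - q) * q + C)).
  by rewrite lerD// mulrCA mulrC ler_pM2r.
by rewrite le_eqVlt; apply/orP; left; apply/eqP; field; rewrite gt_eqF ?subr_gt0.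
Qed.

(** The upper bound C / (1 - q) of A_n q^n divided by the lower bound c^2 of lam_n rho_n q^(3n). *)
Definition eta_const := C / (1 - q) / c ^+ 2.

Lemma eta_const_gt0 : 0 < eta_const.
Proof. by rewrite !divr_gt0 ?exprn_gt0 ?subr_gt0. Qed.

Lemma chain_lam_rho n : c ^+ 2 <= lam n * rho n * (q ^+ 3) ^+ n <= C ^+ 2.
Proof.
have -> : lam n * rho n * (q ^+ 3) ^+ n =
   (lam n * (q ^+ 2) ^+ n) * (rho n * q ^+ n).
  by rewrite (exprAC q 3) (exprAC q 2); ring.
have /andP[h1 h2] := chain_rho G n; have /andP[h3 h4] := chain_lam G n.
have h5 := le_trans (ltW c0) h1; have h6 := le_trans (ltW c0) h3.
by rewrite !expr2 !ler_pM// (ltW c0).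
Qed.

Lemma chain_eta n : eta n <= eta_const * (q ^+ 2) ^+ n.
Proof.
have /andP[h _] := chain_lam_rho n.
have lr0 : 0 < lam n * rho n by rewrite mulr_gt0// (chain_lam_gt0 G).
rewrite /bdeta ler_pdivrMr// -(ler_pM2r (qn0 n)).
apply: le_trans (chain_A n) _.
have -> : eta_const * (q ^+ 2) ^+ n * (lam n * rho n) * q ^+ n =
  eta_const * (lam n * rho n * (q ^+ 3) ^+ n).
  by rewrite (exprAC q 3) (exprAC q 2); ring.
apply: (@le_trans _ _ (eta_const * c ^+ 2)).
  by rewrite /eta_const divfK// gt_eqF// exprn_gt0.
by rewrite ler_pM2l// eta_const_gt0.
Qed.

Lemma chain_eta_sum N : \sum_(j < N) eta j <= eta_const / (1 - q ^+ 2).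
Proof.
have /andP[qq0 qq1] := q01.
apply: (@le_trans _ _ (\sum_(j < N) eta_const * (q ^+ 2) ^+ j)).
  by apply: ler_sum => i _; exact: chain_eta.
rewrite -(big_mkord xpredT (fun j => eta_const * (q ^+ 2) ^+ j)).
have -> : \sum_(0 <= i < N) eta_const * (q ^+ 2) ^+ i = series (geometric eta_const (q^+2)) N by [].
rewrite geometric_seriesE ?lt_eqF//= ler_pM2r ?invr_gt0 ?subr_gt0//.
by rewrite ler_piMr ?(ltW eta_const_gt0)// gerBl exprn_ge0.
Qed.

Lemma bdpi_bounded x : exists2 M : R, 0 < M & forall n, `|pi n x| <= M.
Proof. exact: cvgn_bounded (@pi_phi x). Qed.

(** [ell n x] is a weighted mean of pi_0(x), ..., pi_n(x). *)
Lemma bdell_le x M : (forall n, `|pi n x| <= M) -> forall n, `|ell n x| <= M.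
Proof.
move=> H n; rewrite /bdell normrM normfV (ger0_norm (ltW (A_gt0 n))).
rewrite ler_pdivrMr// /bdA mulr_sumr; apply: le_trans (ler_norm_sum _ _ _) _.
by apply: ler_sum => i _; rewrite normrM (ger0_norm (ltW (rho_gt0 i))) mulrC ler_pM2r.
Qed.

(** The increments x eta_n ell_n are O(q^(2n)) because ell_n stays bounded; with limit phi(x) = 0
    the tail of the increments has the same order. *)
Lemma bdpi_root_decay x : phi x = 0 ->
  exists2 K : R, 0 < K & forall n, `|pi n x| <= K * (q ^+ 2) ^+ n.
Proof.
move=> px; have [M M0 HM] := bdpi_bounded x.
have He n : `|pi n.+1 x - pi n x| <= (`|x| * eta_const * M) * (q ^+ 2) ^+ n.
  rewrite bdpi_sub; [|exact: chain_lam_gt0 G|exact: chain_mu_gt0 G|exact: chain_mu0 G].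
  rewrite normrN (normrM (x * _)) (normrM x) (ger0_norm (ltW (eta_gt0 n))).
  have -> : `|x| * eta_const * M * (q ^+ 2) ^+ n =
    `|x| * (eta_const * (q ^+ 2) ^+ n * M) by ring.
  rewrite -mulrA ler_wpM2l//; apply: ler_pM; rewrite ?normr_ge0 ?(ltW (eta_gt0 n))//.
    exact: chain_eta.
  exact: bdell_le.
have pi0 : pi n x @[n --> \oo] --> (0 : R) by rewrite -px.
have T := @geometric_tail R (pi^~ x) _ (q ^+ 2) 0 q01 (fun n _ => He n) pi0.
(* Adding 1 keeps the constant positive whatever [x] is. *)
exists (`|x| * eta_const * M / (1 - q ^+ 2) + 1).
  apply: ltr_wpDl => //; apply: divr_ge0.
    by apply: mulr_ge0 (ltW M0); apply: mulr_ge0 (ltW eta_const_gt0).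
  by rewrite subr_ge0; case/andP: q01 => _ /ltW.
move=> n; apply: le_trans (T n isT) _.
by rewrite ler_wpM2r ?lerDl// exprn_ge0// exprn_ge0// ltW.
Qed.

Let q3 : 0 <= q ^+ 3 < 1.
Proof. by rewrite exprn_ge0 ?ltW//= exprn_ilt1// ltW. Qed.

(** P_n^2 = rho_n pi_n^2 has order at most q^(-n) q^(4n). *)
Lemma bdP_root_decay x : phi x = 0 ->
  exists2 K : R, 0 < K & forall n, P n x ^+ 2 <= K * (q ^+ 3) ^+ n.
Proof.
move=> /bdpi_root_decay[K K0 HK]; exists (C * K ^+ 2).
  by rewrite mulr_gt0// exprn_gt0.
move=> n; rewrite sqr_bdP; [|exact: chain_lam_gt0 G|exact: chain_mu_gt0 G].
rewrite -(ler_pM2r (qn0 n)) mulrAC.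
have -> : C * K ^+ 2 * (q ^+ 3) ^+ n * q ^+ n = C * (K * (q ^+ 2) ^+ n) ^+ 2.
  by rewrite (exprAC q 3) (exprAC q 2); ring.
have /andP[h1 h2] := chain_rho G n.
apply: ler_pM => //; first exact: le_trans (ltW c0) h1.
  exact: sqr_ge0.
by rewrite -real_normK ?num_real// lerXn2r ?nnegrE// (le_trans _ (HK n)).
Qed.

Let lam_gt0 : forall n, 0 < lam n. Proof. exact: chain_lam_gt0 G. Qed.
Let mu_gt0 : forall n, 0 < mu n.+1. Proof. exact: chain_mu_gt0 G. Qed.
Let mu0 : mu 0 = 0. Proof. exact: chain_mu0 G. Qed.

Lemma bdP_root_series x : phi x = 0 -> cvgn (series (fun n => P n x ^+ 2)).
Proof.
move=> /bdP_root_decay[K K0 HK].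
apply: (@series_le_cvg _ _ (geometric K (q ^+ 3))) => //.
- by move=> n; exact: sqr_ge0.
- by move=> n; apply: le_trans (HK n); exact: sqr_ge0.
- by apply: is_cvg_geometric_series; case/andP: q3 => h1 h2; rewrite ger0_norm.
Qed.

(** The squared l^2 norm of the eigenvector (P_n(x)) when x is a zero of [phi]; its inverse turns
    out to be the mass of x. *)
Definition bdnorm x : R := limn (series (fun n => P n x ^+ 2)).

Lemma bdnorm_cvg x : phi x = 0 ->
  \sum_(j < n) P j x ^+ 2 @[n --> \oo] --> bdnorm x.
Proof.
move=> /bdP_root_series h; rewrite (_ : (fun n => _) = series (fun n => P n x ^+ 2))//.
by apply/funext => n; rewrite /series/= big_mkord.
Qed.

Lemma bdnorm_ge x n : phi x = 0 -> \sum_(j < n) P j x ^+ 2 <= bdnorm x.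
Proof.
move=> px; rewrite -(big_mkord xpredT (fun j => P j x ^+ 2)).
apply: (@nondecreasing_cvgn_le _ (series (fun n => P n x ^+ 2))).
  by apply: nondecreasing_series => i _ _; exact: sqr_ge0.
exact: bdP_root_series.
Qed.

Lemma bdnorm_gt0 x : phi x = 0 -> 0 < bdnorm x.
Proof.
move=> px; apply: lt_le_trans (@bdnorm_ge x 1 px).
by rewrite big_ord_recl big_ord0 addr0 bdP0 expr1n.
Qed.

(** The Christoffel-Darboux boundary term is lam_n rho_n = O(q^(-3n)) times products pi_(n+1) pi_n =
    O(q^(4n)), hence O(q^n). *)
Lemma bdP_orthogonal_roots x t : phi x = 0 -> phi t = 0 -> x != t ->
  \sum_(j < n) P j x * P j t @[n --> \oo] --> (0 : R).
Proof.
move=> px pt xt; have [K K0 HK] := bdpi_root_decay px.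
have [L L0 HL] := bdpi_root_decay pt.
rewrite -cvg_shiftS.
have E n : \sum_(j < n.+1) P j x * P j t =
  (x - t)^-1 * (lam n * rho n * (pi n.+1 t * pi n x - pi n.+1 x * pi n t)).
  rewrite -bdpi_christoffel_darboux// mulKf ?subr_eq0//.
  by apply: eq_bigr => i _; rewrite mul_bdP.
under eq_fun do rewrite E.
apply: cvgn0Z.
apply: cvgn0I => e e0.
have : C ^+ 2 * (2 * (K * L)) * q ^+ n @[n --> \oo] --> (0 : R).
  by apply: cvg_geometric; rewrite ger0_norm// ltW.
move=> /cvgn0_le /(_ _ e0)[N HN]; exists N => n /HN; apply: le_trans.
apply: le_trans _ (ler_norm _).
have B y z Y Z : 0 <= Y -> 0 <= Z -> (forall n, `|pi n y| <= Y * (q ^+ 2) ^+ n) ->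
   (forall n, `|pi n z| <= Z * (q ^+ 2) ^+ n) ->
   `|pi n.+1 y * pi n z| <= Y * Z * (q ^+ 4) ^+ n.
  move=> Y0 Z0 Hy Hz; have -> : Y * Z * (q ^+ 4) ^+ n = (Y * (q ^+ 2) ^+ n) * (Z * (q ^+ 2) ^+ n).
    by rewrite (exprAC q 4) (exprAC q 2); ring.
  rewrite normrM ler_pM//; apply: le_trans (Hy _) _.
  by rewrite exprS ler_wpM2l// ler_piMl ?exprn_ge0 ?exprn_ge0 ?(ltW q0)// ltW; case/andP: q01.
rewrite normrM ger0_norm ?mulr_ge0 ?(ltW (rho_gt0 n)) ?(ltW (lam_gt0 n))//.
rewrite -(ler_pM2r (exprn_gt0 n (exprn_gt0 3 q0))) mulrAC.
have -> : C ^+ 2 * (2 * (K * L)) * q ^+ n * (q ^+ 3) ^+ n =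
   C ^+ 2 * (L * K * (q ^+ 4) ^+ n + K * L * (q ^+ 4) ^+ n).
  by rewrite (exprAC q 3) (exprAC q 4); ring.
have /andP[_ h] := chain_lam_rho n; apply: ler_pM => //.
  by rewrite !mulr_ge0 ?(ltW (rho_gt0 n)) ?(ltW (lam_gt0 n)) ?exprn_ge0 ?ltW.
by apply: le_trans (ler_normB _ _) _; rewrite lerD// B// ltW.
Qed.

(** The boundary term A_n ell_n pi_(n+1) of the Abel summation is O(q^(-n)) O(1) O(q^(2n)) at a
    zero. *)
Lemma bdell_root_sum x : phi x = 0 ->
  x * (\sum_(j < n) A j * eta j * ell j x ^+ 2) @[n --> \oo] --> bdnorm x.
Proof.
move=> px; have [M M0 HM] := bdpi_bounded x; have [K K0 HK] := bdpi_root_decay px.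
rewrite -cvg_shiftS.
have E n : x * (\sum_(j < n.+1) A j * eta j * ell j x ^+ 2) =
  \sum_(j < n.+1) P j x ^+ 2 - A n * ell n x * pi n.+1 x.
  by under [in RHS]eq_bigr do rewrite sqr_bdP//; rewrite bd_sum_sqr// addrK.
under eq_fun do rewrite E.
rewrite -[bdnorm x]subr0; apply: cvgB.
  by have := bdnorm_cvg px; rewrite -cvg_shiftS.
apply: cvgn0I => e e0.
have : C / (1 - q) * M * K * q ^+ n @[n --> \oo] --> (0 : R).
  by apply: cvg_geometric; rewrite ger0_norm// ltW.
move=> /cvgn0_le /(_ _ e0)[N HN]; exists N => n /HN; apply: le_trans.
apply: le_trans _ (ler_norm _).
rewrite !(normrM (_ * _), normrM (A n)) (ger0_norm (ltW (A_gt0 n))).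
rewrite -(ler_pM2r (qn0 n)).
have -> : A n * `|ell n x| * `|pi n.+1 x| * q ^+ n =
  (A n * q ^+ n) * `|ell n x| * `|pi n.+1 x| by ring.
have -> : C / (1 - q) * M * K * q ^+ n * q ^+ n =
  C / (1 - q) * M * (K * (q ^+ 2) ^+ n) by rewrite (exprAC q 2); ring.
apply: ler_pM => //.
- by rewrite !mulr_ge0 ?(ltW (A_gt0 n)) ?(ltW (qn0 n)).
- apply: ler_pM => //; first by rewrite mulr_ge0 ?(ltW (A_gt0 n)) ?(ltW (qn0 n)).
    exact: chain_A.
  exact: bdell_le.
- apply: le_trans (HK _) _.
  by rewrite exprS ler_wpM2l ?(ltW K0)// ler_piMl ?exprn_ge0 ?exprn_ge0 ?(ltW q0)// ltW; case/andP: q01.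
Qed.

End geometric_chains.

(** * Measurability of the inverse; integrals of finite sums *)

Section measurable_inverse.
Variable R : realType.

(* x^-1 = lim x / (x^2 + 1/(n+1)), also at the junk value 0^-1 = 0. *)
Lemma measurable_inv : measurable_fun setT (fun x : R => x^-1).
Proof.
apply: (@measurable_fun_cvg _ (measurableTypeR R) R setT (fun n x => x / (x ^+ 2 + harmonic n))) => [n|x _].
  apply: continuous_measurable_fun => x.
  have n0 : 0 < @harmonic R n by rewrite /harmonic/= invr_gt0 ltr0n.
  apply: cvgM; first exact: cvg_id.
  apply: cvgV; first by rewrite gt_eqF// ltr_wpDl// sqr_ge0.
  by apply: cvgD; [exact: exprn_continuous|exact: cvg_cst].
have [->|x0] := eqVneq x 0.
  by rewrite invr0; under eq_fun do rewrite mul0r; exact: cvg_cst.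
rewrite (_ : x^-1 = x / (x ^+ 2 + 0)); last first.
  by rewrite addr0 expr2 invfM mulrA divff// mul1r.
apply: cvgM; first exact: cvg_cst.
apply: cvgV; first by rewrite addr0 sqrf_eq0.
by apply: cvgD; [exact: cvg_cst|exact: cvg_harmonic].
Qed.

End measurable_inverse.

Section Rintegral_sums.
Context d (T : measurableType d) (R : realType) (m : {measure set T -> \bar R}).
Local Notation integ f := (m.-integrable setT (EFin \o f)).

Lemma Rintegral_ord_sum (f : nat -> T -> R) : (forall i, integ (f i)) ->
  forall n, integ (fun x => \sum_(i < n) f i x) /\
    (\int[m]_x (\sum_(i < n) f i x))%R = \sum_(i < n) (\int[m]_x f i x)%R.
Proof.
move=> If; elim=> [|n [IH1 IH2]].
  under [X in Rintegral _ _ X]eq_fun do rewrite big_ord0.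
  rewrite big_ord0 /Rintegral integral0; split=> //.
  apply: (eq_integrable measurableT (cst 0%:E)); last exact: integrable0.
  by move=> x _; rewrite /= big_ord0.
have E : (fun x => \sum_(i < n.+1) f i x) = (fun x => \sum_(i < n) f i x + f n x).
  by apply/funext => x; rewrite big_ord_recr.
rewrite E RintegralD// big_ord_recr IH2; split=> //.
exact: (integrableD measurableT IH1 (If n)).
Qed.

Lemma Rintegral_EFin (f : T -> R) : integ f ->
  (\int[m]_x (f x)%:E)%E = (\int[m]_x f x)%:E.
Proof. by move=> h; rewrite /Rintegral fineK// integrable_fin_num. Qed.

Lemma integrable_dominated (f g : T -> R) : measurable_fun setT f ->
  (forall x, `|f x| <= g x) -> integ g -> integ f.
Proof.
move=> mf fg ig; apply: le_integrable ig => //; first exact/measurable_EFinP.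
by move=> x _; rewrite /= lee_fin (le_trans (fg x))// ler_norm.
Qed.

End Rintegral_sums.

(** * The orthogonality measure *)

Section orthonormal_chain.
Variables (R : realType) (lam mu : nat -> R).
Implicit Types (x t : R) (n : nat).
Local Notation pi := (bdpi lam mu).
Local Notation rho := (bdrho lam mu).
Local Notation A := (bdA lam mu).
Local Notation eta := (bdeta lam mu).
Local Notation ell := (bdell lam mu).
Local Notation P := (bdP lam mu).
Variables (q c C : R) (phi : R -> R).
Hypothesis G : geometric_chain lam mu q c C.
Hypothesis pi_phi : forall x, pi n x @[n --> \oo] --> phi x.
Variable m : probability (measurableTypeR R) R.
Hypothesis orth : forall i j,
  (\int[m]_x (P i x * P j x)%:E = ((i == j)%:R : R)%:E)%E.
Local Notation integ f := (m.-integrable setT (EFin \o f)).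
Local Notation Z := [set x | phi x = 0].

Let lam_gt0 : forall n, 0 < lam n. Proof. exact: chain_lam_gt0 G. Qed.
Let mu_gt0 : forall n, 0 < mu n.+1. Proof. exact: chain_mu_gt0 G. Qed.
Let mu0 : mu 0 = 0. Proof. exact: chain_mu0 G. Qed.
Let rho_gt0 n : 0 < rho n. Proof. exact: bdrho_gt0. Qed.
Let A_gt0 n : 0 < A n. Proof. exact: bdA_gt0. Qed.

Lemma measurable_bdpi n : measurable_fun setT (pi n : measurableTypeR R -> R).
Proof.
suff [] : measurable_fun setT (pi n : measurableTypeR R -> R) /\
  measurable_fun setT (bdstep lam mu n : measurableTypeR R -> R) by [].
elim: n => [|n [IH1 IH2]].
  by split; [apply: measurable_cst|apply: measurable_cst].
have H : measurable_fun setT (bdstep lam mu n.+1 : measurableTypeR R -> R).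
  apply: measurable_funM; last exact: measurable_cst.
  apply: measurable_funB; first by apply: measurable_funM => //; exact: measurable_cst.
  by apply: measurable_funM => //; exact: measurable_id.
by split=> //; exact: measurable_funD.
Qed.

Lemma measurable_bdP n : measurable_fun setT (P n : measurableTypeR R -> R).
Proof. by apply: measurable_funM; [exact: measurable_cst|exact: measurable_bdpi]. Qed.

Lemma measurable_limit : measurable_fun setT (phi : measurableTypeR R -> R).
Proof.
apply: (@measurable_fun_cvg _ (measurableTypeR R) R setT (fun n => pi n)).
  exact: measurable_bdpi.
by move=> x _; exact: pi_phi.
Qed.

Lemma measurable_roots : measurable (Z : set (measurableTypeR R)).
Proof.
rewrite (_ : Z = setT `&` phi @^-1` [set 0]); last by rewrite setTI.
by apply: measurable_limit => //; exact: measurable_set1.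
Qed.

Lemma integrable_sqr_bdP n : integ (fun x => P n x * P n x).
Proof.
have mP := measurable_bdP n; apply/integrableP; split.
  by apply/measurable_EFinP; exact: measurable_funM.
under eq_integral do rewrite /= -expr2 ger0_norm ?sqr_ge0// expr2.
by rewrite orth ltry.
Qed.

Lemma integrable_bdPP i j : integ (fun x => P i x * P j x).
Proof.
apply: (@integrable_dominated _ (measurableTypeR R) R m (fun x => P i x * P j x)
  (fun x => P i x * P i x + P j x * P j x)).
- by apply: measurable_funM; exact: measurable_bdP.
- by move=> x; rewrite ler_norml; nra.
- exact: (integrableD measurableT (integrable_sqr_bdP i) (integrable_sqr_bdP j)).
Qed.

Lemma Rintegral_bdPP i j : (\int[m]_x (P i x * P j x))%R = (i == j)%:R.
Proof. by rewrite /Rintegral orth. Qed.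

Lemma integrable_bdP i : integ (P i).
Proof.
rewrite (_ : P i = fun x => P i x * P 0 x); first exact: integrable_bdPP.
by apply/funext => x; rewrite bdP0 mulr1.
Qed.

Lemma Rintegral_bdP i : (\int[m]_x P i x)%R = (i == 0)%:R.
Proof.
by rewrite -Rintegral_bdPP; apply: eq_Rintegral => x _; rewrite bdP0 mulr1.
Qed.

Lemma Rintegral_sqr_comb (a : nat -> R) n :
  integ (fun x => (\sum_(i < n) a i * P i x) ^+ 2) /\
  (\int[m]_x ((\sum_(i < n) a i * P i x) ^+ 2))%R = \sum_(i < n) a i ^+ 2.
Proof.
have I2 i j : integ (fun x => a i * a j * (P i x * P j x)).
  exact: (integrableZl measurableT (a i * a j) (integrable_bdPP i j)).
have I1 i := Rintegral_ord_sum (I2 i) n.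
have I := Rintegral_ord_sum (fun i => (I1 i).1) n.
have E : (fun x => (\sum_(i < n) a i * P i x) ^+ 2) =
   (fun x => \sum_(i < n) \sum_(j < n) a i * a j * (P i x * P j x)).
  apply/funext => x; rewrite expr2 mulr_suml; apply: eq_bigr => i _.
  by rewrite mulr_sumr; apply: eq_bigr => j _; ring.
rewrite E; case: I => I ->; split=> //.
apply: eq_bigr => i _; rewrite (I1 i).2 (bigD1 i)//= big1 ?addr0.
  by rewrite RintegralZl//; [rewrite Rintegral_bdPP eqxx mulr1 expr2|exact: integrable_bdPP].
move=> j ji; rewrite RintegralZl//; last exact: integrable_bdPP.
have ij : (i == j :> nat) = false by rewrite eq_sym; exact: negbTE.
by rewrite Rintegral_bdPP ij mulr0.
Qed.

(** Parseval: ell_n has the coefficients (-1)^j sqrt(rho_j) / A_n with respect to the P_j, and their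
    squares add up to A_n / A_n^2. *)
Lemma Rintegral_sqr_bdell n : integ (fun x => ell n x ^+ 2) /\
  (\int[m]_x (ell n x ^+ 2))%R = (A n)^-1.
Proof.
have E : (fun x => ell n x ^+ 2) = (fun x =>
    (\sum_(j < n.+1) ((-1) ^+ j * Num.sqrt (rho j) / A n) * P j x) ^+ 2).
  apply/funext => x; congr (_ ^+ 2); rewrite /bdell mulr_suml.
  apply: eq_bigr => j _; rewrite /bdP.
  transitivity (((-1) ^+ j) ^+ 2 * (Num.sqrt (rho j)) ^+ 2 * pi j x / A n).
    by rewrite sqrr_sign sqr_sqrtr ?mul1r// ltW.
  by ring.
rewrite E; have [h ->] := Rintegral_sqr_comb
  (fun j => (-1) ^+ j * Num.sqrt (rho j) / A n) n.+1; split=> //.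
under eq_bigr => j _ do
  rewrite !exprMn sqrr_sign mul1r sqr_sqrtr ?(ltW (rho_gt0 j))//.
by rewrite -mulr_suml -/(A n) exprVn expr2 invfM mulrA divff ?mul1r// gt_eqF.
Qed.

(* Fatou: the L2 norm of pi_n is 1 / rho_n, which tends to 0. *)
Lemma measure_nonroots : m (~` Z) = 0%E.
Proof.
have mphi2 : measurable_fun setT (fun x : measurableTypeR R => (phi x ^+ 2)%:E).
  by apply/measurable_EFinP; apply: measurable_funX; exact: measurable_limit.
have I0 : (\int[m]_x (phi x ^+ 2)%:E = 0)%E.
  apply/eqP; rewrite eq_le; apply/andP; split; last first.
    by apply: integral_ge0 => x _; rewrite lee_fin sqr_ge0.
  have E x : limn_einf (fun n => (pi n x ^+ 2)%:E) = (phi x ^+ 2)%:E.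
    have /cvg_limn_einf_sup[-> _] // : (pi n x ^+ 2)%:E @[n --> \oo] --> (phi x ^+ 2)%:E.
    apply/cvg_EFin; first by near=> n.
    exact: (cvgn_sqr (@pi_phi x)).
  under eq_integral do rewrite -E.
  apply: le_trans (fatou _ _ _ _) _ => //.
  - by move=> n; apply/measurable_EFinP; apply: measurable_funX; exact: measurable_bdpi.
  - by move=> n x _; rewrite lee_fin sqr_ge0.
  have L : (\int[m]_x (pi n x ^+ 2)%:E)%E @[n --> \oo] --> (0%:E : \bar R).
    have -> : (fun n => (\int[m]_x (pi n x ^+ 2)%:E)%E) = (fun n => ((rho n)^-1)%:E).
      apply/funext => n.
      have -> : (fun x => (pi n x ^+ 2)%:E) =
          (fun x => ((rho n)^-1%:E * (P n x * P n x)%:E)%E).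
        apply/funext => x; rewrite -EFinM -expr2 sqr_bdP// mulKf// gt_eqF//.
      rewrite integralZl//; last exact: integrable_sqr_bdP.
      by rewrite orth eqxx mule1.
    apply/cvg_EFin; first by near=> n.
    exact: (chain_inv_rho_cvg0 G).
  by have [-> _] := cvg_limn_einf_sup L.
have /(ae_eq_integral_abs m measurableT mphi2) :
    (\int[m]_x `|(phi x ^+ 2)%:E| = 0)%E.
  by under eq_integral do rewrite gee0_abs ?lee_fin ?sqr_ge0//.
move=> H; apply/negligibleP; first by apply: measurableC; exact: measurable_roots.
apply: negligibleS H => x /= nz; rewrite not_implyE; split=> //.
by move=> [] /eqP; rewrite sqrf_eq0 => /eqP.
Unshelve. all: by end_near. Qed.

End orthonormal_chain.

(** * Point masses of the measure *)

Section atoms.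
Variables (R : realType) (m : probability (measurableTypeR R) R).
Local Notation integ f :=
  (m.-integrable [set: measurableTypeR R] (EFin \o (f : measurableTypeR R -> R))).

Lemma integrable_atom (x : R) : integ (\1_[set x] : R -> R).
Proof. by apply: integrable_indic => //; exact: measurable_set1. Qed.

Lemma Rintegral_atom (x : R) : (\int[m]_t (\1_[set x] t : R))%R = fine (m [set x]).
Proof.
by rewrite /Rintegral integral_indic ?setIT//; exact: measurable_set1.
Qed.

(** The sum is the integral of the f(zeta_k) times the indicators of the zeta_k; as these points are
    distinct, the integrand is at most f pointwise. *)
Lemma sum_atoms_le (f : R -> R) (zeta : nat -> R) K : injective zeta ->
  (forall x, 0 <= f x) -> integ f ->
  \sum_(k < K) f (zeta k) * fine (m [set zeta k]) <= (\int[m]_x f x)%R.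
Proof.
move=> zi f0 If.
have I k : integ (fun t => f (zeta k) * \1_[set zeta k] t).
  exact: (integrableZl measurableT (f (zeta k)) (integrable_atom (zeta k))).
have [IS ES] := @Rintegral_ord_sum _ (measurableTypeR R) R m _ I K.
have -> : \sum_(k < K) f (zeta k) * fine (m [set zeta k]) =
    (\int[m]_t (\sum_(k < K) f (zeta k) * \1_[set zeta k] t))%R.
  rewrite ES; apply: eq_bigr => k _.
  by rewrite RintegralZl ?Rintegral_atom//; exact: integrable_atom.
apply: le_Rintegral => // t _.
have [[j tj]|tz] := pselect (exists j : 'I_K, t = zeta j).
  rewrite (bigD1 j)//= big1 ?addr0 => [|k kj].
    by rewrite {2}tj indicE mem_set ?mulr1 ?tj.
  rewrite indicE memNset ?mulr0// => /= tk.
  by move/eqP: kj; apply; apply/val_inj/zi; rewrite -tk.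
rewrite big1// => k _; rewrite indicE memNset ?mulr0// => /= tk.
by apply: tz; exists k.
Qed.

End atoms.

(** * Masses of the zeros and the sum of their inverses *)

Section masses.
Variables (R : realType) (lam mu : nat -> R).
Implicit Types (x t : R) (n : nat).
Local Notation pi := (bdpi lam mu).
Local Notation rho := (bdrho lam mu).
Local Notation A := (bdA lam mu).
Local Notation eta := (bdeta lam mu).
Local Notation ell := (bdell lam mu).
Local Notation P := (bdP lam mu).
Variables (q c C : R) (phi : R -> R).
Hypothesis G : geometric_chain lam mu q c C.
Hypothesis pi_phi : forall x, pi n x @[n --> \oo] --> phi x.
Variable m : probability (measurableTypeR R) R.
Hypothesis orth : forall i j,
  (\int[m]_x (P i x * P j x)%:E = ((i == j)%:R : R)%:E)%E.
Local Notation integ f :=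
  (m.-integrable [set: measurableTypeR R] (EFin \o (f : measurableTypeR R -> R))).

Let q0 : 0 < q. Proof. by have /andP[] := chain_q G. Qed.
Let q1 : q < 1. Proof. by have /andP[] := chain_q G. Qed.
Let lam_gt0 : forall n, 0 < lam n. Proof. exact: chain_lam_gt0 G. Qed.
Let mu_gt0 : forall n, 0 < mu n.+1. Proof. exact: chain_mu_gt0 G. Qed.
Let mu0 : mu 0 = 0. Proof. exact: chain_mu0 G. Qed.
Let A_gt0 n : 0 < A n. Proof. exact: bdA_gt0. Qed.
Let eta_gt0 n : 0 < eta n. Proof. exact: bdeta_gt0. Qed.

(** For x <= 0 all pi_n(x) are at least 1, so their limit cannot be 0; the contradiction is reached
    in the form 0 <= -1. *)
Lemma bdroot_gt0 x : phi x = 0 -> 0 < x.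
Proof.
move=> px; rewrite ltNge; apply/negP => x0.
have : 0 <= -1 :> R; last by rewrite ler0N1.
apply: (@cvgn_le _ (fun n => - pi n x)); last first.
  by move=> n; rewrite lerN2; apply: bdpi_ge1.
by rewrite -oppr0 -px; apply: cvgN; exact: pi_phi.
Qed.

(* The partial sums of the kernel sum_n P_n(x) P_n(t) have integral 1, converge
   to bdnorm x at t = x and to 0 at the other roots. *)
Lemma measure_root x : phi x = 0 -> m [set x] = ((bdnorm lam mu x)^-1)%:E.
Proof.
move=> px; have [K K0 HK] := bdP_root_decay G pi_phi px.
have k0 := bdnorm_gt0 G pi_phi px.
pose f_ N (t : measurableTypeR R) : \bar R := (\sum_(n < N) P n x * P n t)%:E.
pose f (t : measurableTypeR R) : \bar R := (bdnorm lam mu x * \1_[set x] t)%:E.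
(* Terms of the dominating series: |u v| <= q^(-n) u^2 + q^n v^2 with u = P_n(x), v = P_n(t) and u^2
   <= K q^(3n). Since P_n^2 has integral 1, the integrals of the [h n] are summable. *)
pose h n (t : measurableTypeR R) : R := K * (q ^+ 2) ^+ n + q ^+ n * P n t ^+ 2.
pose g (t : measurableTypeR R) : \bar R := (\sum_(0 <= n <oo) (h n t)%:E)%E.
have h0 n t : 0 <= h n t.
  by rewrite addr_ge0// mulr_ge0 ?sqr_ge0 ?exprn_ge0 ?exprn_ge0 ?ltW.
have IPP n : integ (fun t => P n t ^+ 2).
  rewrite (_ : (fun t => P n t ^+ 2) = (fun t => P n t * P n t)).
    exact: (integrable_sqr_bdP orth).
  by apply/funext => t; rewrite expr2.
have I1 n : integ (fun=> K * (q ^+ 2) ^+ n).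
  exact: finite_measure_integrable_cst.
have I2 n : integ (fun t => q ^+ n * P n t ^+ 2).
  exact: (integrableZl measurableT (q ^+ n) (IPP n)).
have Ih n : integ (h n) by exact: (integrableD measurableT (I1 n) (I2 n)).
have Eh n : (\int[m]_t (h n t)%:E = (K * (q ^+ 2) ^+ n + q ^+ n)%:E)%E.
  rewrite (@Rintegral_EFin _ (measurableTypeR R) R m)// RintegralD//.
  rewrite Rintegral_cst// RintegralZl//= probability_setT/= mulr1.
  congr (_ + _)%:E; rewrite -[RHS]mulr1; congr (_ * _).
  by under eq_Rintegral do rewrite expr2; rewrite (Rintegral_bdPP orth) eqxx.
have mh n : measurable_fun setT (fun t => (h n t)%:E).
  by have /integrableP[] := Ih n.
have g0 t : (0 <= g t)%E.
  by apply: nneseries_ge0 => n _ _; rewrite lee_fin.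
have mg : measurable_fun setT g.
  apply: (@ge0_emeasurable_sum _ (measurableTypeR R) R setT
    (fun n t => (h n t)%:E) xpredT).
    by move=> k t _ _; rewrite lee_fin.
  by move=> k _; exact: mh.
have Ig : m.-integrable setT g.
  apply/integrableP; split; first exact: mg.
  under eq_integral do rewrite gee0_abs//.
  rewrite integral_nneseries//; last by move=> n t _; rewrite lee_fin.
  under eq_eseriesr do rewrite Eh.
  apply: (@le_lt_trans _ _ ((K / (1 - q ^+ 2) + 1 / (1 - q))%:E)); last exact: ltry.
  apply: lime_le; first by apply: is_cvg_nneseries => n _ _; rewrite lee_fin addr_ge0 ?mulr_ge0 ?exprn_ge0 ?exprn_ge0 ?ltW.
  apply: nearW => n; rewrite sumEFin lee_fin big_split/=.
  have GS (a z : R) : 0 <= a -> 0 <= z < 1 -> \sum_(0 <= i < n) a * z ^+ i <= a / (1 - z).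
    move=> a0 /andP[z0 z1].
    have -> : \sum_(0 <= i < n) a * z ^+ i = series (geometric a z) n by [].
    rewrite geometric_seriesE ?lt_eqF//= ler_pM2r ?invr_gt0 ?subr_gt0//.
    by rewrite ler_piMr// gerBl exprn_ge0.
  apply: lerD; first by apply: GS; rewrite ?(ltW K0)// exprn_ge0 ?(ltW q0)// exprn_ilt1// ltW.
  under eq_bigr do rewrite -[q ^+ _]mul1r.
  by apply: GS; rewrite ?ltW.
have mf_ N : measurable_fun setT (f_ N).
  apply/measurable_EFinP; apply: measurable_sum => n.
  by apply: measurable_funM; [exact: measurable_cst|exact: measurable_bdP].
have mf : measurable_fun setT f.
  apply/measurable_EFinP; apply: measurable_funM; first exact: measurable_cst.
  by apply: measurable_indic; exact: measurable_set1.
have aeZ : \forall t \ae m, phi t = 0.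
  have := measure_nonroots G pi_phi orth.
  move/(negligibleP m (measurableC (measurable_roots pi_phi))).
  by apply: negligibleS.
(* Convergence of the kernel is available only at the zeros of phi, which is enough because they
   carry all the mass. *)
have cvf : \forall t \ae m, [set: measurableTypeR R] t -> f_ N t @[N --> \oo] --> f t.
  apply: negligibleS aeZ => t /= nt pt; apply: nt => _.
  apply/cvg_EFin; first by near=> n.
  rewrite /f /f_; have [<-|tx] := eqVneq x t.
    rewrite /= indicE mem_set// mulr1.
    by have := bdnorm_cvg G pi_phi px; under eq_fun do under eq_bigr do rewrite expr2.
  rewrite /= indicE memNset ?mulr0//; first exact: (bdP_orthogonal_roots G pi_phi).
  by move=> /= e; move: tx; rewrite e eqxx.
have dom : \forall t \ae m, forall N, [set: measurableTypeR R] t -> (`|f_ N t| <= g t)%E.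
  apply: aeW => t N _; apply: (@le_trans _ _ (\sum_(0 <= n < N) (h n t)%:E)%E).
    rewrite sumEFin lee_fin big_mkord; apply: le_trans (ler_norm_sum _ _ _) _.
    apply: ler_sum => n _; rewrite normrM.
    have qn : 0 < q ^+ n by rewrite exprn_gt0.
    have : P n x ^+ 2 <= K * (q ^+ 2) ^+ n * q ^+ n.
      apply: le_trans (HK n) _; rewrite le_eqVlt; apply/orP; left; apply/eqP.
      by rewrite (exprAC q 3) (exprAC q 2); ring.
    rewrite -(real_normK (num_real (P n x))) /h -(real_normK (num_real (P n t))).
    set a := `|P n x|; set b := `|P n t|; set e := K * _ => H.
    have a0 : 0 <= a by exact: normr_ge0. have b0 : 0 <= b by exact: normr_ge0.
    rewrite -(ler_pM2r qn).
    have : 0 <= (a - q ^+ n * b) ^+ 2 by exact: sqr_ge0.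
    by have := mulr_ge0 a0 (mulr_ge0 b0 (ltW qn)); nra.
  by apply: nneseries_lim_ge => n _ _; rewrite lee_fin.
have [_ _ L] := dominated_convergence measurableT mf_ mf cvf Ig dom.
(* Every P_n with n > 0 has integral 0, so only the term n = 0 counts; the index [N.+1] ensures that
   it is present. *)
have E1 N : (\int[m]_t f_ N.+1 t = 1%:E)%E.
  have IP n : integ (fun t => P n x * P n t).
    exact: (integrableZl measurableT (P n x) (integrable_bdP orth n)).
  have [IS ES] := @Rintegral_ord_sum _ (measurableTypeR R) R m _ IP N.+1.
  rewrite (@Rintegral_EFin _ (measurableTypeR R) R m)// ES.
  rewrite big_ord_recl big1 ?addr0 => [|i _].
    rewrite RintegralZl//; last exact: (integrable_bdP orth).
    by rewrite (Rintegral_bdP orth) bdP0 eqxx mulr1.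
  by rewrite RintegralZl ?(Rintegral_bdP orth) ?mulr0//; exact: (integrable_bdP orth).
have E2 : (\int[m]_t f t = (bdnorm lam mu x * fine (m [set x]))%:E)%E.
  rewrite (@Rintegral_EFin _ (measurableTypeR R) R m); last first.
    exact: (integrableZl measurableT _ (integrable_atom m x)).
  by rewrite RintegralZl ?Rintegral_atom//; exact: integrable_atom.
have : (bdnorm lam mu x * fine (m [set x]))%:E = 1%:E :> \bar R.
  rewrite -E2; move: L; rewrite -cvg_shiftS.
  rewrite (_ : (fun n => _) = fun=> 1%:E); last by apply/funext => n; exact: E1.
  by move=> /(cvg_unique (@ereal_hausdorff R)); apply; exact: cvg_cst.
move=> [e]; rewrite -[LHS]fineK; last first.
  by apply: fin_num_measure; exact: measurable_set1.
have kn0 : bdnorm lam mu x != 0 by rewrite gt_eqF.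
by congr EFin; apply: (mulfI kn0); rewrite e divff.
Unshelve. all: by end_near. Qed.

(* For n fixed, the atoms contribute at most int ell_n^2 dm = 1 / A_n, while
   sum_n A_n eta_n ell_n(x)^2 m{x} = 1 / x at a root x; sum_n eta_n is the trace
   of the inverse Jacobi operator. *)
Lemma sum_inv_roots_le (zeta : nat -> R) K : injective zeta ->
  (forall k, phi (zeta k) = 0) ->
  \sum_(k < K) (zeta k)^-1 <= eta_const q c C / (1 - q ^+ 2).
Proof.
move=> zi pz; have z0 k := bdroot_gt0 (pz k).
have mk k : fine (m [set zeta k]) = (bdnorm lam mu (zeta k))^-1.
  by rewrite measure_root.
pose S N k := \sum_(n < N) A n * eta n * ell n (zeta k) ^+ 2.
apply: (@cvgn_le _ (fun N => \sum_(k < K) S N k * fine (m [set zeta k]))).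
  apply: (@cvgn_sum _ (fun k N => S N k * fine (m [set zeta k])) (fun k => (zeta k)^-1)) => k.
  have k0 := bdnorm_gt0 G pi_phi (pz k).
  have -> : (zeta k)^-1 = ((zeta k)^-1 / bdnorm lam mu (zeta k)) * bdnorm lam mu (zeta k).
    by rewrite divfK// gt_eqF.
  have E N : S N k * fine (m [set zeta k]) =
      ((zeta k)^-1 / bdnorm lam mu (zeta k)) * (zeta k * S N k).
    by rewrite mk; field; rewrite !gt_eqF.
  under eq_fun do rewrite E.
  by apply: cvgMl_tmp; exact: (bdell_root_sum G pi_phi (pz k)).
move=> N; apply: le_trans (chain_eta_sum G N).
rewrite /S; under eq_bigr do rewrite mulr_suml.
rewrite exchange_big/=; apply: ler_sum => n _.
have [I E] := Rintegral_sqr_bdell G orth n.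
have := sum_atoms_le K zi (fun x => sqr_ge0 (ell n x)) I; rewrite E => H.
under eq_bigr do rewrite -mulrA; rewrite -mulr_sumr.
apply: (@le_trans _ _ (A n * eta n * (A n)^-1)).
  by rewrite ler_wpM2l// mulr_ge0// ltW.
by rewrite mulrAC divff ?mul1r// gt_eqF.
Qed.

End masses.

(** * The Jacobi operator *)

Section real_green.
Variables (R : realType) (a b : nat -> R).
Implicit Types (u y P Q : nat -> R) (n : nat) (z p D Y : R).

(** The action of the matrix on real sequences; it is applied to real and imaginary parts
    separately, for real spectral parameters. *)
Definition real_jacobi u n : R :=
  (if n is m.+1 then a m * u m else 0) + b n * u n + a n * u n.+1.

Hypothesis a_gt0 : forall n, 0 < a n.

(** As no a_n vanishes, the three-term recurrence determines a solution from its value at 0. *)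
Lemma real_jacobi_eigen_uniq z u P : P 0 = 1 ->
  (forall n, real_jacobi P n = z * P n) ->
  (forall n, real_jacobi u n = z * u n) -> forall n, u n = u 0 * P n.
Proof.
move=> P0 hP hu n; suff [] : u n = u 0 * P n /\ u n.+1 = u 0 * P n.+1 by [].
have an0 k : a k != 0 by rewrite gt_eqF.
elim: n => [|n [IH1 IH2]].
  rewrite P0 mulr1; split=> //; apply: (mulfI (an0 0)).
  have := hP 0; have := hu 0; rewrite /real_jacobi P0 !add0r mulr1 => h1 h2.
  have -> : a 0 * u 1 = (z - b 0) * u 0 by rewrite mulrBl -h1; ring.
  have h3 : a 0 * P 1 = z - b 0 by lra.
  by rewrite mulrCA h3 mulrC.
split=> //; apply: (mulfI (an0 n.+1)).
have := hP n.+1; have := hu n.+1; rewrite /real_jacobi IH1 IH2 => h1 h2.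
have -> : a n.+1 * u n.+2 = u 0 * ((z - b n.+1) * P n.+1 - a n * P n).
  have -> : a n.+1 * u n.+2 = z * (u 0 * P n.+1) - (a n * (u 0 * P n) + b n.+1 * (u 0 * P n.+1)).
    by rewrite -h1; ring.
  by ring.
have h3 : a n.+1 * P n.+2 = (z - b n.+1) * P n.+1 - a n * P n.
  have -> : (z - b n.+1) * P n.+1 = z * P n.+1 - b n.+1 * P n.+1 by ring.
  by rewrite -h2; ring.
by rewrite mulrCA h3.
Qed.

(** The discrete Wronskian of two solutions is constant; the inhomogeneity of Q at n = 0 gives it
    the value -1. *)
Lemma real_jacobi_wronskian z P Q : P 0 = 1 ->
  (forall n, real_jacobi P n = z * P n) ->
  (forall n, real_jacobi Q n = z * Q n + (n == 0%N)%:R) ->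
  forall n, a n * (P n.+1 * Q n - P n * Q n.+1) = -1.
Proof.
move=> P0 hP hQ; elim=> [|n IH].
  have := hP 0; have := hQ 0; rewrite /real_jacobi P0 !add0r /= => h1 h2.
  have -> : a 0 * (P 1 * Q 0 - 1 * Q 1) = (a 0 * P 1) * Q 0 - a 0 * Q 1 by ring.
  have -> : a 0 * P 1 = z - b 0 by lra.
  have -> : a 0 * Q 1 = (z - b 0) * Q 0 + 1 by rewrite mulrBl; lra.
  by ring.
have := hP n.+1; have := hQ n.+1; rewrite /real_jacobi /= => h1 h2; rewrite -IH.
have -> : a n.+1 * (P n.+2 * Q n.+1 - P n.+1 * Q n.+2) =
    (a n.+1 * P n.+2) * Q n.+1 - P n.+1 * (a n.+1 * Q n.+2) by ring.
have -> : a n.+1 * P n.+2 = z * P n.+1 - (a n * P n + b n.+1 * P n.+1).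
  by rewrite -h2; ring.
have -> : a n.+1 * Q n.+2 = z * Q n.+1 - (a n * Q n + b n.+1 * Q n.+1).
  by move: h1; rewrite addr0 => <-; ring.
by ring.
Qed.

Lemma affine_recursion_le (v y : nat -> R) p Y : 0 <= p < 1 -> 0 <= Y -> v 0 <= Y / (1 - p) ->
  (forall n, v n.+1 = p * v n + y n.+1) -> (forall n, y n <= Y) ->
  forall n, v n <= Y / (1 - p).
Proof.
move=> /andP[p0 p1] Y0 v0 hv hy; elim=> [//|n IH].
have p1' : 0 < 1 - p by rewrite subr_gt0.
rewrite hv; apply: (@le_trans _ _ (p * (Y / (1 - p)) + Y)).
  by rewrite lerD// ler_wpM2l.
by rewrite le_eqVlt; apply/orP; left; apply/eqP; field; rewrite gt_eqF.
Qed.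

Lemma affine_recursion_cvg0 (v y : nat -> R) p : 0 <= p < 1 ->
  (forall n, 0 <= v n) ->
  (forall n, v n.+1 = p * v n + y n.+1) -> y @ \oo --> (0 : R) ->
  v @ \oo --> (0 : R).
Proof.
move=> /andP[p0 p1] v0 hv y0; apply: cvgn0I => e e0.
have p1' : 0 < 1 - p by rewrite subr_gt0.
have e20 : 0 < e / 2 by rewrite divr_gt0.
have [N HN] := cvgn0_le y0 (mulr_gt0 e20 p1').
have H k : v (N + k)%N <= p ^+ k * v N + e / 2.
  elim: k => [|k IH]; first by rewrite addn0 expr0 mul1r lerDl ltW.
  rewrite addnS hv exprS.
  have := HN (N + k).+1 (leq_trans (leq_addr _ _) (leqnSn _)).
  move=> /(le_trans (ler_norm _)) hy.
  have : p * v (N + k)%N <= p * (p ^+ k * v N + e / 2) by rewrite ler_wpM2l.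
  by rewrite mulrDr -mulrA; lra.
have : v N * p ^+ n @[n --> \oo] --> (0 : R).
  by apply: cvg_geometric; rewrite ger0_norm.
move=> /cvgn0_le /(_ _ e20)[M HM].
exists (N + M)%N => n Nn; rewrite ger0_norm//.
rewrite -(subnKC (leq_trans (leq_addr _ _) Nn)); apply: le_trans (H _) _.
have /HM /(le_trans (ler_norm _)) : (M <= n - N)%N by rewrite leq_subRL// (leq_trans (leq_addr _ _) Nn).
by lra.
Qed.

(** Variation of constants: g_n = Q_n (sum of P_m y_m over m <= n) + P_n (sum of Q_m y_m over m >
    n). With P_n = O(p^(-n)) and Q_n = O(p^(5n)) both parts are O(p^(4n)). The last conclusion
    improves this to o(p^(4n)) because y tends to 0; it is needed since the matrix entries may grow
    exactly like p^(-4n). *)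
Lemma real_green z P Q p D : 0 < p < 1 -> 0 < D -> P 0 = 1 ->
  (forall n, real_jacobi P n = z * P n) ->
  (forall n, real_jacobi Q n = z * Q n + (n == 0%N)%:R) ->
  (forall n, `|P n| * p ^+ n <= D) -> (forall n, `|Q n| <= D * (p ^+ 5) ^+ n) ->
  forall y Y, 0 <= Y -> (forall n, `|y n| <= Y) -> y @ \oo --> (0 : R) ->
  exists g : nat -> R,
   [/\ forall n, real_jacobi g n = z * g n + y n,
       forall n, `|g n| <= (D ^+ 2 / (1 - p) + D ^+ 2 / (1 - p ^+ 5)) * Y * (p ^+ 4) ^+ n &
       g n / (p ^+ 4) ^+ n @[n --> \oo] --> (0 : R)].
Proof.
move=> /andP[p0 p1] D0 P0 hP hQ bP bQ y Y Y0 yY y0.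
have p5 : 0 <= p ^+ 5 < 1 by rewrite exprn_ge0 ?ltW//= exprn_ilt1// ltW.
have pn n : 0 < p ^+ n by rewrite exprn_gt0.
have p4n n : 0 < (p ^+ 4) ^+ n by rewrite !exprn_gt0.
have W := real_jacobi_wronskian P0 hP hQ.
pose t n := Q n * y n.
have ct : cvgn (series t).
  apply: normed_cvg; apply: (@series_le_cvg _ _ (geometric (D * Y) (p ^+ 5))) => //.
  - by move=> n; exact: normr_ge0.
  - move=> n; apply: mulr_ge0; first by rewrite mulr_ge0 ?(ltW D0).
    by rewrite exprn_ge0//; case/andP: p5.
  - move=> n; rewrite /geometric/= /t normrM mulrAC ler_pM//.
  - by apply: is_cvg_geometric_series; case/andP: p5 => h1 h2; rewrite ger0_norm.
pose S n := \sum_(m < n.+1) P m * y m.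
pose T n := limn (series t) - series t n.+1.
have SS n : S n.+1 = S n + P n.+1 * y n.+1 by rewrite /S big_ord_recr.
have TS n : T n.+1 = T n - Q n.+1 * y n.+1.
  by rewrite /T seriesEnat/= big_nat_recr//= opprD addrA.
have T0 : T @ \oo --> (0 : R).
  rewrite -(subrr (limn (series t))); apply: cvgB; first exact: cvg_cst.
  by rewrite cvg_shiftS.
(* Stated for an arbitrary start [N] and bound [e]: [N = 0], [e = Y] gives the uniform estimate, a
   small [e] gives the vanishing of the quotient. *)
have Tb N e : 0 <= e -> (forall n, (N <= n)%N -> `|y n| <= e) -> forall n, (N <= n)%N ->
    `|T n| <= D * e / (1 - p ^+ 5) * (p ^+ 5) ^+ n.
  move=> e0 He; apply: geometric_tail => // n Nn.
  rewrite TS addrAC subrr add0r normrN normrM.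
  apply: (@le_trans _ _ (D * (p ^+ 5) ^+ n.+1 * e)).
    by apply: ler_pM => //; apply: He; rewrite leqW.
  rewrite mulrAC ler_wpM2l ?mulr_ge0 ?(ltW D0)// exprS ler_piMl//.
    by rewrite exprn_ge0//; case/andP: p5.
  by case/andP: p5 => _ /ltW.
have PT N e : 0 <= e -> (forall n, (N <= n)%N -> `|y n| <= e) -> forall n, (N <= n)%N ->
    `|P n * T n| <= D ^+ 2 / (1 - p ^+ 5) * e * (p ^+ 4) ^+ n.
  move=> e0 He n Nn; rewrite normrM -(ler_pM2r (pn n)) mulrAC.
  apply: (@le_trans _ _ (D * (D * e / (1 - p ^+ 5) * (p ^+ 5) ^+ n))).
    by apply: ler_pM => //; [rewrite mulr_ge0// ltW|exact: Tb Nn].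
  rewrite le_eqVlt; apply/orP; left; apply/eqP.
  by rewrite (exprAC p 5) (exprAC p 4); ring.
(* A convolution of |y| with powers of p. It dominates |S_n| p^n up to the factor D and obeys an
   affine recursion with ratio p, hence is bounded by Y / (1 - p) and tends to 0 along with y. *)
pose V n := \sum_(m < n.+1) p ^+ (n - m) * `|y m|.
have VS n : V n.+1 = p * V n + `|y n.+1|.
  rewrite /V big_ord_recr/= subnn expr0 mul1r mulr_sumr; congr (_ + _).
  by apply: eq_bigr => i _; rewrite subSn ?exprS ?mulrA// -ltnS.
have V0 n : 0 <= V n by apply: sumr_ge0 => i _; rewrite mulr_ge0// ltW.
have QS n : `|Q n * S n| <= D ^+ 2 * V n * (p ^+ 4) ^+ n.
  have : `|S n| * p ^+ n <= D * V n.
    rewrite /V mulr_sumr; apply: le_trans (ler_wpM2r (ltW (pn n)) (ler_norm_sum _ _ _)) _.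
    rewrite mulr_suml; apply: ler_sum => i _; rewrite normrM.
    have -> : p ^+ n = p ^+ i * p ^+ (n - i) by rewrite -exprD subnKC// -ltnS.
    have -> : `|P i| * `|y i| * (p ^+ i * p ^+ (n - i)) =
      `|P i| * p ^+ i * (p ^+ (n - i) * `|y i|) by ring.
    by rewrite ler_wpM2r ?bP// mulr_ge0// ltW.
  move=> h; rewrite normrM -(ler_pM2r (pn n)) -mulrA.
  apply: (@le_trans _ _ (D * (p ^+ 5) ^+ n * (D * V n))).
    by apply: ler_pM => //; rewrite mulr_ge0// ltW.
  rewrite le_eqVlt; apply/orP; left; apply/eqP.
  by rewrite (exprAC p 5) (exprAC p 4); ring.
exists (fun n => Q n * S n + P n * T n); split.
- case=> [|n].
    have := hP 0; have := hQ 0; rewrite /real_jacobi !add0r /= => h1 h2.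
    rewrite SS TS.
    have -> : S 0 = y 0 by rewrite /S big_ord_recl big_ord0 P0 addr0 mul1r.
    transitivity ((b 0 * Q 0 + a 0 * Q 1) * y 0 + (b 0 * P 0 + a 0 * P 1) * T 0); first by ring.
    by rewrite h1 h2; ring.
  have := hP n.+1; have := hQ n.+1; rewrite /real_jacobi /= => h1 h2.
  rewrite (SS n.+1) (TS n.+1).
  have -> : S n = S n.+1 - P n.+1 * y n.+1 by rewrite SS addrK.
  have -> : T n = T n.+1 + Q n.+1 * y n.+1 by rewrite TS subrK.
  transitivity ((a n * Q n + b n.+1 * Q n.+1 + a n.+1 * Q n.+2) * S n.+1 +
     (a n * P n + b n.+1 * P n.+1 + a n.+1 * P n.+2) * T n.+1
     - (a n * (P n.+1 * Q n - P n * Q n.+1)) * y n.+1); first by ring.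
  by rewrite h1 h2 W addr0; ring.
- move=> n; apply: le_trans (ler_normD _ _) _.
  have -> : (D ^+ 2 / (1 - p) + D ^+ 2 / (1 - p ^+ 5)) * Y * (p ^+ 4) ^+ n =
     D ^+ 2 * (Y / (1 - p)) * (p ^+ 4) ^+ n +
     D ^+ 2 / (1 - p ^+ 5) * Y * (p ^+ 4) ^+ n by ring.
  apply: lerD; last exact: (PT 0).
  apply: le_trans (QS n) _; rewrite ler_pM2r// ler_pM2l ?exprn_gt0//.
  have p01 : 0 <= p < 1 by rewrite ltW.
  apply: (@affine_recursion_le _ (fun n => `|y n|)) => //.
  rewrite /V big_ord_recl big_ord0 addr0 expr0 mul1r.
  apply: le_trans (yY 0) _; rewrite ler_pdivlMr ?subr_gt0//.
  by rewrite ler_piMr// gerBl ltW.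
- have V0c : V @ \oo --> (0 : R).
    apply: (@affine_recursion_cvg0 _ (fun n => `|y n|) p) => //; first by rewrite ltW.
    by rewrite -(@normr0 _ R); exact: cvg_norm.
  apply: cvgn0I => e e0; have e20 : 0 < e / 2 by rewrite divr_gt0.
  have D2 : 0 < D ^+ 2 by rewrite exprn_gt0.
  have [N1 H1] := cvgn0_le (cvgn0Z (D ^+ 2) V0c) e20.
  have k0 : 0 < D ^+ 2 / (1 - p ^+ 5).
    by rewrite divr_gt0// subr_gt0; case/andP: p5.
  have [N2 H2] := cvgn0_le y0 (divr_gt0 e20 k0).
  exists (maxn N1 N2) => n; rewrite geq_max => /andP[n1 n2].
  rewrite normrM normfV (ger0_norm (ltW (p4n n))) ler_pdivrMr//.
  apply: le_trans (ler_normD _ _) _.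
  have -> : e * (p ^+ 4) ^+ n = e / 2 * (p ^+ 4) ^+ n + e / 2 * (p ^+ 4) ^+ n by field.
  apply: lerD.
    apply: le_trans (QS n) _; rewrite ler_pM2r//.
    exact: le_trans (ler_norm _) (H1 n n1).
  apply: le_trans (PT N2 _ (ltW (divr_gt0 e20 k0)) H2 n n2) _.
  by rewrite mulrCA divff ?mulr1// gt_eqF.
Qed.

End real_green.

(** * Square-summable complex sequences *)

Section square_sums.
Variable R : realType.
Local Notation C := (Cplx R).
Local Notation "x %:C" := (real_complex R x : Cplx R).
Implicit Types (x y : nat -> C) (z w : C) (r e : R).

Definition csqr z : R := complex.Re z ^+ 2 + complex.Im z ^+ 2.

Lemma csqr_ge0 z : 0 <= csqr z.
Proof. by rewrite addr_ge0 ?sqr_ge0. Qed.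

Lemma cReD z w : complex.Re (z + w) = complex.Re z + complex.Re w.
Proof. by case: z w => [? ?] [? ?]. Qed.

Lemma cImD z w : complex.Im (z + w) = complex.Im z + complex.Im w.
Proof. by case: z w => [? ?] [? ?]. Qed.

Lemma cReN z : complex.Re (- z) = - complex.Re z.
Proof. by case: z => [? ?]. Qed.

Lemma cImN z : complex.Im (- z) = - complex.Im z.
Proof. by case: z => [? ?]. Qed.

Lemma cReZ r z : complex.Re (r%:C * z) = r * complex.Re z.
Proof. by case: z => [u v]; rewrite /= mul0r subr0. Qed.

Lemma cImZ r z : complex.Im (r%:C * z) = r * complex.Im z.
Proof. by case: z => [u v]; rewrite /= mul0r addr0. Qed.

Lemma cplx_eq z w : complex.Re z = complex.Re w -> complex.Im z = complex.Im w -> z = w.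
Proof. by case: z w => [? ?] [? ?] /= -> ->. Qed.

Lemma sqnorm_ge0 x : (0 <= sqnorm x)%E.
Proof. by apply: nneseries_ge0 => n _ _; rewrite lee_fin csqr_ge0. Qed.

Lemma sum_le_sqnorm x N : ((\sum_(n < N) csqr (x n))%:E <= sqnorm x)%E.
Proof.
rewrite -(big_mkord xpredT (fun n => csqr (x n))) -sumEFin.
by apply: nneseries_lim_ge => n _ _; rewrite lee_fin csqr_ge0.
Qed.

Lemma sqnorm_le x r : (forall N, \sum_(n < N) csqr (x n) <= r) ->
  (sqnorm x <= r%:E)%E.
Proof.
move=> H; apply: lime_le.
  by apply: is_cvg_nneseries => n _ _; rewrite lee_fin csqr_ge0.
by apply: nearW => N; rewrite sumEFin lee_fin big_mkord.
Qed.

Lemma in_l2P x : in_l2 x <-> exists r, forall N, \sum_(n < N) csqr (x n) <= r.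
Proof.
split=> [h|[r hr]]; last exact: le_lt_trans (sqnorm_le hr) (ltry _).
exists (fine (sqnorm x)) => N; rewrite -lee_fin fineK ?sum_le_sqnorm//.
by rewrite ge0_fin_numE// sqnorm_ge0.
Qed.

Lemma csqr_le_sum x n : csqr (x n) <= \sum_(k < n.+1) csqr (x k).
Proof.
rewrite big_ord_recr/= lerDr; apply: sumr_ge0 => i _; exact: csqr_ge0.
Qed.

Lemma csqr_le_sqnorm x n r : (sqnorm x <= r%:E)%E -> csqr (x n) <= r.
Proof.
move=> h; apply: le_trans (csqr_le_sum x n) _.
by rewrite -lee_fin; apply: le_trans (sum_le_sqnorm x n.+1) h.
Qed.

Lemma in_l2_tail x : in_l2 x -> forall e, 0 < e ->
  exists N, forall K, \sum_(n < K) csqr (x (N + n)%N) <= e.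
Proof.
move=> /in_l2P[r hr] e e0; pose s N := \sum_(n < N) csqr (x n).
have nd : nondecreasing_seq s.
  apply/nondecreasing_seqP => n; rewrite /s big_ord_recr/= lerDl; exact: csqr_ge0.
have cs : cvgn s by apply: nondecreasing_is_cvgn => //; exists r => _ [N _ <-]; exact: hr.
have [N HN] := cvgn_dist_le cs e0; exists N => K.
have -> : \sum_(n < K) csqr (x (N + n)%N) = s (N + K)%N - s N.
  by rewrite /s big_split_ord/= addrAC subrr add0r.
have := HN N (leqnn _); rewrite distrC => /(le_trans (ler_norm _)); apply: le_trans.
by rewrite lerD2r; apply: nondecreasing_cvgn_le.
Qed.

Lemma sqnorm_cvg0P (s : nat -> nat -> C) :
  (sqnorm (s k) @[k --> \oo] --> 0%E) <->
  (forall e, 0 < e -> exists N, forall k, (N <= k)%N -> (sqnorm (s k) <= e%:E)%E).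
Proof.
split=> [/fine_cvgP[[N1 _ HN1] /cvgn0_le h] e e0|h].
  have [N HN] := h e e0; exists (maxn N N1) => k; rewrite geq_max => /andP[kN kN1].
  rewrite -(fineK (HN1 _ kN1)) lee_fin; exact: le_trans (ler_norm _) (HN k kN).
apply/fine_cvgP; split.
  have [N HN] := h 1 ltr01; exists N => // k /= /HN hk.
  by rewrite ge0_fin_numE ?sqnorm_ge0//; apply: le_lt_trans hk (ltry _).
apply: cvgn0I => e e0; have [N HN] := h e e0; exists N => k /HN hk /=.
have fk : sqnorm (s k) \is a fin_num.
  by rewrite ge0_fin_numE ?sqnorm_ge0//; apply: le_lt_trans hk (ltry _).
rewrite ger0_norm ?fine_ge0 ?sqnorm_ge0//.
by rewrite -lee_fin fineK.
Qed.

Lemma sqnorm_cvg0_Re (s : nat -> nat -> C) n : sqnorm (s k) @[k --> \oo] --> 0%E ->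
  complex.Re (s k n) @[k --> \oo] --> (0 : R) /\
  complex.Im (s k n) @[k --> \oo] --> (0 : R).
Proof.
move=> /sqnorm_cvg0P h.
have H e : 0 < e -> exists N, forall k, (N <= k)%N ->
    `|complex.Re (s k n)| <= e /\ `|complex.Im (s k n)| <= e.
  move=> e0; have [N HN] := h (e ^+ 2) (exprn_gt0 2 e0); exists N => k /HN.
  move=> /(csqr_le_sqnorm n); rewrite /csqr => hk.
  have hr := sqr_ge0 (complex.Re (s k n)); have hi := sqr_ge0 (complex.Im (s k n)).
  by split; rewrite -ler_sqr ?nnegrE// ?(ltW e0)// real_normK ?num_real//; lra.
split; apply: cvgn0I => e /H[N HN]; exists N => k /HN.
  by case.
by case.
Qed.

Lemma in_l2_cvg0 x : in_l2 x ->
  complex.Re (x n) @[n --> \oo] --> (0 : R) /\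
  complex.Im (x n) @[n --> \oo] --> (0 : R).
Proof.
move=> hx.
have H e : 0 < e -> exists N, forall k, (N <= k)%N ->
    `|complex.Re (x k)| <= e /\ `|complex.Im (x k)| <= e.
  move=> e0; have [N HN] := in_l2_tail hx (exprn_gt0 2 e0); exists N => k Nk.
  have := le_trans (csqr_le_sum (fun n => x (N + n)%N) _) (HN (k - N).+1).
  rewrite subnKC// /csqr => hk.
  have hr := sqr_ge0 (complex.Re (x k)); have hi := sqr_ge0 (complex.Im (x k)).
  by split; rewrite -ler_sqr ?nnegrE// ?(ltW e0)// real_normK ?num_real//; lra.
split; apply: cvgn0I => e /H[N HN]; exists N => k /HN.
  by case.
by case.
Qed.

Lemma in_l2D x y : in_l2 x -> in_l2 y -> in_l2 (fun n => x n + y n).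
Proof.
move=> /in_l2P[r hr] /in_l2P[t ht]; apply/in_l2P; exists (2 * (r + t)) => N.
apply: (@le_trans _ _ (\sum_(n < N) 2 * (csqr (x n) + csqr (y n)))).
  apply: ler_sum => n _; rewrite /csqr cReD cImD.
  have := sqr_ge0 (complex.Re (x n) - complex.Re (y n)).
  by have := sqr_ge0 (complex.Im (x n) - complex.Im (y n)); nra.
rewrite -mulr_sumr big_split/= ler_pM2l//; apply: lerD; [exact: hr|exact: ht].
Qed.

Lemma in_l2Z r x : in_l2 x -> in_l2 (fun n => r%:C * x n).
Proof.
move=> /in_l2P[t ht]; apply/in_l2P; exists (r ^+ 2 * t) => N.
rewrite (eq_bigr (fun n : 'I_N => r ^+ 2 * csqr (x n))) => [|n _].
  by rewrite -mulr_sumr; apply: ler_wpM2l; [exact: sqr_ge0|exact: ht].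
by rewrite /csqr cReZ cImZ; ring.
Qed.

End square_sums.

(** * The closed Jacobi operator and its eigenvalues *)

Section jacobi_spectra.
Variables (R : realType) (a b : nat -> R).
Local Notation C := (Cplx R).
Local Notation "x %:C" := (real_complex R x : Cplx R).
Local Notation J := (real_jacobi a b).
Local Notation Re := (@complex.Re R).
Local Notation Im := (@complex.Im R).
Implicit Types (x y w : nat -> C) (u v : nat -> R) (z : R).
Hypothesis a_gt0 : forall n, 0 < a n.

Lemma Re_jacobi_mul x n : Re (jacobi_mul a b x n) = J (fun k => Re (x k)) n.
Proof.
by rewrite /jacobi_mul /real_jacobi !cReD !cReZ; case: n => [|n]//; rewrite cReZ.
Qed.

Lemma Im_jacobi_mul x n : Im (jacobi_mul a b x n) = J (fun k => Im (x k)) n.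
Proof.
by rewrite /jacobi_mul /real_jacobi !cImD !cImZ; case: n => [|n]//; rewrite cImZ.
Qed.

Lemma real_jacobi_cvg (s : nat -> nat -> R) u :
  (forall n, s k n @[k --> \oo] --> u n) ->
  forall n, J (s k) n @[k --> \oo] --> J u n.
Proof.
move=> su n; rewrite /real_jacobi; apply: cvgD; last by apply: cvgMl_tmp.
apply: cvgD; last by apply: cvgMl_tmp.
by case: n => [|n]; [exact: cvg_cst|apply: cvgMl_tmp].
Qed.

Lemma real_jacobiB u v n : J (fun k => u k - v k) n = J u n - J v n.
Proof. by rewrite /real_jacobi; case: n => [|n]; ring. Qed.

(** Convergence in l^2 implies convergence of each coordinate, and a row of the matrix involves at
    most three coordinates; so the closure still acts by the matrix. *)
Lemma jacobi_graph_mul x w : jacobi_graph a b x w ->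
  forall n, jacobi_mul a b x n = w n.
Proof.
move=> [_ _ [s [_ sx sw]]] n.
have [Rx Ix] : (forall n, Re (s k n) @[k --> \oo] --> Re (x n)) /\
    (forall n, Im (s k n) @[k --> \oo] --> Im (x n)).
  split=> j; have [h1 h2] := sqnorm_cvg0_Re j sx.
    by apply: cvgn_sub0; move: h1; under eq_fun do rewrite cReD cReN.
  by apply: cvgn_sub0; move: h2; under eq_fun do rewrite cImD cImN.
have [Rw Iw] := sqnorm_cvg0_Re n sw.
have {}Rw : J (fun j => Re (s k j)) n - Re (w n) @[k --> \oo] --> (0 : R).
  by move: Rw; under eq_fun do rewrite cReD cReN Re_jacobi_mul.
have {}Iw : J (fun j => Im (s k j)) n - Im (w n) @[k --> \oo] --> (0 : R).
  by move: Iw; under eq_fun do rewrite cImD cImN Im_jacobi_mul.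
apply: cplx_eq.
  rewrite Re_jacobi_mul; apply: (cvg_unique (@norm_hausdorff _ R) _ (cvgn_sub0 Rw)).
  exact: real_jacobi_cvg.
rewrite Im_jacobi_mul; apply: (cvg_unique (@norm_hausdorff _ R) _ (cvgn_sub0 Iw)).
exact: real_jacobi_cvg.
Qed.

(** Symmetry of the matrix up to a boundary term, which disappears when u is supported below N. *)
Lemma real_jacobi_green_identity u v N :
  \sum_(n < N.+1) (v n * J u n - J v n * u n) =
  a N * (v N * u N.+1 - v N.+1 * u N).
Proof.
elim: N => [|N IH]; first by rewrite big_ord_recl big_ord0 /real_jacobi/=; ring.
by rewrite big_ord_recr/= IH /real_jacobi/=; ring.
Qed.

(* The range of J - z is orthogonal to an l^2 solution v of Jv = zv, hence does
   not contain the first basis vector. *)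
Lemma eigenvalue_spectrum z v K : v 0 = 1 -> (forall n, J v n = z * v n) ->
  (forall N, \sum_(n < N) v n ^+ 2 <= K) -> jacobi_spectrum a b z%:C.
Proof.
move=> v0 hv vK [ex _].
pose e0 n : C := ((n == 0%N)%:R : R)%:C.
have e0l2 : in_l2 e0.
  have E n : csqr (e0 n) = (n == 0%N)%:R.
    by rewrite /csqr /e0/=; case: (n == 0%N) => /=; ring.
  apply/in_l2P; exists 1 => N; under eq_bigr do rewrite E.
  case: N => [|N]; first by rewrite big_ord0.
  by rewrite big_ord_recl big1 /= ?addr0.
have [X [[Xl2 _ [s [sf sX sw]]] _]] := ex _ e0l2.
have K1 : 1 <= K by have := vK 1%N; rewrite big_ord_recl big_ord0 v0 expr1n addr0.
have K0 : 0 < K by exact: lt_le_trans K1.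
(* Chosen so that 4 K^2 * 2 (1 + z^2) d = K in the final estimate. *)
pose d := (8 * K * (1 + z ^+ 2))^-1.
have z1 : 0 < 1 + z ^+ 2 by rewrite ltr_pwDl// sqr_ge0.
have d0 : 0 < d by rewrite invr_gt0 !mulr_gt0.
have [N1 H1] := (sqnorm_cvg0P _).1 sX d d0.
have [N2 H2] := (sqnorm_cvg0P _).1 sw d d0.
pose k := maxn N1 N2.
have h1 := H1 k (leq_maxl _ _); have h2 := H2 k (leq_maxr _ _).
have [N HN] := sf k.
pose u n := Re (s k n).
(* The residual of the equation (J - z) u = e_0 for the real part of a finitely supported
   approximant: small in l^2, yet its product with v is -1 because v annihilates the range. *)
pose t n := J u n - z * u n - (n == 0%N)%:R.
have tK : \sum_(n < N.+1) t n ^+ 2 <= 2 * (1 + z ^+ 2) * d.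
  pose p n := s k n - X n; pose r n := jacobi_mul a b (s k) n - (z%:C * X n + e0 n).
  apply: (@le_trans _ _ (\sum_(n < N.+1) 2 * (csqr (r n) + z ^+ 2 * csqr (p n)))).
    apply: ler_sum => n _.
    have -> : t n = Re (r n) - z * Re (p n).
      have -> : Re (r n) = J u n - (z * Re (X n) + (n == 0%N :> nat)%:R).
        by rewrite /r cReD Re_jacobi_mul cReN cReD cReZ.
      have -> : Re (p n) = u n - Re (X n) by rewrite /p cReD cReN.
      by rewrite /t; ring.
    have := sqr_ge0 (Re (r n) + z * Re (p n)).
    have := sqr_ge0 (Im (r n)); have := mulr_ge0 (sqr_ge0 z) (sqr_ge0 (Im (p n))).
    by rewrite /csqr; nra.
  rewrite -mulr_sumr big_split/= -mulr_sumr -mulrA ler_pM2l// mulrDl mul1r.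
  apply: lerD; first by rewrite -lee_fin; apply: le_trans (sum_le_sqnorm _ _) h2.
  by rewrite ler_wpM2l ?sqr_ge0// -lee_fin; apply: le_trans (sum_le_sqnorm _ _) h1.
have vt : \sum_(n < N.+1) v n * t n = -1.
  have := real_jacobi_green_identity u v N.
  rewrite /u !HN// /= !mulr0 subrr mulr0 -/u => e.
  have -> : \sum_(n < N.+1) v n * t n =
     \sum_(n < N.+1) (v n * J u n - J v n * u n) - \sum_(n < N.+1) v n * (n == 0%N :> nat)%:R.
    by rewrite -sumrB; apply: eq_bigr => n _; rewrite hv /t; ring.
  rewrite e sub0r big_ord_recl big1 /= ?addr0 ?v0 ?mulr1// => i _.
  by rewrite mulr0.
(* A form of Cauchy-Schwarz: with weight 2 K the sum of squares is at most K - 4 K + K < 0. *)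
have : 0 <= \sum_(n < N.+1) (v n + 2 * K * t n) ^+ 2.
  by apply: sumr_ge0 => i _; exact: sqr_ge0.
have -> : \sum_(n < N.+1) (v n + 2 * K * t n) ^+ 2 = \sum_(n < N.+1) v n ^+ 2 +
    (4 * K * (\sum_(n < N.+1) v n * t n) + 4 * K ^+ 2 * \sum_(n < N.+1) t n ^+ 2).
  by rewrite !mulr_sumr -!big_split/=; apply: eq_bigr => n _; ring.
rewrite vt; have := vK N.+1.
have : 4 * K ^+ 2 * \sum_(n < N.+1) t n ^+ 2 <= K.
  apply: (@le_trans _ _ (4 * K ^+ 2 * (2 * (1 + z ^+ 2) * d))).
    by rewrite ler_wpM2l// mulr_ge0// sqr_ge0.
  rewrite le_eqVlt; apply/orP; left; apply/eqP; rewrite /d; field.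
  by rewrite !gt_eqF.
lra.
Qed.

End jacobi_spectra.

(** * Resolvent points from a Green kernel *)

Section jacobi_resolvents.
Variables (R : realType) (a b : nat -> R).
Local Notation C := (Cplx R).
Local Notation "x %:C" := (real_complex R x : Cplx R).
Local Notation J := (real_jacobi a b).
Local Notation Re := (@complex.Re R).
Local Notation Im := (@complex.Im R).
Implicit Types (x y w : nat -> C) (u v : nat -> R) (z : R).
Hypothesis a_gt0 : forall n, 0 < a n.

Lemma sum_shift_le (f g : nat -> R) N K : (forall n, (n < N)%N -> f n = 0) ->
  (forall n, f (N + n)%N <= g n) -> (forall n, 0 <= g n) ->
  \sum_(n < K) f n <= \sum_(n < K) g n.
Proof.
move=> f0 fg g0; have [KN|NK] := leqP K N.
  rewrite big1 ?sumr_ge0// => i _; apply: f0; exact: leq_trans (ltn_ord i) KN.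
rewrite -(subnKC (ltnW NK)); move: (K - N)%N => {NK}L.
have -> : \sum_(n < N + L) g n = \sum_(n < L) g n + \sum_(n < N) g (L + n)%N.
  by rewrite addnC big_split_ord.
rewrite big_split_ord/= big1 ?add0r => [|i _]; last exact: f0.
apply: ler_wpDr; first by apply: sumr_ge0 => i _.
by apply: ler_sum => i _.
Qed.

Definition truncation u k n : R := if (n < k.+1)%N then u n else 0.

Lemma real_jacobi_truncation_lt u k n : (n < k)%N -> J (truncation u k) n = J u n.
Proof.
move=> nk; rewrite /real_jacobi /truncation !ltnS nk (ltnW nk).
by case: n nk => [//|n] nk; rewrite ltnS (leq_trans (leqnSn _) (ltnW nk)).
Qed.

(** Cutting u after the index k disturbs the rows k and k + 1 by the boundary products a_k u_(k+1)
    and a_k u_k; in later rows the error is Ju itself. *)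
Lemma real_jacobi_truncation u k j :
  (J (truncation u k) (k + j)%N - J u (k + j)%N) ^+ 2 <=
  2 * J u (k + j)%N ^+ 2 + 2 * (j < 2)%:R * ((a k * u k.+1) ^+ 2 + (a k * u k) ^+ 2).
Proof.
case: j => [|[|j]].
- rewrite addn0.
  have -> : J (truncation u k) k - J u k = - (a k * u k.+1).
    rewrite /real_jacobi /truncation ltnS leqnn ltnn.
    case: k => [|k]; first by ring.
    by rewrite ltnS leqnSn; ring.
  rewrite sqrrN mulr1; have := sqr_ge0 (J u k); have := sqr_ge0 (a k * u k.+1).
  by have := sqr_ge0 (a k * u k); lra.
- rewrite addn1.
  have -> : J (truncation u k) k.+1 = a k * u k.
    rewrite /real_jacobi /truncation leqnn !ltnn.
    by rewrite ltnNge ltnW//=; ring.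
  have := sqr_ge0 (a k * u k + J u k.+1); have := sqr_ge0 (a k * u k.+1).
  by rewrite mulr1; nra.
- have -> : J (truncation u k) (k + j.+2) = 0.
    have f i : (k + i.+1 <= k)%N = false by rewrite addnS ltnNge leq_addr.
    by rewrite /real_jacobi /truncation !addnS !ltnS -!addnS !f; ring.
  by rewrite sub0r sqrrN mulr0 mul0r addr0; have := sqr_ge0 (J u (k + j.+2)%N); lra.
Qed.

Definition ctruncation x k n : C := if (n < k.+1)%N then x n else 0.

(** A formal solution lies in the domain of the closure once the boundary products tend to 0: its
    truncations are the required finitely supported approximants. *)
Lemma jacobi_graph_truncation x w : in_l2 x -> in_l2 w ->
  (forall n, jacobi_mul a b x n = w n) ->
  (forall e, 0 < e -> exists N, forall k, (N <= k)%N ->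
     csqr ((a k)%:C * x k) <= e /\ csqr ((a k)%:C * x k.+1) <= e) ->
  jacobi_graph a b x w.
Proof.
move=> xl2 wl2 xw H; split=> //; exists (ctruncation x); split.
- by move=> k; exists k.+1 => n kn; rewrite /ctruncation ltnNge kn.
- apply: (sqnorm_cvg0P _).2 => e e0; have [N HN] := in_l2_tail xl2 e0.
  exists N => k Nk; apply: sqnorm_le => K; apply: le_trans (HN K).
  apply: (@sum_shift_le (fun n => csqr (ctruncation x k n - x n))
    (fun n => csqr (x (N + n)%N)) N) => [n nN|n|n]; last exact: csqr_ge0.
    rewrite /ctruncation ltnS (leq_trans (ltnW nN) Nk) subrr /csqr/=.
    by rewrite expr0n addr0.
  rewrite /ctruncation; case: ifP => _.
    by rewrite subrr /csqr /= expr0n addr0 -/(csqr _) csqr_ge0.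
  by rewrite sub0r /csqr cReN cImN !sqrrN.
- apply: (sqnorm_cvg0P _).2 => e e0.
  (* Each of the two boundary rows costs at most 2 (e/12 + e/12) = e/3 and the tail of w at most 2
     e/12, in all less than e. *)
  have e40 : 0 < e / 12 by rewrite divr_gt0.
  have [N HN] := in_l2_tail wl2 e40; have [M HM] := H _ e40.
  exists (maxn N M) => k; rewrite geq_max => /andP[Nk Mk].
  have [h1 h2] := HM k Mk; apply: sqnorm_le => K.
  have Er n : Re (jacobi_mul a b (ctruncation x k) n - w n) =
      J (truncation (fun j => Re (x j)) k) n - J (fun j => Re (x j)) n.
    rewrite cReD cReN -xw !Re_jacobi_mul; congr (_ - _).
    by congr real_jacobi; apply/funext => j; rewrite /ctruncation /truncation; case: ifP.
  have Ei n : Im (jacobi_mul a b (ctruncation x k) n - w n) =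
      J (truncation (fun j => Im (x j)) k) n - J (fun j => Im (x j)) n.
    rewrite cImD cImN -xw !Im_jacobi_mul; congr (_ - _).
    by congr real_jacobi; apply/funext => j; rewrite /ctruncation /truncation; case: ifP.
  apply: (@le_trans _ _ (\sum_(j < K) (2 * csqr (w (k + j)%N) + (j < 2)%:R * (e / 3)))).
    apply: (@sum_shift_le (fun n => csqr (jacobi_mul a b (ctruncation x k) n - w n))
       (fun j => 2 * csqr (w (k + j)%N) + (j < 2)%:R * (e / 3)) k) => [n nk|n|n].
    - by rewrite /csqr Er Ei !real_jacobi_truncation_lt// !subrr expr0n addr0.
    - rewrite /csqr Er Ei -xw Re_jacobi_mul Im_jacobi_mul.
      have := real_jacobi_truncation (fun j => Re (x j)) k n.
      have := real_jacobi_truncation (fun j => Im (x j)) k n.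
      move: h1 h2; rewrite /csqr !cReZ !cImZ; case: (n < 2)%N => /=; nra.
    - rewrite addr_ge0// mulr_ge0 ?csqr_ge0// divr_ge0// ltW//.
  rewrite big_split/= -mulr_sumr -mulr_suml.
  have t1 : \sum_(n < K) csqr (w (k + n)%N) <= e / 12.
    rewrite -(subnKC Nk).
    apply: le_trans (HN ((k - N) + K)%N); rewrite big_split_ord/=.
    rewrite (eq_bigr (fun i : 'I_K => csqr (w (N + (k - N + i))%N))) => [|i _]; last by rewrite addnA.
    by rewrite lerDr; apply: sumr_ge0 => i _; exact: csqr_ge0.
  have t2 : \sum_(j < K) (j < 2)%:R <= 2 :> R.
    case: K {HN t1} => [|[|K]]; rewrite ?big_ord0 ?big_ord_recl ?big_ord0/=; [lra|lra|].
    by rewrite big1 ?addr0//; lra.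
  have : (\sum_(j < K) (j < 2)%:R) * (e / 3) <= 2 * (e / 3).
    by rewrite ler_wpM2r// divr_ge0// ltW.
  by lra.
Qed.

Section green.
Variables (z : R) (P Q : nat -> R) (p D : R).
Hypotheses (p01 : 0 < p < 1) (D0 : 0 < D) (P0 : P 0 = 1).
Hypothesis hP : forall n, J P n = z * P n.
Hypothesis hQ : forall n, J Q n = z * Q n + (n == 0%N)%:R.
Hypothesis bP : forall n, `|P n| * p ^+ n <= D.
Hypothesis bQ : forall n, `|Q n| <= D * (p ^+ 5) ^+ n.
Hypothesis ba : forall n, a n * (p ^+ 4) ^+ n <= D.
Hypothesis nP : ~ (P @ \oo --> (0 : R)).

(** The difference of two solutions is a multiple of P in its real and in its imaginary part; being
    in l^2 it tends to 0, which P does not. *)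
Lemma resolvent_uniq x x' w : jacobi_graph a b x (fun n => z%:C * x n + w n) ->
  jacobi_graph a b x' (fun n => z%:C * x' n + w n) -> x = x'.
Proof.
move=> g g'; have e n := jacobi_graph_mul g n; have e' n := jacobi_graph_mul g' n.
have [xl2 _ _] := g; have [xl2' _ _] := g'.
have [rx ix] := in_l2_cvg0 xl2; have [rx' ix'] := in_l2_cvg0 xl2'.
have key u : (forall n, J u n = z * u n) -> u @ \oo --> (0 : R) -> forall n, u n = 0.
  move=> hu u0 n; rewrite (real_jacobi_eigen_uniq a_gt0 P0 hP hu).
  have [->|u00] := eqVneq (u 0) 0; first by rewrite mul0r.
  exfalso; apply: nP; have := cvgn0Z (u 0)^-1 u0.
  apply: cvg_trans; apply: near_eq_cvg; apply: nearW => k /=.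
  by rewrite (real_jacobi_eigen_uniq a_gt0 P0 hP hu k) mulKf.
apply/funext => n; apply: cplx_eq; apply/eqP; rewrite -subr_eq0; apply/eqP.
  apply: (key (fun n => Re (x n) - Re (x' n))) => [k|].
    rewrite real_jacobiB -!Re_jacobi_mul e e' !cReD !cReZ; ring.
  exact: cvgn0B.
apply: (key (fun n => Im (x n) - Im (x' n))) => [k|].
  rewrite real_jacobiB -!Im_jacobi_mul e e' !cImD !cImZ; ring.
exact: cvgn0B.
Qed.

Let kappa := D ^+ 2 / (1 - p) + D ^+ 2 / (1 - p ^+ 5).

(** [real_green] is applied to the real and the imaginary part of y, both bounded by the l^2 norm Y
    of y. The constant is the sum of 2 (kappa p^(4n))^2 over n. *)
Lemma resolvent_exists y : in_l2 y ->
  exists2 x, jacobi_graph a b x (fun n => z%:C * x n + y n) &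
    (sqnorm x <= (2 * kappa ^+ 2 / (1 - p ^+ 8))%:E * sqnorm y)%E.
Proof.
have /andP[p0 p1] := p01; have p8 : 0 <= p ^+ 8 < 1.
  by rewrite exprn_ge0 ?ltW//= exprn_ilt1// ltW.
have p81 : 0 < 1 - p ^+ 8 by rewrite subr_gt0; case/andP: p8.
move=> yl2; have fy : sqnorm y \is a fin_num by rewrite ge0_fin_numE ?sqnorm_ge0.
have [ry iy] := in_l2_cvg0 yl2.
set Y2 := fine (sqnorm y); have Y20 : 0 <= Y2 by rewrite fine_ge0// sqnorm_ge0.
have hY n : csqr (y n) <= Y2 by apply: csqr_le_sqnorm; rewrite fineK.
set Y := Num.sqrt Y2; have YY : Y ^+ 2 = Y2 by rewrite sqr_sqrtr.
have bY n : `|Re (y n)| <= Y /\ `|Im (y n)| <= Y.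
  have := hY n; rewrite -YY /csqr => h.
  have hr := sqr_ge0 (Re (y n)); have hi := sqr_ge0 (Im (y n)).
  by split; rewrite -ler_sqr ?nnegrE// ?sqrtr_ge0// real_normK ?num_real//; lra.
have [g [Hg bg cg]] := real_green p01 D0 P0 hP hQ bP bQ (sqrtr_ge0 Y2) (fun n => (bY n).1) ry.
have [h [Hh bh ch]] := real_green p01 D0 P0 hP hQ bP bQ (sqrtr_ge0 Y2) (fun n => (bY n).2) iy.
rewrite -/kappa -/Y in bg bh.
pose x n : C := Complex (g n) (h n).
have sx K : \sum_(n < K) csqr (x n) <= 2 * kappa ^+ 2 / (1 - p ^+ 8) * Y2.
  apply: (@le_trans _ _ (\sum_(0 <= n < K) 2 * kappa ^+ 2 * Y2 * (p ^+ 8) ^+ n)).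
    rewrite big_mkord; apply: ler_sum => n _; rewrite /csqr/=.
    have bsq (v : R) : `|v| <= kappa * Y * (p ^+ 4) ^+ n -> v ^+ 2 <= kappa ^+ 2 * Y2 * (p ^+ 8) ^+ n.
      move=> hv; have -> : kappa ^+ 2 * Y2 * (p ^+ 8) ^+ n = (kappa * Y * (p ^+ 4) ^+ n) ^+ 2.
        by rewrite (exprAC p 8) (exprAC p 4) -YY; ring.
      by rewrite -real_normK ?num_real// ler_sqr ?nnegrE// (le_trans _ hv).
    by have := bsq _ (bg n); have := bsq _ (bh n); lra.
  have -> : \sum_(0 <= n < K) 2 * kappa ^+ 2 * Y2 * (p ^+ 8) ^+ n =
    series (geometric (2 * kappa ^+ 2 * Y2) (p ^+ 8)) K by [].
  rewrite geometric_seriesE; last by rewrite lt_eqF//; case/andP: p8.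
  rewrite /= [leRHS]mulrAC ler_pM2r ?invr_gt0//.
  apply: ler_piMr; last by rewrite gerBl exprn_ge0//; case/andP: p8.
  by apply: mulr_ge0 => //; apply: mulr_ge0 => //; exact: sqr_ge0.
exists x; last first.
  by rewrite -(fineK fy) -EFinM; exact: sqnorm_le.
have xl2 : in_l2 x by apply/in_l2P; eexists; exact: sx.
apply: jacobi_graph_truncation => //.
- by apply: in_l2D => //; exact: in_l2Z.
- move=> n; apply: cplx_eq.
    by rewrite Re_jacobi_mul cReD cReZ; exact: Hg.
  by rewrite Im_jacobi_mul cImD cImZ; exact: Hh.
(* With a_k p^(4k) <= D, this [d] makes each real boundary product at most sqrt(e/2). *)
move=> e e0; pose d := Num.sqrt (e / 2) / D.
have e20 : 0 < e / 2 by rewrite divr_gt0.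
have d0 : 0 < d by rewrite divr_gt0// sqrtr_gt0.
have [N1 HN1] := cvgn0_le cg d0; have [N2 HN2] := cvgn0_le ch d0.
exists (maxn N1 N2) => k; rewrite geq_max => /andP[k1 k2].
have p4 n : 0 < (p ^+ 4) ^+ n by rewrite !exprn_gt0.
have B (v : nat -> R) j : (k <= j <= k.+1)%N -> `|v j / (p ^+ 4) ^+ j| <= d -> (a k * v j) ^+ 2 <= e / 2.
  move=> /andP[kj jk]; rewrite normrM normfV (ger0_norm (ltW (p4 j))) ler_pdivrMr// => hv.
  have : `|a k * v j| <= Num.sqrt (e / 2).
    rewrite normrM (ger0_norm (ltW (a_gt0 k))).
    apply: (@le_trans _ _ (a k * (d * (p ^+ 4) ^+ k))).
      rewrite ler_pM2l//; apply: le_trans hv _; rewrite ler_pM2l//.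
      by rewrite ler_wiXn2l ?exprn_ge0 ?exprn_ile1// ltW.
    by rewrite mulrCA /d -mulrA ler_piMr ?sqrtr_ge0// mulrC ler_pdivrMr// mul1r.
  by rewrite -ler_sqr ?nnegrE ?sqrtr_ge0// sqr_sqrtr ?(ltW e20)// real_normK ?num_real.
have k01 : (k <= k <= k.+1)%N by rewrite leqnn leqnSn.
have k11 : (k <= k.+1 <= k.+1)%N by rewrite leqnn leqnSn.
rewrite /csqr !cReZ !cImZ /x/=; split.
  have := B g k k01 (HN1 k k1); have := B h k k01 (HN2 k k2); lra.
have := B g _ k11 (HN1 _ (leqW k1)); have := B h _ k11 (HN2 _ (leqW k2)); lra.
Qed.

Lemma green_resolvent : jacobi_resolvent_set a b z%:C.
Proof.
split.
  move=> y yl2; have [x gx _] := resolvent_exists yl2; exists x; split=> // x' gx'.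
  exact: resolvent_uniq gx gx'.
exists (2 * kappa ^+ 2 / (1 - p ^+ 8)) => x y yl2 gx.
have [x' gx' bx'] := resolvent_exists yl2.
by rewrite (resolvent_uniq gx gx').
Qed.

End green.
End jacobi_resolvents.

(** * Points that are not zeros of the limit *)

Section nonroots.
Variables (R : realType) (lam mu : nat -> R).
Implicit Types (x t z : R) (n : nat).
Local Notation pi := (bdpi lam mu).
Local Notation rho := (bdrho lam mu).
Local Notation P := (bdP lam mu).
Local Notation a := (bda lam mu).
Local Notation b := (bdb lam mu).
Local Notation J := (real_jacobi a b).
Variables (q c C : R) (phi : R -> R).
Hypothesis G : geometric_chain lam mu q c C.
Hypothesis pi_phi : forall x, pi n x @[n --> \oo] --> phi x.
Variable m : probability (measurableTypeR R) R.
Hypothesis orth : forall i j,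
  (\int[m]_x (P i x * P j x)%:E = ((i == j)%:R : R)%:E)%E.
Local Notation integ f :=
  (m.-integrable [set: measurableTypeR R] (EFin \o (f : measurableTypeR R -> R))).

Let q0 : 0 < q. Proof. by have /andP[] := chain_q G. Qed.
Let q1 : q < 1. Proof. by have /andP[] := chain_q G. Qed.
Let c0 : 0 < c. Proof. exact: chain_c G. Qed.
Let lam_gt0 : forall n, 0 < lam n. Proof. exact: chain_lam_gt0 G. Qed.
Let mu_gt0 : forall n, 0 < mu n.+1. Proof. exact: chain_mu_gt0 G. Qed.
Let mu0 : mu 0 = 0. Proof. exact: chain_mu0 G. Qed.
Let rho_gt0 n : 0 < rho n. Proof. exact: bdrho_gt0. Qed.
Let a_gt0 n : 0 < a n. Proof. exact: bda_gt0. Qed.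

(** K distinct zeros up to x would contribute at least K / x to the bounded sum of inverse zeros. *)
Lemma finite_roots_le x : finite_set [set t | phi t = 0 /\ t <= x].
Proof.
apply: contrapT => /infiniteP /pcard_leP[f].
pose zeta n := f n.
have fz n : phi (zeta n) = 0 /\ zeta n <= x by exact: (@funS _ _ _ _ f n).
have zi : injective zeta by move=> i j e; apply: (@inj _ _ _ f) => //; rewrite inE.
set E := eta_const q c C / (1 - q ^+ 2).
have z0 n : 0 < zeta n by apply: (bdroot_gt0 G pi_phi); case: (fz n).
have x0 : 0 < x by apply: lt_le_trans (z0 0) (fz 0).2.
have H K : K%:R * x^-1 <= E.
  apply: le_trans (sum_inv_roots_le G pi_phi orth K zi (fun n => (fz n).1)).
  rewrite -[in leLHS](card_ord K) -sum1_card natr_sum mulr_suml.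
  by apply: ler_sum => i _; rewrite mul1r lef_pV2 ?posrE// (fz i).2.
have := H (Num.truncn (E * x)).+1; rewrite leNgt => /negP; apply.
by rewrite ltr_pdivlMr// truncnS_gt.
Qed.

(** The finitely many zeros up to z + 1 form a closed set that misses z; all other zeros are at
    distance at least 1. *)
Lemma nonroot_isolated z : phi z != 0 ->
  exists2 d : R, 0 < d & forall t, phi t = 0 -> d <= `|t - z|.
Proof.
move=> pz; pose F := [set t | phi t = 0 /\ t <= z + 1].
have cF : closed F.
  by apply: (accessible_finite_set_closed.1 _ _ (finite_roots_le (z + 1)));
    apply: hausdorff_accessible; exact: norm_hausdorff.
have : nbhs z (~` F).
  apply: open_nbhs_nbhs; split; first by rewrite openC.
  by move=> [] /eqP; rewrite (negbTE pz).
move=> /nbhs_ballP[e /= e0 He]; exists (Num.min e 1); first by rewrite lt_min e0 ltr01.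
move=> t pt; rewrite leNgt; apply/negP; rewrite lt_min => /andP[h1 h2].
apply: (He t); first by rewrite /ball/= distrC.
by split=> //; have := ltW (le_lt_trans (ler_norm _) h2); lra.
Qed.

Lemma real_jacobi_bdP n t : J (P^~ t) n = t * P n t.
Proof. by rewrite /real_jacobi bdP_rec. Qed.

Lemma ae_eq_Rintegral_roots (f g : R -> R) :
  measurable_fun setT (f : measurableTypeR R -> R) ->
  measurable_fun setT (g : measurableTypeR R -> R) ->
  (forall t, phi t = 0 -> f t = g t) -> (\int[m]_t f t = \int[m]_t g t)%R.
Proof.
move=> mf mg fg; congr fine; apply: ae_eq_integral => //.
- exact/measurable_EFinP.
- exact/measurable_EFinP.
have := measure_nonroots G pi_phi orth.
move/(negligibleP m (measurableC (measurable_roots pi_phi))).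
by apply: negligibleS => t /= nt pt; apply: nt => _; rewrite fg.
Qed.

(* Q_n = int P_n(t) / (t - z) dm(t); the kernel is cut off near z, where m has no
   mass, to make it bounded everywhere. *)
Lemma second_kind z d : 0 < d -> (forall t, phi t = 0 -> d <= `|t - z|) ->
  exists Q : nat -> R, (forall n, J Q n = z * Q n + (n == 0%N)%:R) /\
    forall n, `|Q n| <= 2 / d.
Proof.
move=> d0 hd; pose k t : R := if d <= `|t - z| then (t - z)^-1 else 0.
have mB : measurable_fun setT (fun t : measurableTypeR R => t - z).
  by apply: measurable_funB => //; exact: measurable_id.
have mk : measurable_fun setT (k : measurableTypeR R -> R).
  apply: measurable_fun_ifT.
  - apply: measurable_fun_ler; first exact: measurable_cst.
    by apply: measurableT_comp => //; exact: normr_measurable.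
  - exact: (measurableT_comp (@measurable_inv R) mB).
  - exact: measurable_cst.
have bk t : `|k t| <= d^-1.
  rewrite /k; case: ifP => h; last by rewrite normr0 invr_ge0 ltW.
  by rewrite normfV lef_pV2 ?posrE// (lt_le_trans d0).
have mPk n : measurable_fun setT (fun t : measurableTypeR R => P n t * k t).
  by apply: measurable_funM => //; exact: measurable_bdP.
have IP n : integ (fun t => d^-1 * `|P n t|).
  exact: (integrableZl measurableT d^-1 (integrable_norm (integrable_bdP orth n))).
have I n : integ (fun t => P n t * k t).
  apply: (@integrable_dominated _ (measurableTypeR R) R m _ (fun t => d^-1 * `|P n t|)) => //.
  by move=> t; rewrite normrM mulrC ler_wpM2r.
pose Q n := (\int[m]_t (P n t * k t))%R.
have IZ r n : integ (fun t => r * (P n t * k t)) by exact: (integrableZl measurableT r (I n)).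
have ZQ r n : (\int[m]_t (r * (P n t * k t)))%R = r * Q n by rewrite RintegralZl.
exists Q; split=> n.
  have E1 : J Q n = (\int[m]_t (J (P^~ t) n * k t))%R.
    (* For n = 0 the junk index [n.-1 = 0] is multiplied by 0, so that one integrand serves both
       cases. *)
    have E0 : J Q n = (\int[m]_t ((if n is i.+1 then a i else 0) * (P n.-1 t * k t)
        + b n * (P n t * k t) + a n * (P n.+1 t * k t)))%R.
      rewrite RintegralD//; last first.
        exact: (integrableD measurableT (IZ _ _) (IZ _ _)).
      rewrite RintegralD// !ZQ /real_jacobi.
      by case: (n) => [|i]//=; rewrite mul0r.
    rewrite E0; apply: eq_Rintegral => t _; rewrite /real_jacobi.
    by case: (n) => [|i]/=; ring.
  (* On the zeros t / (t - z) = z / (t - z) + 1; the summand 1 leaves the integral of P_n, which is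
     the Kronecker delta at 0. *)
  rewrite E1 (ae_eq_Rintegral_roots (g := fun t => z * (P n t * k t) + P n t)).
  - by rewrite RintegralD// ?ZQ ?(Rintegral_bdP orth)//; exact: (integrable_bdP orth).
  - have -> : (fun t => J (P^~ t) n * k t) = (fun t => t * (P n t * k t)).
      by apply/funext => t; rewrite real_jacobi_bdP -mulrA.
    apply: measurable_funM; last exact: mPk.
    exact: (@measurable_id _ (measurableTypeR R) setT).
  - apply: measurable_funD; last exact: measurable_bdP.
    by have /integrableP[/measurable_EFinP] := IZ z n.
  - move=> t /hd h; rewrite real_jacobi_bdP /k h.
    have tz : t - z != 0 by rewrite -normr_gt0 (lt_le_trans d0).
    by field.
apply: le_trans (le_normr_Rintegral _ (I n)) _ => //.
have Is : integ (fun t => P n t ^+ 2).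
  rewrite (_ : (fun t => P n t ^+ 2) = (fun t => P n t * P n t)).
    exact: (integrable_sqr_bdP orth).
  by apply/funext => t; rewrite expr2.
have I1 : integ (fun=> 1 : R) by exact: finite_measure_integrable_cst.
have I1s : integ (fun t => 1 + P n t ^+ 2) by exact: (integrableD measurableT I1 Is).
(* From |P_n| <= 1 + P_n^2, whose integral is 2, and |k| <= 1 / d. *)
have -> : 2 / d = (\int[m]_t (d^-1 * (1 + P n t ^+ 2)))%R.
  rewrite RintegralZl// RintegralD// Rintegral_cst//= probability_setT/= mulr1.
  under eq_Rintegral do rewrite expr2; rewrite (Rintegral_bdPP orth) eqxx.
  by rewrite mulrC.
apply: le_Rintegral => //.
- exact: (integrable_norm (I n)).
- exact: (integrableZl measurableT d^-1 I1s).
move=> t _; rewrite normrM mulrC; apply: ler_pM => //.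
rewrite -(real_normK (num_real (P n t))); set y := `|P n t|.
have y0 : 0 <= y by exact: normr_ge0.
by have := sqr_ge0 (y - 1); nra.
Qed.

(** Reduction of order: u_n = Q_n / P_n has increments 1 / (a_n P_n P_(n+1)) by the Wronskian. As
    pi_n(z) stays away from 0 these are O(1 / (lam_n rho_n)) = O(q^(3n)). Moreover u_n tends to 0,
    since Q_n is bounded and |P_n| tends to infinity. Hence Q_n = O(q^(3n)) P_n = O(q^(5n/2)). *)
Lemma nonroot_resolvent z : phi z != 0 ->
  jacobi_resolvent_set a b (real_complex R z).
Proof.
move=> pz; have [d d0 hd] := nonroot_isolated pz.
have [Q [hQ bQ]] := second_kind d0 hd.
have [M M0 HM] := bdpi_bounded pi_phi z.
(* In powers of p = sqrt q the rates become P_n = O(p^(-n)), Q_n = O(p^(5n)) and a_n = O(p^(-4n)),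
   as [green_resolvent] requires. *)
pose p := Num.sqrt q; have pq : p ^+ 2 = q by rewrite sqr_sqrtr// ltW.
have p0 : 0 < p by rewrite sqrtr_gt0.
have p1 : p < 1 by rewrite -(@ltr_sqr R) ?nnegrE ?ltW// pq expr1n.
have pn n : 0 < p ^+ n by rewrite exprn_gt0.
have qn n : 0 < q ^+ n by rewrite exprn_gt0.
have C0 : 0 < C.
  by have /andP[h1 h2] := chain_lam G 0; apply: lt_le_trans (le_trans h1 h2).
have sqr_le1 (y B : R) : 0 <= B -> y ^+ 2 <= B -> `|y| <= 1 + B.
  move=> B0 yB; rewrite -ler_sqr ?nnegrE ?addr_ge0// real_normK ?num_real//.
  by apply: le_trans yB _; nra.
have bP n : `|P n z| * p ^+ n <= 1 + C * M ^+ 2.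
  rewrite -{1}(ger0_norm (ltW (pn n))) -normrM; apply: sqr_le1.
    by rewrite mulr_ge0 ?sqr_ge0// ltW.
  rewrite exprMn sqr_bdP// (exprAC p n 2) pq mulrAC.
  have /andP[_ h] := chain_rho G n.
  apply: ler_pM => //; first by rewrite mulr_ge0// ltW.
    exact: sqr_ge0.
  by rewrite -real_normK ?num_real// ler_sqr ?nnegrE// ltW.
have ba n : a n * (p ^+ 4) ^+ n <= 1 + C ^+ 3 / c.
  have p4 : 0 < (p ^+ 4) ^+ n by rewrite !exprn_gt0.
  rewrite -[leLHS]ger0_norm; last by rewrite mulr_ge0// ltW.
  apply: sqr_le1; first by rewrite divr_ge0 ?exprn_ge0// ltW.
  have E : a n ^+ 2 * rho n.+1 = lam n ^+ 2 * rho n.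
    rewrite -(sqr_sqrtr (ltW (rho_gt0 n))) -(sqr_sqrtr (ltW (rho_gt0 n.+1))).
    by rewrite -!exprMn bda_sqrt_rhoS.
  have /andP[h1 h2] := chain_lam G n; have /andP[h3 h4] := chain_rho G n.
  have /andP[h5 h6] := chain_rho G n.+1.
  rewrite ler_pdivlMr//; apply: (@le_trans _ _ ((a n * (p ^+ 4) ^+ n) ^+ 2 * (rho n.+1 * q ^+ n.+1))).
    by rewrite ler_wpM2l// sqr_ge0.
  have -> : (a n * (p ^+ 4) ^+ n) ^+ 2 * (rho n.+1 * q ^+ n.+1) =
      (lam n * (q ^+ 2) ^+ n) ^+ 2 * (rho n * q ^+ n) * q.
    have -> : (q ^+ 2) ^+ n = (p ^+ 4) ^+ n by rewrite -pq -(exprM p 2 2).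
    rewrite (exprS q n).
    transitivity (a n ^+ 2 * rho n.+1 * ((p ^+ 4) ^+ n) ^+ 2 * q * q ^+ n); first by ring.
    by rewrite E; ring.
  have -> : C ^+ 3 = C ^+ 2 * C * 1 by ring.
  have L0 := le_trans (ltW c0) h1; have R0 := le_trans (ltW c0) h3.
  apply: ler_pM.
  - exact: mulr_ge0 (sqr_ge0 _) R0.
  - exact: ltW.
  - apply: ler_pM => //; first exact: sqr_ge0.
    by rewrite ler_sqr ?nnegrE// ltW.
  - exact: ltW.
have [N [e e0 HN]] : exists N, exists2 e : R, 0 < e & forall n, (N <= n)%N -> e <= `|pi n z|.
  have pz2 : 0 < `|phi z| / 2 by rewrite divr_gt0// normr_gt0.
  have [N HN] := cvgn_dist_le (@pi_phi z) pz2.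
  exists N, (`|phi z| / 2) => // n /HN h.
  have := ler_normB (pi n z) (pi n z - phi z).
  by rewrite opprB addrC subrK; lra.
have P2 n : (N <= n)%N -> e ^+ 2 * rho n <= P n z ^+ 2.
  move=> /HN h; rewrite sqr_bdP// mulrC ler_pM2l// -(real_normK (num_real (pi n z))).
  by rewrite ler_sqr ?nnegrE// ltW.
have Pinv2 n : (N <= n)%N -> (P n z)^-1 ^+ 2 <= (e ^+ 2)^-1 * (rho n)^-1.
  move=> /P2 h; have er : 0 < e ^+ 2 * rho n by rewrite mulr_gt0 ?exprn_gt0.
  by rewrite exprVn -invfM lef_pV2 ?posrE// (lt_le_trans er).
have Pinv0 : (P n z)^-1 @[n --> \oo] --> (0 : R).
  apply: cvgn0I => x x0.
  have [K HK] := cvgn0_le (cvgn0Z (e ^+ 2)^-1 (chain_inv_rho_cvg0 G)) (exprn_gt0 2 x0).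
  exists (maxn N K) => n; rewrite geq_max => /andP[Nn Kn].
  rewrite -ler_sqr ?nnegrE// ?(ltW x0)// real_normK ?num_real//.
  apply: le_trans (Pinv2 n Nn) _; exact: le_trans (ler_norm _) (HK n Kn).
have Pn0 n : (N <= n)%N -> P n z != 0.
  move=> /P2 h; rewrite -sqrf_eq0 gt_eqF// (lt_le_trans _ h)// mulr_gt0// exprn_gt0//.
have W := real_jacobi_wronskian (bdP0 lam mu z) (fun n => real_jacobi_bdP n z) hQ.
pose u n := Q n * (P n z)^-1.
have u0 : u @ \oo --> (0 : R).
  apply: cvgn0I => x x0; have d20 : 0 < 2 / d by rewrite divr_gt0.
  have [K HK] := cvgn0_le (cvgn0Z (2 / d) Pinv0) x0; exists K => n /HK.
  apply: le_trans; rewrite /u (normrM (Q n)) (normrM (2 / d)) (ger0_norm (ltW d20)).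
  by rewrite ler_wpM2r.
have q3 : 0 <= q ^+ 3 < 1 by rewrite exprn_ge0 ?ltW//= exprn_ilt1// ltW.
have du n : (N <= n)%N -> `|u n.+1 - u n| <= (e ^+ 2 * c ^+ 2)^-1 * (q ^+ 3) ^+ n.
  move=> Nn; have Nn1 := leq_trans Nn (leqnSn n).
  have -> : u n.+1 - u n = (a n * P n z * P n.+1 z)^-1.
    have an0 : a n != 0 by rewrite gt_eqF.
    have := W n => Wn; rewrite /u.
    have -> : Q n.+1 * (P n.+1 z)^-1 - Q n * (P n z)^-1 =
      - (a n * (P n.+1 z * Q n - P n z * Q n.+1)) * (a n * P n z * P n.+1 z)^-1.
      by field; rewrite an0 !Pn0.
    by rewrite Wn opprK mul1r.
  have E : a n * P n z * P n.+1 z = - (lam n * rho n * (pi n z * pi n.+1 z)).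
    have := bda_sqrt_rhoS lam_gt0 mu_gt0 n => h.
    have h2 := sqr_sqrtr (ltW (rho_gt0 n)); rewrite expr2 in h2.
    transitivity (- ((-1) ^+ n) ^+ 2 * (a n * Num.sqrt (rho n.+1)) * Num.sqrt (rho n) * (pi n z * pi n.+1 z)).
      by rewrite /bdP exprS; ring.
    by rewrite h sqrr_sign -[in RHS]h2; ring.
  rewrite E normfV normrN normrM; have lr : 0 < lam n * rho n by rewrite mulr_gt0.
  rewrite (ger0_norm (ltW lr)).
  have H1 : e ^+ 2 <= `|pi n z * pi n.+1 z|.
    by rewrite normrM expr2; apply: ler_pM; rewrite ?(ltW e0)//; exact: HN.
  have /andP[H2 _] := chain_lam_rho G n.
  have q3n : 0 < (q ^+ 3) ^+ n by rewrite !exprn_gt0.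
  have ec : 0 < e ^+ 2 * c ^+ 2 by rewrite mulr_gt0 ?exprn_gt0.
  have H3 : e ^+ 2 * c ^+ 2 <= `|pi n z * pi n.+1 z| * (lam n * rho n * (q ^+ 3) ^+ n).
    by apply: ler_pM => //; exact: sqr_ge0.
  have pp : 0 < `|pi n z * pi n.+1 z| by apply: lt_le_trans H1; rewrite exprn_gt0.
  rewrite -[leLHS]mul1r ler_pdivrMr ?mulr_gt0// -mulrA ler_pdivlMl// mulr1.
  by apply: le_trans H3 _; rewrite le_eqVlt; apply/orP; left; apply/eqP; ring.
have ub := geometric_tail q3 du u0.
set K := (e ^+ 2 * c ^+ 2)^-1 / (1 - q ^+ 3) in ub.
have K0 : 0 <= K.
  apply: divr_ge0; first by rewrite invr_ge0; apply: mulr_ge0; exact: sqr_ge0.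
  by rewrite subr_ge0; case/andP: q3 => _ /ltW.
(* D1 bounds P and D2 bounds a; [K * D1] bounds Q from N on, and D3 turns the uniform bound 2 / d
   into one of order p^(5n) for n < N. *)
pose D1 := 1 + C * M ^+ 2; pose D2 := 1 + C ^+ 3 / c; pose D3 := 2 / d / (p ^+ 5) ^+ N.
have D10 : 0 < D1 by rewrite ltr_pwDl// mulr_ge0 ?sqr_ge0// ltW.
have D20 : 0 < D2 by rewrite ltr_pwDl// divr_ge0 ?exprn_ge0// ltW.
have D30 : 0 < D3 by rewrite !divr_gt0// !exprn_gt0.
have KD : 0 <= K * D1 by rewrite mulr_ge0// ltW.
apply: (@green_resolvent R a b a_gt0 z (P^~ z) Q p (D1 + D2 + D3 + K * D1)) => //.
- by rewrite p0.
- by apply: ltr_wpDr => //; apply: addr_gt0 => //; apply: addr_gt0.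
- exact: bdP0.
- by move=> n; exact: real_jacobi_bdP.
- by move=> n; apply: le_trans (bP n) _; rewrite -/D1; lra.
- move=> n; have [Nn|nN] := leqP N n.
    have -> : Q n = u n * P n z by rewrite /u mulfVK// Pn0.
    rewrite normrM -(ler_pM2r (pn n)) -mulrA.
    apply: (@le_trans _ _ (K * (q ^+ 3) ^+ n * D1)).
      by apply: ler_pM; [exact: normr_ge0|rewrite mulr_ge0// ltW|exact: ub|exact: bP].
    have -> : K * (q ^+ 3) ^+ n * D1 = K * D1 * (p ^+ 5) ^+ n * p ^+ n.
      by rewrite -pq -(exprM p 2 3) (exprAC p (2 * 3)) (exprAC p 5); ring.
    rewrite !ler_pM2r ?exprn_gt0//; lra.
  apply: le_trans (bQ n) _.
  apply: (@le_trans _ _ (D3 * (p ^+ 5) ^+ n)).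
    rewrite /D3 -mulrA; apply: ler_peMr; first by apply: divr_ge0 => //; exact: ltW.
    rewrite mulrC ler_pdivlMr ?exprn_gt0// mul1r.
    apply: ler_wiXn2l; [by rewrite exprn_ge0// ltW| |exact: ltnW].
    by apply: exprn_ile1; exact: ltW.
  by rewrite ler_wpM2r ?exprn_ge0 ?exprn_ge0 ?(ltW p0)//; lra.
- by move=> n; apply: le_trans (ba n) _; rewrite -/D2; lra.
- move=> P0; have [K1 HK1] := cvgn0_le P0 ltr01.
  have h20 : 0 < 2^-1 :> R by rewrite invr_gt0.
  have [K2 HK2] := cvgn0_le Pinv0 h20.
  pose k := maxn N (maxn K1 K2).
  have Nk : (N <= k)%N by rewrite leq_maxl.
  have h1 := HK1 k (leq_trans (leq_maxl _ _) (leq_maxr _ _)).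
  have h2 := HK2 k (leq_trans (leq_maxr _ _) (leq_maxr _ _)).
  have : 1 <= 2^-1 :> R.
    have e1 : `|P k z| * `|(P k z)^-1| = 1 by rewrite -normrM divff ?normr1// Pn0.
    rewrite -[leRHS]mul1r -[leLHS]e1; apply: ler_pM; [exact: normr_ge0|exact: normr_ge0| |].
      exact: h1.
    exact: h2.
  by lra.
Qed.

End nonroots.

(** * The characteristic and Weyl functions *)

Section complex_limits.
Variable R : realType.
Local Notation C := (Cplx R).
Local Notation "x %:C" := (real_complex R x : Cplx R).
Implicit Types (z w : C) (r e : R).

(** The norm of [R[i]] takes values in [R[i]]; its real part is the modulus as an element of R,
    where real inequalities can be solved. *)
Definition cabs z : R := complex.Re `|z|.

Lemma cabsE z : `|z| = (cabs z)%:C.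
Proof. by rewrite /cabs normc_def. Qed.

Lemma real_complex_le r e : (r%:C <= e%:C) = (r <= e).
Proof. exact: lecR. Qed.

Lemma cabs_ge0 z : 0 <= cabs z.
Proof. by rewrite -real_complex_le -cabsE normr_ge0. Qed.

Lemma cabsM z w : cabs (z * w) = cabs z * cabs w.
Proof.
have : (cabs (z * w))%:C = (cabs z * cabs w)%:C by rewrite -cabsE normrM !cabsE -rmorphM.
by move=> [].
Qed.

Lemma cabsV z : cabs z^-1 = (cabs z)^-1.
Proof.
have : (cabs z^-1)%:C = ((cabs z)^-1)%:C by rewrite -cabsE normfV cabsE fmorphV.
by move=> [].
Qed.

Lemma cabsD z w : cabs (z + w) <= cabs z + cabs w.
Proof. by rewrite -real_complex_le rmorphD -!cabsE ler_normD. Qed.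

Lemma cabsN z : cabs (- z) = cabs z.
Proof. by rewrite /cabs normrN. Qed.

Lemma cabsB z w : cabs (z - w) = cabs (w - z).
Proof. by rewrite /cabs distrC. Qed.

Lemma cabs_real r : cabs r%:C = `|r|.
Proof. by rewrite /cabs normc_def /= expr0n addr0 sqrtr_sqr. Qed.

Lemma cabs0 : cabs 0 = 0. Proof. by rewrite /cabs normr0. Qed.

Lemma cabs1 : cabs 1 = 1. Proof. by rewrite /cabs normr1. Qed.

Lemma cabs_eq0 z : (cabs z == 0) = (z == 0).
Proof.
apply/eqP/eqP => [h|->]; last exact: cabs0.
by apply/eqP; rewrite -normr_eq0 cabsE h.
Qed.

Lemma cabs_sqr z : cabs z ^+ 2 = csqr z.
Proof. by rewrite /cabs normc_def /= sqr_sqrtr// csqr_ge0. Qed.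

Lemma Re_le_cabs z : `|complex.Re z| <= cabs z.
Proof.
rewrite -ler_sqr ?nnegrE ?cabs_ge0// cabs_sqr real_normK ?num_real// lerDl.
exact: sqr_ge0.
Qed.

Lemma Im_le_cabs z : `|complex.Im z| <= cabs z.
Proof.
rewrite -ler_sqr ?nnegrE ?cabs_ge0// cabs_sqr real_normK ?num_real// lerDr.
exact: sqr_ge0.
Qed.

Lemma cabs_le_ReIm z : cabs z <= `|complex.Re z| + `|complex.Im z|.
Proof.
rewrite -ler_sqr ?nnegrE ?cabs_ge0 ?addr_ge0// cabs_sqr /csqr.
rewrite -(real_normK (num_real (complex.Re z))) -(real_normK (num_real (complex.Im z))).
rewrite sqrrD -addrA lerD2l lerDr.
by rewrite mulrn_wge0// mulr_ge0.
Qed.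

(** Positivity in the order of [R[i]] forces a zero imaginary part, so the epsilons of the norm
    topology are real. *)
Lemma cplx_gt0 (e' : C) : 0 < e' -> exists2 r : R, 0 < r & e' = r%:C.
Proof.
case: e' => a b; rewrite ltcE /= => /andP[/eqP -> a0]; exists a => //.
Qed.

Lemma cvgn_cplx (u : nat -> C) l :
  (forall e, 0 < e -> exists N, forall n, (N <= n)%N -> cabs (u n - l) <= e) ->
  u @ \oo --> l.
Proof.
move=> H; apply/cvgrPdist_le => e' /cplx_gt0[e e0 ->].
have [N HN] := H e e0; exists N => // n /= /HN h.
by rewrite cabsE real_complex_le cabsB.
Qed.

Lemma cvg_dnbhs_cplx (f : C -> C) z l :
  (forall e, 0 < e -> exists2 d, 0 < d & forall w, w != z -> cabs (w - z) < d ->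
     cabs (f w - l) <= e) ->
  f w @[w --> z^'] --> l.
Proof.
move=> H; apply/cvgrPdist_le => e' /cplx_gt0[e e0 ->].
have [d d0 Hd] := H e e0; apply/nbhs_ballP; exists d%:C.
  by rewrite /= ltcR.
move=> w; rewrite /ball/= cabsE => hw wz; rewrite cabsE real_complex_le cabsB.
by apply: Hd => //; move: hw; rewrite ltcR cabsB.
Qed.

Lemma cplx_summable_cvg (u : nat -> C) (v : nat -> R) (B : R) :
  (forall n, cabs (u n.+1 - u n) <= v n) ->
  (forall N, \sum_(n < N) v n <= B) ->
  exists l, forall e, 0 < e -> exists N, forall n, (N <= n)%N -> cabs (u n - l) <= e.
Proof.
move=> uv vB.
have v0 n : 0 <= v n by apply: le_trans (uv n); exact: cabs_ge0.
have cv : cvgn (series v).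
  apply: nondecreasing_is_cvgn; first by apply: nondecreasing_series.
  by exists B => _ [N _ <-]; rewrite /series/= big_mkord.
have part (f : C -> R) : (forall z w, f (z - w) = f z - f w) -> (forall z, `|f z| <= cabs z) ->
    exists l : R, f (u n) @[n --> \oo] --> l.
  move=> fB fc.
  have cs : cvgn (series (fun n => f (u n.+1) - f (u n))).
    apply: normed_cvg; apply: (series_le_cvg _ _ _ cv) => n //; first exact: normr_ge0.
    by rewrite /= -fB; apply: le_trans (fc _) (uv n).
  exists (limn (series (fun n => f (u n.+1) - f (u n))) + f (u 0%N)).
  rewrite (_ : (fun n => f (u n)) = (fun n => series (fun n => f (u n.+1) - f (u n)) n + f (u 0%N))).
    by apply: cvgD => //; exact: cvg_cst.
  by apply/funext => n; rewrite /series/= telescope_sumr// subrK.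
have [lr hr] := part (@complex.Re R) (fun z w => ltac:(by rewrite cReD cReN)) Re_le_cabs.
have [li hi] := part (@complex.Im R) (fun z w => ltac:(by rewrite cImD cImN)) Im_le_cabs.
exists (Complex lr li) => e e0; have e20 : 0 < e / 2 by rewrite divr_gt0.
have [N HN] := cvgn_dist_le hr e20; have [M HM] := cvgn_dist_le hi e20.
exists (maxn N M) => n; rewrite geq_max => /andP[/HN h1 /HM h2].
apply: le_trans (cabs_le_ReIm _) _; rewrite cReD cReN cImD cImN /=; lra.
Qed.

End complex_limits.

(** * The infinite product with one factor removed *)

Section products.
Variables (R : realType) (zeta : nat -> R) (S : R) (k0 : nat).
Local Notation C := (Cplx R).
Local Notation "x %:C" := (real_complex R x : Cplx R).
Implicit Types (z w : C) (r e : R).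
Hypothesis zeta_gt0 : forall k, 0 < zeta k.
Hypothesis zeta_inj : injective zeta.
Hypothesis zeta_sum : forall K, \sum_(k < K) (zeta k)^-1 <= S.

Let S0 : 0 <= S. Proof. by have := zeta_sum 0; rewrite big_ord0. Qed.

Definition punctured n z : C := \prod_(k < n | k != k0 :> nat) (1 - z / (zeta k)%:C).

Lemma puncturedS n z : punctured n.+1 z =
  punctured n z * (if n != k0 then 1 - z / (zeta n)%:C else 1).
Proof.
by rewrite /punctured big_mkcond big_ord_recr -big_mkcond.
Qed.

Lemma cabs_factor z k : cabs (1 - z / (zeta k)%:C) <= 1 + cabs z / zeta k.
Proof.
apply: le_trans (cabsD _ _) _; rewrite cabs1 cabsN cabsM cabsV cabs_real.
by rewrite gtr0_norm.
Qed.

(** Each factor is at most 1 + M / zeta_k <= exp(M / zeta_k) in modulus. *)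
Lemma cabs_punctured n z M : cabs z <= M -> cabs (punctured n z) <= expR (M * S).
Proof.
move=> zM; have M0 : 0 <= M by apply: le_trans zM; exact: cabs_ge0.
apply: (@le_trans _ _ (expR (M * \sum_(k < n) (zeta k)^-1))); last first.
  by rewrite ler_expR ler_wpM2l.
elim: n => [|n IH]; first by rewrite /punctured !big_ord0 cabs1 mulr0 expR0.
rewrite puncturedS cabsM big_ord_recr/= mulrDr expRD.
apply: ler_pM => //; rewrite ?cabs_ge0//.
apply: le_trans _ (expR_ge1Dx _).
have Mz : cabs z / zeta n <= M / zeta n by rewrite ler_pM2r ?invr_gt0.
case: ifP => _; first by apply: le_trans (cabs_factor _ _) _; rewrite lerD2l.
by rewrite cabs1 lerDl divr_ge0// ltW.
Qed.

Lemma punctured_cvg z : exists l, forall e, 0 < e -> exists N, forall n, (N <= n)%N ->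
  cabs (punctured n z - l) <= e.
Proof.
set M := cabs z.
apply: (@cplx_summable_cvg _ _ (fun n => expR (M * S) * (M / zeta n)) (expR (M * S) * (M * S))).
  move=> n; rewrite puncturedS -[X in _ - X]mulr1 -mulrBr cabsM.
  apply: ler_pM; rewrite ?cabs_ge0//; first exact: cabs_punctured.
  case: ifP => _; last by rewrite subrr cabs0 divr_ge0 ?cabs_ge0// ltW.
  by rewrite addrAC subrr add0r cabsN cabsM cabsV cabs_real gtr0_norm.
move=> N; rewrite -!mulr_sumr ler_wpM2l ?expR_ge0// ler_wpM2l ?cabs_ge0//.
Qed.

(** Uniform in [n], hence inherited by the limit. The product rule replaces the factors one at a
    time, the n-th replacement costing |z - w| / zeta_n. *)
Lemma punctured_lipschitz n z w M : cabs z <= M -> cabs w <= M ->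
  cabs (punctured n z - punctured n w) <= expR (M * S) * expR (M * S) * S * cabs (z - w).
Proof.
move=> zM wM; have M0 : 0 <= M by apply: le_trans zM; exact: cabs_ge0.
(* For the induction, one factor exp(M S) and the sum S are sharpened to the partial sums [s n],
   which absorb 1 + M / zeta_n and 1 / zeta_n. *)
pose s n := \sum_(k < n) (zeta k)^-1.
have s0 k : 0 <= s k by apply: sumr_ge0 => i _; rewrite invr_ge0 ltW.
apply: (@le_trans _ _ (expR (M * S) * expR (M * s n) * s n * cabs (z - w))); last first.
  rewrite ler_wpM2r ?cabs_ge0//; apply: ler_pM; rewrite ?mulr_ge0 ?expR_ge0//; last exact: zeta_sum.
  by rewrite ler_wpM2l ?expR_ge0// ler_expR ler_wpM2l//; exact: zeta_sum.
elim: n => [|n IH].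
  rewrite /punctured !big_ord0 subrr cabs0.
  by rewrite !mulr_ge0 ?expR_ge0 ?cabs_ge0.
have E1 : s n.+1 = s n + (zeta n)^-1 by rewrite /s big_ord_recr.
have z0 := zeta_gt0 n; have iz0 : 0 < (zeta n)^-1 by rewrite invr_gt0.
have Es : expR (M * s n) * (1 + M / zeta n) <= expR (M * s n.+1).
  by rewrite E1 (mulrDr M) expRD ler_wpM2l ?expR_ge0// expR_ge1Dx.
have E1s : 1 <= expR (M * s n.+1).
  by rewrite -(expR0 R) ler_expR mulr_ge0.
have d0 := cabs_ge0 (z - w).
have ES := expR_ge0 (M * S).
rewrite !puncturedS; case: ifP => _; last first.
  rewrite !mulr1; apply: le_trans IH _; apply: ler_wpM2r => //.
  apply: ler_pM; rewrite ?mulr_ge0 ?expR_ge0//; last by rewrite E1 lerDl ltW.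
  by rewrite ler_wpM2l// ler_expR ler_wpM2l// E1 lerDl ltW.
set p := punctured n z; set r := punctured n w.
have -> : p * (1 - z / (zeta n)%:C) - r * (1 - w / (zeta n)%:C) =
  (p - r) * (1 - z / (zeta n)%:C) + r * (- ((z - w) / (zeta n)%:C)) by ring.
apply: le_trans (cabsD _ _) _; rewrite !cabsM cabsN cabsM cabsV cabs_real gtr0_norm//.
have F : cabs (1 - z / (zeta n)%:C) <= 1 + M / zeta n.
  by apply: le_trans (cabs_factor _ _) _; rewrite lerD2l ler_pM2r.
have G : cabs r <= expR (M * S) by exact: cabs_punctured.
have M1 : 0 <= 1 + M / zeta n by rewrite addr_ge0// divr_ge0// ltW.
apply: (@le_trans _ _ (expR (M * S) * (expR (M * s n) * (1 + M / zeta n)) * s n * cabs (z - w)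
   + expR (M * S) * (cabs (z - w) / zeta n))).
  apply: lerD; last by apply: ler_wpM2r => //; rewrite mulr_ge0// ltW.
  apply: le_trans (ler_pM (cabs_ge0 _) (cabs_ge0 _) IH F) _.
  by rewrite le_eqVlt; apply/orP; left; apply/eqP; ring.
have -> : expR (M * S) * expR (M * s n.+1) * s n.+1 * cabs (z - w) =
    expR (M * S) * expR (M * s n.+1) * s n * cabs (z - w) +
    expR (M * S) * (cabs (z - w) / zeta n) * expR (M * s n.+1).
  by rewrite [X in _ * X * _](E1); ring.
apply: lerD.
  by do 2 (apply: ler_wpM2r => //); apply: ler_wpM2l.
by apply: ler_peMr => //; rewrite mulr_ge0// divr_ge0// ltW.
Qed.

(** Weierstrass' product inequality. *)
Lemma prod_1sub_ge (f : nat -> R) n : (forall k, 0 <= f k <= 1) ->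
  1 - \sum_(k < n) f k <= \prod_(k < n) (1 - f k).
Proof.
move=> f01; elim: n => [|n IH]; first by rewrite !big_ord0 subr0.
rewrite !big_ord_recr/=; have /andP[h0 h1] := f01 n.
have s0 : 0 <= \sum_(k < n) f k by apply: sumr_ge0 => i _; case/andP: (f01 i).
have : (1 - \sum_(k < n) f k) * (1 - f n) <= (\prod_(k < n) (1 - f k)) * (1 - f n).
  by rewrite ler_wpM2r// subr_ge0.
nra.
Qed.

(** Finitely many factors are nonzero because the zeta_k are distinct, and by Weierstrass'
    inequality the product of the others is at least 1/2. *)
Lemma punctured_bounded_below : exists2 e : R, 0 < e &
  exists N, forall n, (N <= n)%N -> e <= cabs (punctured n (zeta k0)%:C).
Proof.
set x := zeta k0; have x0 : 0 < x := zeta_gt0 k0.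
have cz : cvgn (series (fun k => (zeta k)^-1)).
  apply: nondecreasing_is_cvgn.
    by apply: nondecreasing_series => i _ _; rewrite invr_ge0 ltW.
  by exists S => _ [N _ <-]; rewrite /series/= big_mkord.
have e0 : 0 < (2 * x)^-1 by rewrite invr_gt0 mulr_gt0.
have [N1 HN1] := cvgn_dist_le cz e0.
(* Beyond N the sum of x / zeta_k is at most 1/2 and the omitted index k0 no longer occurs. *)
pose N := maxn N1 k0.+1.
have tail m : \sum_(k < m) x / zeta (N + k)%N <= 1 / 2.
  rewrite -mulr_sumr.
  have -> : \sum_(k < m) (zeta (N + k)%N)^-1 =
      series (fun k => (zeta k)^-1) (N + m)%N - series (fun k => (zeta k)^-1) N.
    by rewrite /series/= !big_mkord big_split_ord/= addrAC subrr add0r.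
  have h : series (fun k => (zeta k)^-1) (N + m)%N <= limn (series (fun k => (zeta k)^-1)).
    apply: nondecreasing_cvgn_le => //.
    by apply: nondecreasing_series => i _ _; rewrite invr_ge0 ltW.
  have := HN1 N (leq_maxl _ _); rewrite distrC => /(le_trans (ler_norm _)) h2.
  rewrite -ler_pdivlMl// mul1r -invfM mulrC; lra.
have fact k : k != k0 -> 0 < cabs (1 - x%:C / (zeta k)%:C).
  move=> kk; rewrite lt_neqAle cabs_ge0 andbT eq_sym cabs_eq0 subr_eq0.
  have zk : (zeta k)%:C != 0 by rewrite -cabs_eq0 cabs_real normr_eq0 gt_eqF.
  apply/eqP => h; move/eqP: kk; apply; apply: zeta_inj.
  have : (zeta k)%:C = x%:C by rewrite -[RHS](divfK zk) -h mul1r.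
  by case.
have P0 : 0 < cabs (punctured N x%:C).
  elim: (N) => [|j IH]; first by rewrite /punctured big_ord0 cabs1.
  rewrite puncturedS cabsM mulr_gt0//; case: ifP => // jk; last by rewrite cabs1.
  exact: fact.
exists (cabs (punctured N x%:C) * (1 / 2)); first by rewrite mulr_gt0// divr_gt0.
exists N => n Nn; rewrite -(subnKC Nn); set m := (n - N)%N.
have -> : punctured (N + m) x%:C = punctured N x%:C * (\prod_(k < m) (1 - x / zeta (N + k)%N))%:C.
  elim: m => [|j IH]; first by rewrite addn0 big_ord0 mulr1.
  rewrite addnS puncturedS IH big_ord_recr/= rmorphM mulrA.
  have -> : (N + j)%N != k0.
    by rewrite gtn_eqF// (leq_trans _ (leq_addr _ _))// leq_maxr.
  by rewrite rmorphB rmorph1 rmorphM fmorphV.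
rewrite cabsM ler_wpM2l ?cabs_ge0// cabs_real.
apply: le_trans _ (ler_norm _).
apply: le_trans _ (@prod_1sub_ge (fun k => x / zeta (N + k)%N) m _).
  by have := tail m; lra.
move=> k; rewrite divr_ge0 ?(ltW x0) ?(ltW (zeta_gt0 _))//=.
have := tail k.+1; rewrite big_ord_recr/=.
have : 0 <= \sum_(i < k) x / zeta (N + i)%N.
  by apply: sumr_ge0 => i _; rewrite divr_ge0// ltW.
lra.
Qed.

(** H is the limit of the punctured products. The bounds on discs are what the computations at
    zeta_k0 use in place of holomorphy. *)
Lemma charF_factor : exists H : C -> C,
  [/\ forall z, charF zeta z = (1 - z / (zeta k0)%:C) * H z,
      H (zeta k0)%:C != 0 &
      forall M, exists2 B : R, 0 < B & (forall z w, cabs z <= M -> cabs w <= M ->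
        cabs (H z) <= B /\ cabs (H z - H w) <= B * cabs (z - w))].
Proof.
have [H HH] := choice punctured_cvg; exists H; split.
- move=> z; apply: cvg_lim; first exact: norm_hausdorff.
  have E n : (k0 < n)%N -> \prod_(k < n) (1 - z / (zeta k)%:C) =
      (1 - z / (zeta k0)%:C) * punctured n z.
    by move=> kn; rewrite (bigD1 (Ordinal kn)).
  apply: (@cvg_trans _ ((1 - z / (zeta k0)%:C) * punctured n z @[n --> \oo])).
    by apply: near_eq_cvg; exists k0.+1 => // n /= /E ->.
  by apply: cvgM; [exact: cvg_cst|exact: (cvgn_cplx (HH z))].
- have [e e0 [N HN]] := punctured_bounded_below.
  have e20 : 0 < e / 2 by rewrite divr_gt0.
  have [M HM] := HH (zeta k0)%:C _ e20.
  apply/eqP => h0; have := HM (maxn M N) (leq_maxl _ _).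
  rewrite h0 subr0; have := HN (maxn M N) (leq_maxr _ _); lra.
- move=> M.
  pose B1 := expR (M * S); pose B2 := expR (M * S) * expR (M * S) * S.
  have B10 : 0 < B1 by exact: expR_gt0.
  have B20 : 0 <= B2 by rewrite !mulr_ge0// expR_ge0.
  exists (B1 + B2); first by rewrite ltr_pwDl.
  move=> z w zM wM; split.
    apply: (@le_trans _ _ B1); last by rewrite lerDl.
    apply/ler_addgt0Pr => e e0; have [N HN] := HH z e e0.
    rewrite -[H z](subKr (punctured N z)); apply: le_trans (cabsD _ _) _.
    by rewrite cabsN lerD ?HN// cabs_punctured.
  apply: (@le_trans _ _ (B2 * cabs (z - w))); last first.
    by rewrite ler_wpM2r ?cabs_ge0// lerDr ltW.
  apply/ler_addgt0Pr => e e0; have e20 : 0 < e / 2 by rewrite divr_gt0.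
  have [N HN] := HH z _ e20; have [K HK] := HH w _ e20.
  pose n := maxn N K.
  have -> : H z - H w = (punctured n z - punctured n w) +
     ((punctured n w - H w) - (punctured n z - H z)) by ring.
  apply: le_trans (cabsD _ _) _; apply: lerD; first exact: punctured_lipschitz.
  apply: le_trans (cabsD _ _) _; rewrite cabsN.
  have := HN n (leq_maxl _ _); have := HK n (leq_maxr _ _); lra.
Qed.

End products.

(** * The pole of the Weyl function at an isolated point of the support *)

Section weyl.
Variables (R : realType) (m : probability (measurableTypeR R) R) (Z : set R).
Local Notation C := (Cplx R).
Local Notation "x %:C" := (real_complex R x : Cplx R).
Implicit Types (z w : C) (x t r e : R).
Hypothesis mZ : measurable (Z : set (measurableTypeR R)).
Hypothesis mZ0 : m (~` Z) = 0%E.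
Local Notation integ f :=
  (m.-integrable [set: measurableTypeR R] (EFin \o (f : measurableTypeR R -> R))).

(** Almost everywhere f is the sum of its value at the atom x and of a function bounded by B, and m
    has total mass 1. *)
Lemma Rintegral_isolated_atom (f : R -> R) x (B : R) : 0 <= B ->
  measurable_fun setT (f : measurableTypeR R -> R) ->
  (forall t, Z t -> t != x -> `|f t| <= B) ->
  `|(\int[m]_t f t)%R - f x * fine (m [set x])| <= B.
Proof.
move=> B0 mf fB.
(* The cut-off makes the remainder bounded everywhere without changing it on Z away from x. *)
pose k t : R := if `|f t| <= B then f t * \1_(~` [set x]) t else 0.
have mk : measurable_fun setT (k : measurableTypeR R -> R).
  apply: measurable_fun_ifT.
  - apply: measurable_fun_ler; last exact: measurable_cst.
    by apply: measurableT_comp => //; exact: normr_measurable.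
  - apply: measurable_funM => //; apply: measurable_indic.
    by apply: measurableC; exact: measurable_set1.
  - exact: measurable_cst.
have bk t : `|k t| <= B.
  rewrite /k; case: ifP => h; last by rewrite normr0.
  rewrite normrM; apply: le_trans _ h; rewrite ler_piMr// indicE.
  by case: (_ \in _); rewrite ?normr1// normr0.
have Ik : integ k.
  apply: (@integrable_dominated _ (measurableTypeR R) R m k (fun=> B)) => //.
  exact: finite_measure_integrable_cst.
have I1 : integ (fun t => f x * \1_[set x] t).
  exact: (integrableZl measurableT (f x) (integrable_atom m x)).
have -> : (\int[m]_t f t)%R = (\int[m]_t (f x * \1_[set x] t + k t))%R.
  congr fine; apply: ae_eq_integral => //.
  - exact/measurable_EFinP.
  - by have /integrableP[] := integrableD measurableT I1 Ik.
  have : m.-negligible (~` Z) by apply/negligibleP => //; exact: measurableC.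
  apply: negligibleS => t /= nt zt; apply: nt => _; congr EFin.
  rewrite /k; have [->|tx] := eqVneq t x.
    by rewrite !indicE mem_set// memNset ?mulr1 ?mulr0 ?if_same ?addr0//; apply.
  rewrite fB// !indicE memNset ?mulr0 ?add0r; last by move=> /= e; move: tx; rewrite e eqxx.
  by rewrite mem_set ?mulr1//= => e; move: tx; rewrite e eqxx.
rewrite RintegralD// RintegralZl//; last exact: integrable_atom.
rewrite Rintegral_atom addrAC subrr add0r.
apply: le_trans (le_normr_Rintegral _ Ik) _ => //.
apply: (@le_trans _ _ (\int[m]_t B)%R); last first.
  by rewrite Rintegral_cst//= probability_setT/= mulr1.
apply: le_Rintegral => //; first exact: (integrable_norm Ik).
exact: finite_measure_integrable_cst.
Qed.

(** For z = u + i v the inverse in [R[i]] unfolds to a real quotient with denominator (t - u)^2 +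
    v^2, so [measurable_inv] applies, also at a zero of the denominator. *)
Lemma measurable_Re_resolvent z :
  measurable_fun setT (fun t : measurableTypeR R => complex.Re (t%:C - z)^-1).
Proof.
case: z => u v.
have ms : measurable_fun setT (fun t : measurableTypeR R => t - u).
  by apply: measurable_funB; [exact: measurable_id|exact: measurable_cst].
apply: measurable_funM => //.
apply: (measurableT_comp (@measurable_inv R)).
apply: measurable_funD; last exact: measurable_cst.
exact: measurable_funX.
Qed.

Lemma measurable_Im_resolvent z :
  measurable_fun setT (fun t : measurableTypeR R => complex.Im (t%:C - z)^-1).
Proof.
case: z => u v.
have ms : measurable_fun setT (fun t : measurableTypeR R => t - u).
  by apply: measurable_funB; [exact: measurable_id|exact: measurable_cst].
apply: measurable_funN; apply: measurable_funM; first exact: measurable_cst.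
apply: (measurableT_comp (@measurable_inv R)).
apply: measurable_funD; last exact: measurable_cst.
exact: measurable_funX.
Qed.

(** For z within d/2 of x, the other points of Z are at distance at least d/2 from z. The bound 2 /
    d occurs twice, for the real and the imaginary part. *)
Lemma weylw_pole x d z : 0 < d -> (forall t, Z t -> t != x -> d <= `|t - x|) ->
  cabs (z - x%:C) <= d / 2 ->
  cabs (weylw m z - (fine (m [set x]))%:C * (x%:C - z)^-1) <= 4 / d.
Proof.
move=> d0 hd zx; have b0 : 0 <= 2 / d by rewrite divr_ge0// ltW.
have far t : Z t -> t != x -> cabs (t%:C - z)^-1 <= 2 / d.
  move=> zt tx; have hc : d / 2 <= cabs (t%:C - z).
    have := hd t zt tx; rewrite -cabs_real.
    have := cabsD (t%:C - z) (z - x%:C); rewrite addrA subrK -rmorphB.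
    move: zx; move: (cabs _) (cabs _) (cabs _) => c1 c2 c3; lra.
  by rewrite cabsV -invf_div lef_pV2 ?posrE ?divr_gt0// (lt_le_trans _ hc)// divr_gt0.
apply: le_trans (cabs_le_ReIm _) _; rewrite cReD cReN cImD cImN cReZ cImZ.
have -> : 4 / d = 2 / d + 2 / d by field; rewrite gt_eqF.
rewrite [_ * complex.Re _]mulrC [_ * complex.Im _]mulrC /weylw /=; apply: lerD.
  apply: (@Rintegral_isolated_atom (fun t => complex.Re (t%:C - z)^-1) x) => //.
    exact: measurable_Re_resolvent.
  by move=> t zt tx; apply: le_trans (Re_le_cabs _) (far t zt tx).
apply: (@Rintegral_isolated_atom (fun t => complex.Im (t%:C - z)^-1) x) => //.
  exact: measurable_Im_resolvent.
by move=> t zt tx; apply: le_trans (Im_le_cabs _) (far t zt tx).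
Qed.

Variables (zeta : nat -> R) (S : R) (k0 : nat) (d : R).
Hypothesis zeta_gt0 : forall k, 0 < zeta k.
Hypothesis zeta_inj : injective zeta.
Hypothesis zeta_sum : forall K, \sum_(k < K) (zeta k)^-1 <= S.
Hypothesis d0 : 0 < d.
Hypothesis isolated : forall t, Z t -> t != zeta k0 -> d <= `|t - zeta k0|.

Lemma weyl_mass : (fine (m [set zeta k0]))%:C =
  - weylW m zeta (zeta k0)%:C * (derive1 (charF zeta) (zeta k0)%:C)^-1.
Proof.
set x := zeta k0; set mx := fine (m [set x]).
have [H [HF H0 Hlip]] := charF_factor k0 zeta_gt0 zeta_inj zeta_sum.
have x0 : 0 < x by exact: zeta_gt0.
have xc : x%:C != 0 by rewrite -cabs_eq0 cabs_real normr_eq0 gt_eqF.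
have ax : cabs x%:C = x by rewrite cabs_real gtr0_norm.
have [B B0 HB] := Hlip (x + d + 1).
have near_le w : cabs (w - x%:C) < d + 1 -> cabs w <= x + d + 1.
  move=> h; rewrite -[w](subrK x%:C); apply: le_trans (cabsD _ _) _; rewrite ax.
  by rewrite addrC -addrA lerD2l ltW.
have xM : cabs x%:C <= x + d + 1 by rewrite ax -addrA lerDl addr_ge0// ltW.
have mx0 : 0 <= mx by rewrite fine_ge0.
have HW : weylW m zeta x%:C = (mx / x)%:C * H x%:C.
  apply: cvg_lim; first exact: norm_hausdorff.
  apply: cvg_dnbhs_cplx => e e0.
  (* A Lipschitz constant of w F near x: the first term comes from H, the second from the bounded
     part of w multiplied by the zero of F. *)
  pose L := mx / x * B + 4 / d / x * B.
  have L0 : 0 <= L by rewrite addr_ge0// !mulr_ge0 ?invr_ge0 ?(ltW B0) ?(ltW x0) ?(ltW d0).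
  have L1 : 0 < L + 1 by rewrite ltr_wpDl.
  exists (Num.min (d / 2) (e / (L + 1))).
    by rewrite lt_min !divr_gt0.
  move=> w wx; rewrite lt_min => /andP[h1 h2].
  have wM : cabs w <= x + d + 1 by apply: near_le; move: h1 d0; move: (cabs _) => c1; lra.
  have [Bw Lw] := HB w x%:C wM xM.
  have P := weylw_pole d0 isolated (ltW h1); rewrite -/x -/mx in P.
  set r := weylw m w - mx%:C * (x%:C - w)^-1 in P.
  have wx' : x%:C - w != 0 by rewrite subr_eq0 eq_sym.
  have -> : weylw m w * charF zeta w - (mx / x)%:C * H x%:C =
      (mx / x)%:C * (H w - H x%:C) + r * ((x%:C - w) / x%:C) * H w.
    rewrite HF -/x /r rmorphM fmorphV; field.
    by rewrite xc wx'.
  apply: le_trans (cabsD _ _) _; rewrite !cabsM cabsV ax cabs_real.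
  rewrite ger0_norm ?divr_ge0 ?(ltW x0)// [cabs (x%:C - w)]cabsB.
  apply: (@le_trans _ _ (L * cabs (w - x%:C))).
    have -> : L * cabs (w - x%:C) = mx / x * (B * cabs (w - x%:C)) +
        4 / d * (cabs (w - x%:C) / x) * B by rewrite /L; field; rewrite !gt_eqF.
    apply: lerD; first by rewrite ler_wpM2l// divr_ge0// ltW.
    apply: ler_pM => //; rewrite ?cabs_ge0 ?mulr_ge0 ?cabs_ge0 ?invr_ge0 ?(ltW x0)//.
    by apply: ler_wpM2r => //; rewrite mulr_ge0 ?cabs_ge0 ?invr_ge0 ?(ltW x0).
  move: h2; rewrite ltr_pdivlMr// => h2.
  have := cabs_ge0 (w - x%:C); nra.
have HD : derive1 (charF zeta) x%:C = - (H x%:C / x%:C).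
  apply: cvg_lim; first exact: norm_hausdorff.
  apply: cvg_dnbhs_cplx => e e0.
  exists (Num.min d (e * x / B)); first by rewrite lt_min d0 !divr_gt0 ?mulr_gt0.
  move=> h hn0; rewrite subr0 lt_min => /andP[h1 h2].
  have hM : cabs (h + x%:C) <= x + d + 1.
    by apply: near_le; rewrite addrK; move: h1 d0; move: (cabs _) => c1; lra.
  have [_ Lh] := HB _ _ hM xM; rewrite addrK in Lh.
  (* As F(x) = 0, the difference quotient is exactly - H(x + h) / x. *)
  have -> : h^-1 *: (charF zeta (h + x%:C) - charF zeta x%:C) - - (H x%:C / x%:C) =
     - ((H (h + x%:C) - H x%:C) / x%:C).
    rewrite /GRing.scale/= !HF -/x; field.
    by rewrite xc hn0.
  rewrite cabsN cabsM cabsV ax ler_pdivrMr//.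
  apply: le_trans Lh _; move: h2; rewrite ltr_pdivlMr// => h2; lra.
have xr : x != 0 by rewrite gt_eqF.
rewrite HW HD invrN mulrNN rmorphM fmorphV.
by field; rewrite H0 xc.
Qed.

End weyl.

(** * The modified q-Laguerre coefficients *)

Section q_products.
Variables (R : realType) (q : R).
Hypothesis q01 : 0 < q < 1.
Implicit Types (a W : R) (n k : nat).

Let q0 : 0 < q. Proof. by case/andP: q01. Qed.
Let q1 : q < 1. Proof. by case/andP: q01. Qed.
Let qn0 n : 0 < q ^+ n. Proof. by rewrite exprn_gt0. Qed.
Let qn1 n : q ^+ n <= 1. Proof. by rewrite exprn_ile1// ltW. Qed.
Let iq : 0 < 1 - q. Proof. by rewrite subr_gt0. Qed.

Lemma qpochS a n : qpoch q a n.+1 = qpoch q a n * (1 - a * q ^+ n).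
Proof. by rewrite /qpoch big_ord_recr. Qed.

Lemma qpochS_l a n : qpoch q a n.+1 = (1 - a) * qpoch q (a * q) n.
Proof.
rewrite /qpoch big_ord_recl expr0 mulr1; congr (_ * _).
by apply: eq_bigr => i _; rewrite /= exprS mulrA.
Qed.

Lemma qfactor a k : 0 <= a <= 1 -> 0 <= a * q ^+ k <= 1.
Proof.
move=> /andP[a0 a1]; rewrite mulr_ge0//= ?(ltW (qn0 _))//.
by rewrite mulr_ile1 ?(ltW (qn0 _)).
Qed.

Lemma qpoch_ge0 a n : 0 <= a <= 1 -> 0 <= qpoch q a n.
Proof.
by move=> a01; apply: prodr_ge0 => i _; rewrite subr_ge0; case/andP: (qfactor i a01).
Qed.

Lemma qpoch_nonincreasing a : 0 <= a <= 1 -> nonincreasing_seq (qpoch q a).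
Proof.
move=> a01; apply/nonincreasing_seqP => n; rewrite qpochS.
by rewrite ler_piMr ?qpoch_ge0// gerBl; case/andP: (qfactor n a01).
Qed.

Lemma qpoch_cvg a : 0 <= a <= 1 -> qpoch q a @ \oo --> qpoch_inf q a.
Proof.
move=> a01; apply: nonincreasing_is_cvgn; first exact: qpoch_nonincreasing.
by exists 0 => _ [n _ <-]; exact: qpoch_ge0.
Qed.

Lemma qpoch_inf_le a n : 0 <= a <= 1 -> qpoch_inf q a <= qpoch q a n.
Proof.
move=> a01; apply: nonincreasing_cvgn_ge; first exact: qpoch_nonincreasing.
exact: (cvgP _ (qpoch_cvg a01)).
Qed.

Lemma qpoch_le1 a n : 0 <= a <= 1 -> qpoch q a n <= 1.
Proof.
move=> a01; have := qpoch_nonincreasing a01 (leq0n n).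
by rewrite {2}/qpoch big_ord0.
Qed.

Lemma qpoch_inf_rec a : 0 <= a <= 1 -> qpoch_inf q a = (1 - a) * qpoch_inf q (a * q).
Proof.
move=> a01; have aq : 0 <= a * q <= 1 by have := qfactor 1 a01; rewrite expr1.
apply: cvg_lim; first exact: norm_hausdorff.
rewrite -cvg_shiftS; under eq_fun do rewrite qpochS_l.
by apply: cvgMl_tmp; exact: qpoch_cvg.
Qed.

Lemma qpoch_inf_ge a : 0 <= a <= 1 -> 1 - a / (1 - q) <= qpoch_inf q a.
Proof.
move=> a01; have /andP[a0 a1] := a01.
rewrite -lerN2; apply: (@cvgn_le _ (fun n => - qpoch q a n)).
  by apply: cvgN; exact: qpoch_cvg.
move=> n; rewrite lerN2; apply: le_trans (prod_1sub_ge n (fun k => qfactor k a01)).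
rewrite lerD2l lerN2 -mulr_sumr ler_wpM2l// -[leRHS]mul1r.
rewrite -(big_mkord xpredT (fun i => q ^+ i)).
have -> : \sum_(0 <= i < n) q ^+ i = series (geometric 1 q) n.
  by apply: eq_bigr => i _; rewrite /= mul1r.
rewrite geometric_seriesE ?lt_eqF//= ler_pM2r ?invr_gt0//.
by rewrite mul1r gerBl ltW.
Qed.

(** Factors are split off until the parameter is at most (1 - q) / 2; there [qpoch_inf_ge] gives at
    least 1/2. *)
Lemma qpoch_inf_gt0 a : 0 <= a < 1 -> 0 < qpoch_inf q a.
Proof.
move=> /andP[a0 a1].
have : a * q ^+ n @[n --> \oo] --> (0 : R).
  by apply: cvg_geometric; rewrite ger0_norm// ltW.
have q2 : 0 < (1 - q) / 2 by rewrite divr_gt0.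
move=> /cvgn0_le /(_ _ q2)[N HN].
have {HN} : a * q ^+ N <= (1 - q) / 2 by apply: le_trans (ler_norm _) (HN N _).
elim: N a a0 a1 => [|N IH] a a0 a1.
  rewrite expr0 mulr1 => h; apply: lt_le_trans (qpoch_inf_ge _); last by rewrite a0 ltW.
  rewrite subr_gt0 ltr_pdivrMr// mul1r; apply: le_lt_trans h _.
  by rewrite ltr_pdivrMr// ltr_pMr// ltr1n.
rewrite exprS mulrA => h; rewrite qpoch_inf_rec ?a0 ?ltW//.
rewrite mulr_gt0 ?subr_gt0//; apply: IH => //; first by rewrite mulr_ge0// ltW.
by rewrite mulr_ilt1// ltW.
Qed.

Lemma qpoch_gt0 a n : 0 <= a < 1 -> 0 < qpoch q a n.
Proof.
move=> a01; apply: lt_le_trans (qpoch_inf_gt0 a01) (qpoch_inf_le _ _).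
by case/andP: a01 => -> /ltW ->.
Qed.

Lemma qpoch_inf1 : qpoch_inf q 1 = 0.
Proof. by rewrite qpoch_inf_rec ?subrr ?mul0r// ler01 lexx. Qed.

(** With 2 W in place of W, consecutive terms have ratio 2 W q^(2k), which is eventually at most 1;
    so these terms are bounded, and the spare 2^k is returned as 2^(-k). *)
Lemma gaussian_bound W : 0 <= W ->
  exists2 A : R, 0 < A & forall k, q ^+ (k * k.-1) * W ^+ k <= A * 2^-1 ^+ k.
Proof.
move=> W0; pose v k := q ^+ (k * k.-1) * (W * 2) ^+ k.
have W20 : 0 <= W * 2 by rewrite mulr_ge0.
have v0 k : 0 <= v k by rewrite mulr_ge0 ?exprn_ge0 ?(ltW q0).
have vS k : v k.+1 = v k * ((q ^+ 2) ^+ k * (W * 2)).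
  rewrite /v exprS; case: k => [|k]; first by rewrite !expr0; ring.
  have -> : (k.+2 * k.+2.-1 = k.+1 * k.+1.-1 + 2 * k.+1)%N by rewrite /= (mulnC 2) -mulnDr addn2 mulnC.
  by rewrite exprD (exprM q 2); ring.
have : (W * 2) * (q ^+ 2) ^+ n @[n --> \oo] --> (0 : R).
  apply: cvg_geometric; rewrite ger0_norm ?exprn_ge0 ?(ltW q0)//.
  by rewrite exprn_ilt1// ltW.
move=> /cvgn0_le /(_ _ ltr01)[N HN].
have H k : v (N + k)%N <= v N.
  elim: k => [|k IH]; first by rewrite addn0.
  rewrite addnS vS; apply: le_trans IH; rewrite ler_piMr//.
  by rewrite mulrC; apply: le_trans (ler_norm _) (HN _ (leq_addr _ _)).
have S0 : 0 <= \sum_(k < N.+1) v k by apply: sumr_ge0.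
exists (1 + \sum_(k < N.+1) v k); first by rewrite ltr_pwDl.
move=> k; have -> : q ^+ (k * k.-1) * W ^+ k = v k * 2^-1 ^+ k.
  by rewrite /v exprMn -!mulrA -exprMn divff ?expr1n ?mulr1// pnatr_eq0.
rewrite ler_wpM2r ?exprn_ge0//.
have [Nk|kN] := leqP N k.
  rewrite -(subnKC Nk); apply: le_trans (H _) _.
  rewrite big_ord_recr/= addrA lerDr addr_ge0//.
  by apply: sumr_ge0.
have kN1 : (k < N.+1)%N by rewrite ltnS ltnW.
rewrite (bigD1 (Ordinal kN1))//= addrCA lerDl addr_ge0//.
by apply: sumr_ge0.
Qed.

End q_products.

(** * Size of the modified coefficients *)

Section modified_weights.
Variables (R : realType) (q B : R).
Hypothesis q01 : 0 < q < 1.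
Hypothesis B01 : 0 < B < 1.
Implicit Types (n k : nat) (x : R).

Let q0 : 0 < q. Proof. by case/andP: q01. Qed.
Let q1 : q < 1. Proof. by case/andP: q01. Qed.
Let B0 : 0 < B. Proof. by case/andP: B01. Qed.
Let B1 : B < 1. Proof. by case/andP: B01. Qed.
Let qn0 n : 0 < q ^+ n. Proof. by rewrite exprn_gt0. Qed.
Let qn1 n : q ^+ n <= 1. Proof. by rewrite exprn_ile1// ltW. Qed.
Let q_neq0 : q != 0. Proof. by rewrite gt_eqF. Qed.
Let B_neq0 : B != 0. Proof. by rewrite gt_eqF. Qed.
Let qn_neq0 n : q ^+ n != 0. Proof. by rewrite gt_eqF. Qed.
Let iB : 0 < 1 - B. Proof. by rewrite subr_gt0. Qed.
Let iB_neq0 : 1 - B != 0. Proof. by rewrite gt_eqF. Qed.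
Let iq : 0 < 1 - q. Proof. by rewrite subr_gt0. Qed.
Let qn01 n : 0 <= q ^+ n <= 1. Proof. by rewrite ltW//= qn1. Qed.
Let qBlt n : q ^+ n * B < 1.
Proof. by apply: le_lt_trans B1; rewrite ler_piMl// ltW. Qed.
Let qB01 n : 0 <= q ^+ n * B < 1.
Proof. by rewrite qBlt mulr_ge0// ltW. Qed.
Let iqB n : 0 < 1 - q ^+ n * B. Proof. by rewrite subr_gt0. Qed.
Let iqB_neq0 n : 1 - q ^+ n * B != 0. Proof. by rewrite gt_eqF. Qed.
Let iqn n : 0 < 1 - q ^+ n.+1.
Proof. by rewrite subr_gt0 exprn_ilt1// ltW. Qed.
Let iqn_neq0 n : 1 - q ^+ n.+1 != 0. Proof. by rewrite gt_eqF. Qed.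

(* With B = q^(alpha+1): gam n is gamma(n, alpha+1; q), gamC n is 1 - gam n, and
   wlam, wmu are the coefficients lambda_n, mu_n with tildes. *)
Definition gam n : R := qpoch_inf q (q ^+ n) / qpoch_inf q (q ^+ n * B).
Definition gamC n : R := 1 - gam n.

Lemma gam0 : gam 0 = 0.
Proof. by rewrite /gam expr0 qpoch_inf1 ?mul0r. Qed.

Lemma gamS n : (1 - q ^+ n) * gam n.+1 = (1 - q ^+ n * B) * gam n.
Proof.
have I0 : qpoch_inf q (q ^+ n * B * q) != 0.
  have := qB01 n.+1; rewrite exprSr mulrAC => h.
  by rewrite gt_eqF// qpoch_inf_gt0.
rewrite /gam (qpoch_inf_rec q01 (qn01 n)) (@qpoch_inf_rec _ q q01 (q ^+ n * B)).
  by rewrite exprSr -(mulrAC _ B q); field; rewrite I0 iqB_neq0.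
by have /andP[-> /ltW ->] := qB01 n.
Qed.

Lemma gam_gt0 n : 0 < gam n.+1.
Proof.
rewrite divr_gt0 ?qpoch_inf_gt0//.
by rewrite ltW//= exprn_ilt1// ltW.
Qed.

(** The increments of [gam] are positive and of exact order q^n; monotonicity and both bounds on
    [gamC] follow from this. *)
Lemma gam_sub n : gam n.+1 - gam n = gam n.+1 * (q ^+ n * (1 - B) / (1 - q ^+ n * B)).
Proof.
apply: (mulfI (iqB_neq0 n)); rewrite mulrBr -gamS.
by field.
Qed.

Lemma gam_nondecreasing : nondecreasing_seq gam.
Proof.
apply/nondecreasing_seqP => n; rewrite -subr_ge0 gam_sub.
by rewrite mulr_ge0 ?(ltW (gam_gt0 n))// divr_ge0 ?(ltW (iqB n))// mulr_ge0 ?ltW.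
Qed.

Lemma gam_cvg : gam @ \oo --> (1 : R).
Proof.
have I a : 0 <= a <= 1 -> qpoch_inf q (q ^+ n * a) @[n --> \oo] --> (1 : R).
  move=> /andP[a0 a1]; have h n : 0 <= q ^+ n * a <= 1.
    by rewrite mulr_ge0 ?mulr_ile1 ?(ltW (qn0 n)).
  apply: cvgn_sub0; apply: cvgn0I => e e0.
  have : (1 - q)^-1 * q ^+ n @[n --> \oo] --> (0 : R).
    by apply: cvg_geometric; rewrite ger0_norm// ltW.
  move=> /cvgn0_le /(_ _ e0)[N HN]; exists N => n /HN /(le_trans (ler_norm _)).
  apply: le_trans; rewrite distrC ger0_norm.
    rewrite lerBlDr -lerBlDl; apply: le_trans (qpoch_inf_ge q01 (h n)).
    by rewrite lerD2l lerN2 mulrC ler_wpM2l ?invr_ge0 ?(ltW iq)// ler_piMr// ltW.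
  rewrite subr_ge0; apply: le_trans (qpoch_inf_le q01 0 (h n)) _.
  by rewrite qpoch_le1.
rewrite -(divr1 (1 : R)); apply: cvgM.
  have := I 1; rewrite ler01 lexx => /(_ isT).
  by under eq_fun do rewrite mulr1.
by apply: cvgV; [rewrite oner_eq0|apply: I; rewrite !ltW].
Qed.

Lemma gam_le1 n : gam n <= 1.
Proof.
have := nondecreasing_cvgn_le gam_nondecreasing (cvgP _ gam_cvg) n.
by rewrite (cvg_lim _ gam_cvg)//; exact: norm_hausdorff.
Qed.

Lemma gamC0 : gamC 0 = 1. Proof. by rewrite /gamC gam0 subr0. Qed.

Lemma gamC_rec n :
  (1 - q ^+ n) * gamC n.+1 = (1 - q ^+ n * B) * gamC n - q ^+ n * (1 - B).
Proof. by rewrite /gamC mulrBr gamS; ring. Qed.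

Lemma gamC_upper n : gamC n <= (1 - q)^-1 * q ^+ n.
Proof.
have g0 : gamC @ \oo --> (0 : R).
  by rewrite -(subrr (1 : R)); apply: cvgB; [exact: cvg_cst|exact: gam_cvg].
have q01' : 0 <= q < 1 by rewrite ltW.
have D k : (0 <= k)%N -> `|gamC k.+1 - gamC k| <= 1 * q ^+ k.
  move=> _; have -> : gamC k.+1 - gamC k = - (gam k.+1 - gam k) by rewrite /gamC; ring.
  rewrite normrN gam_sub ger0_norm; last first.
    by rewrite mulr_ge0 ?(ltW (gam_gt0 k))// divr_ge0 ?(ltW (iqB k))// mulr_ge0 ?ltW.
  apply: ler_pM; rewrite ?(ltW (gam_gt0 k)) ?gam_le1//.
    by rewrite divr_ge0 ?(ltW (iqB k))// mulr_ge0 ?ltW.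
  rewrite ler_pdivrMr// ler_pM2l// lerD2l lerN2 ler_piMl// ltW//.
have := geometric_tail q01' D g0 (leq0n n).
by rewrite mul1r; apply: le_trans; exact: ler_norm.
Qed.

(** Since [gam] increases to 1, [gamC n] is at least the single increment from n to n + 1. *)
Lemma gamC_lower n : gam 1 * (1 - B) * q ^+ n <= gamC n.
Proof.
apply: (@le_trans _ _ (gam n.+1 - gam n)); last by rewrite lerD2r gam_le1.
rewrite gam_sub -mulrA; apply: ler_pM.
- exact: ltW (gam_gt0 0).
- by rewrite mulr_ge0 ?ltW.
- exact: (gam_nondecreasing (ltn0Sn n)).
rewrite mulrC ler_peMr//; first by rewrite mulr_ge0 ?ltW.
by rewrite invf_ge1// gerBl mulr_ge0 ?ltW.
Qed.

Let sl := gam 1 * (1 - B).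
Let su := (1 - q)^-1.
Let sl0 : 0 < sl. Proof. exact: mulr_gt0 (gam_gt0 0) iB. Qed.
Let su0 : 0 < su. Proof. by rewrite invr_gt0. Qed.

Lemma gamC_gt0 n : 0 < gamC n.
Proof. by apply: lt_le_trans (gamC_lower n); rewrite mulr_gt0. Qed.

Let s_neq0 n : gamC n != 0. Proof. by rewrite gt_eqF// gamC_gt0. Qed.

Definition wlam n : R := (q ^+ n) ^- 2 * B^-1 * (1 - q ^+ n * B) * (gamC n / gamC n.+1).
Definition wmu n : R := (q ^+ n) ^- 2 * q * B^-1 * (1 - q ^+ n) * (gamC n.+1 / gamC n).

Lemma wlam_gt0 n : 0 < wlam n.
Proof. by rewrite !mulr_gt0 ?invr_gt0 ?exprn_gt0 ?gamC_gt0. Qed.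

Lemma wmu_gt0 n : 0 < wmu n.+1.
Proof. by rewrite !mulr_gt0 ?invr_gt0 ?exprn_gt0 ?gamC_gt0. Qed.

Lemma wmu0 : wmu 0 = 0.
Proof. by rewrite /wmu expr0 subrr mulr0 mul0r. Qed.

Lemma qpochq_neq0 n : qpoch q q n != 0.
Proof. by rewrite gt_eqF// qpoch_gt0// q1 ltW. Qed.

(** The ratios of [gamC] telescope. As [gamC n] has order q^n and the q-Pochhammer quotient is
    bounded above and below, rho_n has order q^n / q^(2n) = q^(-n). *)
Lemma wrho n : bdrho wlam wmu n =
  q ^+ n * (qpoch q B n / qpoch q q n) * (gamC 1 / (gamC n * gamC n.+1)).
Proof.
elim: n => [|n IH].
  by rewrite bdrho0 /qpoch !big_ord0 gamC0 expr0; field.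
rewrite bdrhoS IH /wlam /wmu !qpochS -exprS [B * _]mulrC.
rewrite !(exprS q n); have h := iqn_neq0 n; rewrite exprS in h.
have := qpochq_neq0 n => hq.
field; rewrite hq h !s_neq0 qn_neq0 B_neq0 q_neq0.
by rewrite /=.
Qed.

Lemma modified_chain : exists c C, geometric_chain wlam wmu q c C.
Proof.
have s n := conj (gamC_lower n) (gamC_upper n).
have B01' : 0 <= B < 1 by rewrite ltW.
have B01'' : 0 <= B <= 1 by rewrite !ltW.
have qq : 0 <= q < 1 by rewrite ltW.
have qq' : 0 <= q <= 1 by rewrite !ltW.
pose IB := qpoch_inf q B; pose Iq := qpoch_inf q q.
have IB0 : 0 < IB by exact: qpoch_inf_gt0.
have Iq0 : 0 < Iq by exact: qpoch_inf_gt0.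
have div_bounds (y z a b c d : R) : 0 < c -> 0 < a -> a <= y <= b -> c <= z <= d -> a / d <= y / z <= b / c.
  move=> c0 a0 /andP[h1 h2] /andP[h3 h4].
  have z0 := lt_le_trans c0 h3; have y0 := lt_le_trans a0 h1.
  have d0 := lt_le_trans z0 h4.
  apply/andP; split; apply: ler_pM; rewrite ?invr_ge0 ?(ltW a0) ?(ltW y0) ?(ltW z0) ?(ltW d0)//.
    by rewrite lef_pV2.
  by rewrite lef_pV2.
have mul_bounds (y z a b c d : R) : 0 < c -> 0 < a -> a <= y <= b -> c <= z <= d -> a * c <= y * z <= b * d.
  move=> c0 a0 /andP[h1 h2] /andP[h3 h4].
  have z0 := lt_le_trans c0 h3; have y0 := lt_le_trans a0 h1.
  by apply/andP; split; apply: ler_pM; rewrite ?(ltW a0) ?(ltW c0) ?(ltW y0) ?(ltW z0).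
have sb n : sl <= gamC n / q ^+ n <= su.
  by rewrite ler_pdivlMr// ler_pdivrMr// gamC_lower gamC_upper.
have L n : B^-1 * (1 - B) * (sl / su / q) <= wlam n * (q ^+ 2) ^+ n <= B^-1 * 1 * (su / sl / q).
  have -> : wlam n * (q ^+ 2) ^+ n =
      B^-1 * (1 - q ^+ n * B) * ((gamC n / q ^+ n) / (gamC n.+1 / q ^+ n.+1) / q).
    rewrite /wlam (exprAC q 2) (exprS q n); field.
    by rewrite q_neq0 s_neq0 qn_neq0 B_neq0.
  apply: mul_bounds; [by rewrite !divr_gt0|by rewrite mulr_gt0 ?invr_gt0| |].
    rewrite !ler_pM2l ?invr_gt0//; apply/andP; split; last by rewrite gerBl mulr_ge0 ?ltW.
    by rewrite lerD2l lerN2 ler_piMl// ltW.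
  by rewrite !ler_pM2r ?invr_gt0//; apply: div_bounds.
have one : (1 : R) <= (1 : R) <= (1 : R) by rewrite lexx.
have Rb n : IB / 1 * (1 / su) * (1 / su) * (gamC 1 / q) <= bdrho wlam wmu n * q ^+ n <=
   1 / Iq * (1 / sl) * (1 / sl) * (gamC 1 / q).
  have -> : bdrho wlam wmu n * q ^+ n =
      qpoch q B n / qpoch q q n * (1 / (gamC n / q ^+ n)) *
      (1 / (gamC n.+1 / q ^+ n.+1)) * (gamC 1 / q).
    rewrite wrho (exprS q n); field.
    by rewrite q_neq0 !s_neq0 qn_neq0 qpochq_neq0.
  rewrite !ler_pM2r ?divr_gt0 ?gamC_gt0//.
  have u0 : 0 < 1 / su by rewrite divr_gt0.
  have b0 : 0 < IB / 1 by rewrite divr_gt0.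
  have i1 k : 1 / su <= 1 / (gamC k / q ^+ k) <= 1 / sl.
    by apply: div_bounds => //; exact: sb.
  have i2 : IB / 1 <= qpoch q B n / qpoch q q n <= 1 / Iq.
    apply: div_bounds => //; first by rewrite qpoch_inf_le//= qpoch_le1.
    by rewrite qpoch_inf_le//= qpoch_le1.
  have i3 := mul_bounds _ _ _ _ _ _ u0 b0 i2 (i1 n).
  exact: (mul_bounds _ _ _ _ _ _ u0 (mulr_gt0 b0 u0) i3 (i1 n.+1)).
set c1 := B^-1 * (1 - B) * (sl / su / q) in L; set C1 := B^-1 * 1 * (su / sl / q) in L.
set c2 := IB / 1 * (1 / su) * (1 / su) * (gamC 1 / q) in Rb.
set C2 := 1 / Iq * (1 / sl) * (1 / sl) * (gamC 1 / q) in Rb.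
have c10 : 0 < c1 by apply: mulr_gt0; [rewrite mulr_gt0 ?invr_gt0|rewrite !divr_gt0].
have c20 : 0 < c2.
  apply: mulr_gt0; last by rewrite divr_gt0 ?gamC_gt0.
  by apply: mulr_gt0; [apply: mulr_gt0|]; rewrite divr_gt0.
exists (Num.min c1 c2), (Num.max C1 C2); split=> //.
- by rewrite lt_min c10.
- exact: wlam_gt0.
- exact: wmu_gt0.
- exact: wmu0.
- by move=> n; have /andP[h1 h2] := L n; rewrite ge_min h1 le_max h2.
- by move=> n; have /andP[h1 h2] := Rb n; rewrite ge_min h1 le_max h2 !orbT.
Qed.

End modified_weights.

(** * q-Laguerre polynomials and their limit *)

Section q_laguerre.
Variables (R : realType) (q B : R).
Hypothesis q01 : 0 < q < 1.
Hypothesis B01 : 0 < B < 1.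
Implicit Types (n k : nat) (x : R).

Let q0 : 0 < q. Proof. by case/andP: q01. Qed.
Let q1 : q < 1. Proof. by case/andP: q01. Qed.
Let B0 : 0 < B. Proof. by case/andP: B01. Qed.
Let B1 : B < 1. Proof. by case/andP: B01. Qed.
Let qn0 n : 0 < q ^+ n. Proof. by rewrite exprn_gt0. Qed.
Let q_neq0 : q != 0. Proof. by rewrite gt_eqF. Qed.
Let B_neq0 : B != 0. Proof. by rewrite gt_eqF. Qed.
Let qn_neq0 n : q ^+ n != 0. Proof. by rewrite gt_eqF. Qed.
Let iB : 0 < 1 - B. Proof. by rewrite subr_gt0. Qed.
Let iB_neq0 : 1 - B != 0. Proof. by rewrite gt_eqF. Qed.
Let Bq01 : 0 <= B * q < 1.
Proof. by rewrite mulr_ge0 ?(ltW B0) ?(ltW q0)//= mulr_ilt1 ?(ltW B0) ?(ltW q0). Qed.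
Let qq01 : 0 <= q < 1. Proof. by rewrite ltW. Qed.
Let qn1 n : q ^+ n <= 1. Proof. by rewrite exprn_ile1// ltW. Qed.

(** The k-th term of 0phi1(-; q^(alpha+2); q, -q^(alpha+2) x), for B = q^(alpha+1). *)
Definition bessel_coef k x : R :=
  q ^+ (k * k.-1) / (qpoch q (B * q) k * qpoch q q k) * (- (B * q * x)) ^+ k.

(** Equal to (q^(-n); q)_k up to sign and a power of q. In this normalization it tends to 1 as n
    grows with k fixed, so that [qlag], a q-Laguerre polynomial with value 1 at 0, tends termwise to
    the 0phi1 series. *)
Definition qfalling n k : R := \prod_(j < k) (1 - q ^+ n / q ^+ j).

Definition qlag n x : R := \sum_(k < n.+1) qfalling n k * bessel_coef k x.

Lemma bessel_coef0 x : bessel_coef 0 x = 1.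
Proof. by rewrite /bessel_coef /qpoch !big_ord0 mul0n !expr0 !mulr1 invr1 mulr1. Qed.

Lemma bessel_coefS k x :
  (1 - B * q ^+ k.+1) * (1 - q ^+ k.+1) * bessel_coef k.+1 x =
  - (B * q * x) * (q ^+ k) ^+ 2 * bessel_coef k x.
Proof.
have b0 n : qpoch q (B * q) n != 0 by rewrite gt_eqF// qpoch_gt0.
have p0 n : qpoch q q n != 0 by rewrite gt_eqF// qpoch_gt0.
have := b0 k.+1; have := p0 k.+1; rewrite /bessel_coef !qpochS.
rewrite !mulf_eq0 !negb_or => /andP[p1 p2] /andP[b1 b2].
have -> : (k.+1 * k.+1.-1 = k * k.-1 + k * 2)%N.
  by case: (k) => // j; rewrite -mulnDr /= addn2 mulnC.
rewrite exprD (exprM q k 2) (exprS q k) (exprS (- (B * q * x)) k); field.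
by rewrite p1 b1 p2 b2.
Qed.

Lemma qfallingS n k : qfalling n k.+1 = qfalling n k * (1 - q ^+ n / q ^+ k).
Proof. by rewrite /qfalling big_ord_recr. Qed.

Lemma qfalling_eq0 n k : (n < k)%N -> qfalling n k = 0.
Proof.
by move=> nk; rewrite /qfalling (bigD1 (Ordinal nk))//= divff// subrr mul0r.
Qed.

Lemma qfallingS_l n k : qfalling n.+1 k.+1 = (1 - q ^+ n.+1) * qfalling n k.
Proof.
rewrite /qfalling big_ord_recl expr0 divr1; congr (_ * _).
apply: eq_bigr => i _; rewrite /= !exprS; congr (1 - _).
by rewrite invfM mulrACA divff// mul1r.
Qed.

Lemma qlag_widen n N x : (n < N)%N ->
  qlag n x = \sum_(k < N) qfalling n k * bessel_coef k x.
Proof.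
move=> nN; rewrite -(subnKC nN) big_split_ord/= [X in _ + X]big1 ?addr0// => i _.
by rewrite qfalling_eq0 ?mul0r// leq_addr.
Qed.

(** Comparison of coefficients in the [bessel_coef k x], multiplication by x being a shift of k by
    [bessel_coefS]. For n = 0 the junk index [n.-1] is multiplied by 1 - q^0 = 0. *)
Lemma qlag_rec n x :
  - (x * q * B * (q ^+ n) ^+ 2) * qlag n x =
  (1 - q ^+ n.+1 * B) * (qlag n.+1 x - qlag n x) +
  q * (1 - q ^+ n) * (qlag n.-1 x - qlag n x).
Proof.
(* The coefficient of [bessel_coef k.+1]; that of [bessel_coef 0] vanishes because every
   [qfalling n 0] is 1. *)
have E k : (1 - q ^+ n.+1 * B) * (qfalling n.+1 k.+1 - qfalling n k.+1) +
    q * ((1 - q ^+ n) * qfalling n.-1 k.+1 - (1 - q ^+ n) * qfalling n k.+1) =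
    qfalling n k * (q ^+ n / q ^+ k) ^+ 2 * ((1 - B * q ^+ k.+1) * (1 - q ^+ k.+1)).
  have -> : (1 - q ^+ n) * qfalling n.-1 k.+1 = qfalling n k.+2.
    case: n => [|n]; first by rewrite expr0 subrr mul0r qfalling_eq0.
    by rewrite qfallingS_l.
  rewrite qfallingS_l !qfallingS !(exprS q); field.
  by rewrite q_neq0 qn_neq0.
rewrite [in LHS](@qlag_widen n n.+2)// mulr_sumr.
rewrite (@qlag_widen n.+1 n.+3)// (@qlag_widen n.-1 n.+3); last first.
  by rewrite ltnS (leq_trans (leq_pred _))// (leq_trans (leqnSn _)).
rewrite (@qlag_widen n n.+3); last by rewrite ltnS ltnW.
rewrite -!sumrB !mulr_sumr -big_split/= [RHS]big_ord_recl/=.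
have q00 k : qfalling k 0 = 1 by rewrite /qfalling big_ord0.
rewrite !q00 !subrr !mulr0 addr0 add0r.
apply: eq_bigr => i _.
transitivity (((1 - q ^+ n.+1 * B) * (qfalling n.+1 i.+1 - qfalling n i.+1) +
    q * ((1 - q ^+ n) * qfalling n.-1 i.+1 - (1 - q ^+ n) * qfalling n i.+1)) *
    bessel_coef i.+1 x); last by rewrite /bump/= add1n; ring.
rewrite E -[RHS]mulrA bessel_coefS expr_div_n; field.
exact: qn_neq0.
Qed.

(** The factors k + 1 and q^k are there to absorb the error k q^n / q^k of [qfalling n k]; they are
    paid for by taking 2 |B q x| / q in the Gaussian bound. *)
Lemma bessel_coef_bound x : exists2 A : R, 0 < A &
  forall k, k.+1%:R * `|bessel_coef k x| <= A * 2^-1 ^+ k * q ^+ k.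
Proof.
set y := `|B * q * x|.
have y0 : 0 <= y by exact: normr_ge0.
have W0 : 0 <= 2 * y / q by rewrite divr_ge0 ?mulr_ge0// ltW.
have [A A0 HA] := gaussian_bound q01 W0.
pose E := qpoch_inf q (B * q) * qpoch_inf q q.
have E0 : 0 < E by rewrite mulr_gt0// qpoch_inf_gt0.
exists (A / E); first by rewrite divr_gt0.
move=> k; have b0 : 0 < qpoch q (B * q) k by rewrite qpoch_gt0.
have p0 : 0 < qpoch q q k by rewrite qpoch_gt0.
rewrite /bessel_coef normrM normrX normrN -/y ger0_norm; last first.
  by rewrite divr_ge0 ?mulr_ge0 ?(ltW b0) ?(ltW p0) ?(ltW (qn0 _)).
have Ek : E <= qpoch q (B * q) k * qpoch q q k.
  have /andP[h1 h2] := Bq01; have /andP[h3 h4] := qq01.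
  by apply: ler_pM; try (exact: ltW (qpoch_inf_gt0 _ _)); apply: qpoch_inf_le;
    rewrite ?h1 ?h3 ?(ltW h2) ?(ltW h4).
have k2 : k.+1%:R <= 2 ^+ k :> R by rewrite -natrX ler_nat ltn_expl.
apply: (@le_trans _ _ (2 ^+ k * (q ^+ (k * k.-1) / E * y ^+ k))).
  apply: ler_pM => //.
    by rewrite !mulr_ge0 ?invr_ge0 ?mulr_ge0 ?exprn_ge0 ?(ltW b0) ?(ltW p0) ?(ltW q0).
  apply: ler_wpM2r; first by rewrite exprn_ge0.
  by rewrite ler_wpM2l ?(ltW (qn0 _))// lef_pV2 ?posrE// mulr_gt0.
have -> : 2 ^+ k * (q ^+ (k * k.-1) / E * y ^+ k) =
    (q ^+ (k * k.-1) * (2 * y / q) ^+ k) * (E^-1 * q ^+ k).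
  by rewrite expr_div_n exprMn; field; rewrite qn_neq0 gt_eqF.
have -> : A / E * 2^-1 ^+ k * q ^+ k = A * 2^-1 ^+ k * (E^-1 * q ^+ k) by ring.
by rewrite ler_wpM2r ?HA// mulr_ge0 ?invr_ge0 ?(ltW E0) ?(ltW (qn0 _)).
Qed.

Lemma bessel_series_cvg x : cvgn (series (fun k => bessel_coef k x)).
Proof.
have [A A0 HA] := bessel_coef_bound x.
apply: normed_cvg; apply: (@series_le_cvg _ _ (geometric A 2^-1)) => [n|n|n|].
- exact: normr_ge0.
- by rewrite /= mulr_ge0 ?exprn_ge0// ltW.
- rewrite /=; apply: (@le_trans _ _ (n.+1%:R * `|bessel_coef n x|)).
    by rewrite ler_peMl// ler1n.
  by apply: le_trans (HA n) _; rewrite ler_piMr// mulr_ge0 ?exprn_ge0// ltW.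
apply: is_cvg_geometric_series; rewrite ger0_norm ?invr_ge0//.
by rewrite invf_lt1 ?ltr1n.
Qed.

Lemma qfalling_bound n k : (k <= n.+1)%N ->
  0 <= qfalling n k <= 1 /\ 1 - qfalling n k <= k%:R * (q ^+ n / q ^+ k).
Proof.
elim: k => [|k IH] kn.
  by rewrite /qfalling big_ord0 ler01 lexx subrr mul0r.
have [/andP[h0 h1] h2] := IH (ltnW kn); rewrite qfallingS.
set y := q ^+ n / q ^+ k.
have y0 : 0 <= y by rewrite divr_ge0// ltW.
have y1 : y <= 1 by rewrite ler_pdivrMr// mul1r ler_wiXn2l// ltW.
have yq : y <= q ^+ n / q ^+ k.+1.
  by rewrite ler_pM2l// lef_pV2 ?posrE// exprS ler_piMl// ltW.
split.
  by rewrite mulr_ge0 ?subr_ge0//= mulr_ile1 ?subr_ge0// gerBl.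
have H : qfalling n k * y <= y by rewrite ler_piMl.
have H2 : k%:R * y <= k%:R * (q ^+ n / q ^+ k.+1) by rewrite ler_wpM2l.
rewrite -natr1 mulrDl mul1r; rewrite -/y in h2; lra.
Qed.

(** Compared with the partial sum of n + 1 terms the error is at most A q^n times the sum of the
    2^(-k). *)
Lemma qlag_cvg x : qlag n x @[n --> \oo] --> limn (series (fun k => bessel_coef k x)).
Proof.
have [A A0 HA] := bessel_coef_bound x.
have cs : series (fun k => bessel_coef k x) n.+1 @[n --> \oo] -->
    limn (series (fun k => bessel_coef k x)).
  by rewrite cvg_shiftS; exact: bessel_series_cvg.
have D : qlag n x - series (fun k => bessel_coef k x) n.+1 @[n --> \oo] --> (0 : R).
  apply: cvgn0I => e e0.
  have : A * 2 * q ^+ n @[n --> \oo] --> (0 : R).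
    by apply: cvg_geometric; rewrite ger0_norm// ltW.
  move=> /cvgn0_le /(_ _ e0)[N HN]; exists N => n /HN /(le_trans (ler_norm _)).
  apply: le_trans; rewrite /series/= big_mkord /qlag -sumrB.
  apply: le_trans (ler_norm_sum _ _ _) _.
  apply: (@le_trans _ _ (\sum_(k < n.+1) A * q ^+ n * 2^-1 ^+ k)).
    apply: ler_sum => k _; rewrite -[X in _ - X]mul1r -mulrBl normrM distrC.
    have [/andP[h0 h1] h2] := @qfalling_bound n k (ltnW (ltn_ord k)).
    have d0 : 0 <= 1 - qfalling n k by rewrite subr_ge0.
    rewrite (ger0_norm d0).
    apply: (@le_trans _ _ (k.+1%:R * (q ^+ n / q ^+ k) * `|bessel_coef k x|)).
      apply: ler_wpM2r => //; apply: le_trans h2 _; apply: ler_wpM2r.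
        by rewrite divr_ge0// ltW.
      by rewrite ler_nat.
    rewrite mulrAC; apply: le_trans (ler_wpM2r _ (HA k)) _.
      by rewrite divr_ge0// ltW.
    by rewrite le_eqVlt; apply/orP; left; apply/eqP; field; exact: qn_neq0.
  rewrite -(big_mkord xpredT (fun k => A * q ^+ n * 2^-1 ^+ k)).
  have -> : \sum_(0 <= k < n.+1) A * q ^+ n * 2^-1 ^+ k =
      series (geometric (A * q ^+ n) 2^-1) n.+1 by [].
  rewrite geometric_seriesE; last by rewrite lt_eqF// invf_lt1 ?ltr1n.
  have -> : A * 2 * q ^+ n = A * q ^+ n / (1 - 2^-1) by field.
  rewrite /= ler_pM2r; last by rewrite invr_gt0 subr_gt0 invf_lt1 ?ltr1n.
  by rewrite ler_piMr ?gerBl ?exprn_ge0// mulr_ge0// ltW.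
apply: cvgn_sub0; apply: cvgn0I => e e0; have e20 : 0 < e / 2 by rewrite divr_gt0.
have [N HN] := cvgn0_le D e20; have [M HM] := cvgn_dist_le cs e20.
exists (maxn N M) => n; rewrite geq_max => /andP[/HN h1 /HM h2].
rewrite -[qlag n x](subrK (series (fun k => bessel_coef k x) n.+1)) -addrA.
by apply: le_trans (ler_normD _ _) _; lra.
Qed.

Local Notation s := (gamC q B).
Local Notation lam := (wlam q B).
Local Notation mu := (wmu q B).

Let s_gt0 n : 0 < s n. Proof. exact: gamC_gt0. Qed.
Let s_neq0 n : s n != 0. Proof. by rewrite gt_eqF. Qed.
Let iqB n : 0 < 1 - q ^+ n * B.
Proof. by rewrite subr_gt0; apply: le_lt_trans B1; rewrite ler_piMl// ltW. Qed.
Let iqB_neq0 n : 1 - q ^+ n * B != 0. Proof. by rewrite gt_eqF. Qed.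

(* The modified polynomials are a Geronimus transform of the q-Laguerre
   polynomials qlag with parameter alpha + 1. *)
Definition geronimus n x : R :=
  (s n * (1 - q ^+ n * B) * qlag n x - (1 - q ^+ n) * s n.+1 * qlag n.-1 x)
  / (q ^+ n * (1 - B)).

(** Value and increment are carried through the induction together, the increment multiplied by
    [mu n] as in [lam_bdstep]. The auxiliary [st] shows that the kernel polynomials ell_k are the
    [qlag k]. *)
Lemma bdpi_geronimus n x : bdpi lam mu n x = geronimus n x /\
  mu n * bdstep lam mu n x =
    - x * (1 - q ^+ n) * s n.+1 * qlag n.-1 x / (q ^+ n * (1 - B)).
Proof.
have st k : bdpi lam mu k x = geronimus k x ->
  mu k * bdstep lam mu k x = - x * (1 - q ^+ k) * s k.+1 * qlag k.-1 x / (q ^+ k * (1 - B)) ->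
  bdstep lam mu k.+1 x = - x * (q ^+ k * B * s k.+1 / (1 - B)) * qlag k x.
  move=> h1 h2; have lk : 0 < lam k by exact: wlam_gt0.
  have lk0 : lam k != 0 by rewrite gt_eqF.
  apply: (mulfI lk0); rewrite lam_bdstep; last by move=> j; exact: wlam_gt0.
  rewrite h1 h2 /geronimus /wlam; field.
  by rewrite qn_neq0 iB_neq0 s_neq0 B_neq0.
elim: n => [|n [IH1 IH2]].
  rewrite wmu0 !mul0r expr0 subrr mulr0 !mul0r; split=> //.
  rewrite bdpi0 /geronimus expr0 subrr !mul0r subr0 gamC0 ?mul1r//.
  by rewrite /qlag big_ord_recl big_ord0 addr0 bessel_coef0 /qfalling big_ord0 !mulr1 divff.
have S := st n IH1 IH2; split.
  rewrite bdpiS S IH1 /geronimus /=.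
  have r1 := gamC_rec q01 B01 n; have r2 := gamC_rec q01 B01 n.+1.
  have r3 := qlag_rec n x.
  have q0' := qn_neq0 n; rewrite r2.
  have -> : (1 - q ^+ n) * s n.+1 * qlag n.-1 x =
     s n.+1 * ((1 - q ^+ n) * (qlag n.-1 x - qlag n x)) + ((1 - q ^+ n) * s n.+1) * qlag n x by ring.
  have -> : (1 - q ^+ n) * (qlag n.-1 x - qlag n x) =
    (- (x * q * B * (q ^+ n) ^+ 2) * qlag n x - (1 - q ^+ n.+1 * B) * (qlag n.+1 x - qlag n x)) / q.
    by rewrite r3; field.
  rewrite r1 (exprS q n); field.
  by rewrite ?q_neq0 ?qn_neq0 ?iB_neq0.
rewrite S /wmu (exprS q n) /=; field.
by rewrite q_neq0 qn_neq0 iB_neq0 s_neq0 B_neq0.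
Qed.

(** By [gamC_rec] the transform is [qlag n] plus E_n times the difference of two consecutive
    q-Laguerre polynomials; that difference tends to 0 and E_n is bounded since gamC_n = O(q^n). *)
Lemma bdpi_bessel_cvg x : bdpi lam mu n x @[n --> \oo] -->
  limn (series (fun k => bessel_coef k x)).
Proof.
rewrite -cvg_shiftS.
pose E n := s n.+1 * (1 - q ^+ n.+1 * B) / (q ^+ n.+1 * (1 - B)).
have Fn n : bdpi lam mu n.+1 x = qlag n x + (qlag n.+1 x - qlag n x) * E n.
  rewrite (bdpi_geronimus n.+1 x).1 /geronimus gamC_rec// /E /=; field.
  by rewrite qn_neq0 iB_neq0.
under eq_fun do rewrite Fn.
set l := limn _; rewrite -[l]addr0; apply: cvgD; first exact: qlag_cvg.
have D0 : qlag n.+1 x - qlag n x @[n --> \oo] --> (0 : R).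
  apply: cvgn0I => e e0; have e20 : 0 < e / 2 by rewrite divr_gt0.
  have [N HN] := cvgn_dist_le (@qlag_cvg x) e20; exists N => n Nn.
  have h1 := HN n Nn; have h2 := HN n.+1 (leqW Nn).
  have -> : qlag n.+1 x - qlag n x = (qlag n.+1 x - l) - (qlag n x - l) by ring.
  by apply: le_trans (ler_normB _ _) _; rewrite -/l in h1 h2; lra.
pose K := (1 - q)^-1 / (1 - B).
have iq : 0 < 1 - q by rewrite subr_gt0.
have K0 : 0 < K by rewrite divr_gt0// invr_gt0.
have EK n : `|E n| <= K.
  rewrite ger0_norm; last first.
    apply: divr_ge0; first by rewrite mulr_ge0 ?(ltW (s_gt0 _)) ?(ltW (iqB _)).
    by rewrite mulr_ge0 ?(ltW (qn0 _)) ?(ltW iB).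
  rewrite ler_pdivrMr ?mulr_gt0//.
  have -> : K * (q ^+ n.+1 * (1 - B)) = (1 - q)^-1 * q ^+ n.+1.
    by rewrite /K; field; rewrite iB_neq0 gt_eqF.
  rewrite mulrC; apply: le_trans (gamC_upper q01 B01 n.+1).
  by rewrite ler_piMl ?(ltW (s_gt0 _))// gerBl mulr_ge0 ?(ltW (qn0 _)) ?(ltW B0).
apply: cvgn0I => e e0; have [N HN] := cvgn0_le (cvgn0Z K D0) e0.
exists N => n /HN; apply: le_trans; rewrite (normrM K) normrM (ger0_norm (ltW K0)).
by rewrite mulrC ler_wpM2r.
Qed.

End q_laguerre.

(** * Translation from alpha to B = q^(alpha+1) *)

Section parameters.
Variables (R : realType) (q alpha : R).
Hypotheses (q0 : 0 < q) (q1 : q < 1) (alpha1 : -1 < alpha).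
Implicit Types (n k : nat) (x : R).
Local Notation B := (q `^ (alpha + 1)).

Let q01 : 0 < q < 1. Proof. by rewrite q0. Qed.
Let b0 : 0 < alpha + 1. Proof. by rewrite -ltrBlDr sub0r. Qed.

Lemma q_powR01 : 0 < B < 1.
Proof.
have e : 1 `^ (alpha + 1) = 1 :> R by rewrite powR1.
rewrite powR_gt0//= -[X in _ < X]e.
by apply: gt0_ltr_powR; rewrite // nnegrE ltW.
Qed.

Let q_neq0 : q != 0. Proof. by rewrite gt_eqF. Qed.

Let q_powRD (r s : R) : q `^ (r + s) = q `^ r * q `^ s.
Proof. by rewrite powRD// q_neq0 implybT. Qed.

Lemma qgamma_gam n : qgamma q n%:R (alpha + 1) = gam q B n.
Proof. by rewrite /qgamma /gam q_powRD powR_mulrn// ltW. Qed.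

Lemma mql_rE n : mql_r q alpha n = gamC q B n.+1 / gamC q B n.
Proof. by rewrite /mql_r !qgamma_gam. Qed.

Let powR2n n : q `^ (- (2 * n%:R)) = (q ^+ n) ^- 2.
Proof. by rewrite powRN -natrM powR_mulrn ?ltW// mulnC exprM. Qed.

Lemma mql_lambdaE : mql_lambda q alpha = wlam q B.
Proof.
apply/funext => n; rewrite /mql_lambda /wlam mql_rE invf_div.
have -> : - (2 * n%:R) - alpha - 1 = - (2 * n%:R) + - (alpha + 1) by ring.
by rewrite -addrA (q_powRD (- (2 * n%:R))) (q_powRD n%:R) powR2n powRN powR_mulrn ?(ltW q0).
Qed.

Lemma mql_muE : mql_mu q alpha = wmu q B.
Proof.
apply/funext => n; rewrite /mql_mu /wmu mql_rE.
have -> : - (2 * n%:R) - alpha = - (2 * n%:R) + 1 + - (alpha + 1) by ring.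
by rewrite (q_powRD (- (2 * n%:R) + 1)) (q_powRD (- (2 * n%:R)) 1) powR2n powRN powRr1 ?(ltW q0).
Qed.

(** For x > 0 the prefactor of the q-Bessel function and its real power are nonzero, so only the
    0phi1 series can vanish. *)
Lemma positive_rootsE x : positive_roots q alpha x <->
  0 < x /\ limn (series (fun k => bessel_coef q B k x)) = 0.
Proof.
rewrite /positive_roots /= /qBesselJ.
have [x0|x0] := boolP (0 < x); last by split=> -[].
have -> : q `^ (alpha + 1 + 1) = B * q by rewrite q_powRD powRr1// ltW.
have -> : B * q * (2 * Num.sqrt x) ^+ 2 / 4 = B * q * x.
  by rewrite exprMn sqr_sqrtr ?(ltW x0)//; field.
rewrite -/(phi01 _ _ _); set l := phi01 _ _ _.
have /andP[B0 B1] := q_powR01.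
have Bq : 0 <= B * q < 1.
  by rewrite mulr_ge0 ?(ltW B0) ?(ltW q0)//= mulr_ilt1 ?(ltW B0) ?(ltW q0).
have qq : 0 <= q < 1 by rewrite ltW.
have pref : qpoch_inf q (B * q) / qpoch_inf q q * (2 * Num.sqrt x / 2) `^ (alpha + 1) != 0.
  rewrite !mulf_neq0 ?invr_eq0 ?gt_eqF ?qpoch_inf_gt0//.
  by rewrite powR_gt0// divr_gt0// mulr_gt0// sqrtr_gt0.
split=> -[_ h]; split=> //.
  by move/eqP: h; rewrite mulf_eq0 (negbTE pref) => /eqP.
by rewrite h mulr0.
Qed.

Lemma mql_PE n x : (mql_P q alpha n).[x] = bdP (mql_lambda q alpha) (mql_mu q alpha) n x.
Proof.
set lam := mql_lambda q alpha; set mu := mql_mu q alpha.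
have lam0 k : 0 < lam k by rewrite /lam mql_lambdaE; exact: (wlam_gt0 q01 q_powR01).
have mup k : 0 < mu k.+1 by rewrite /mu mql_muE; exact: (wmu_gt0 q01 q_powR01).
have mu0 : mu 0 = 0 by rewrite /mu mql_muE wmu0.
have rec k := bdP_rec lam0 mup mu0 k x.
have a0 k : bda lam mu k != 0 by rewrite gt_eqF// bda_gt0.
suff [] : (mql_P q alpha n).[x] = bdP lam mu n x /\
  (mql_P q alpha n.+1).[x] = bdP lam mu n.+1 x by [].
elim: n => [|n [IH1 IH2]].
  rewrite /= hornerC bdP0; split=> //.
  rewrite hornerZ hornerD hornerN hornerX hornerC.
  apply: (mulfI (a0 0)); rewrite mulVKf; last exact: a0.
  have := rec 0; rewrite bdP0 !mulr1 add0r => r0.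
  by rewrite [X in X - _]r0 addrAC subrr add0r.
split=> //; rewrite [mql_P _ _ _.+2]/=.
rewrite hornerZ hornerD hornerM hornerN hornerZ !hornerD !hornerN hornerX hornerC.
rewrite -/(mql_P q alpha n.+1) IH1 IH2.
apply: (mulfI (a0 n.+1)); rewrite mulVKf; last exact: a0.
have -> : bda lam mu n.+1 * bdP lam mu n.+2 x =
   x * bdP lam mu n.+1 x - (bda lam mu n * bdP lam mu n x + bdb lam mu n.+1 * bdP lam mu n.+1 x).
  by rewrite (rec n.+1); ring.
by rewrite /mql_b /mql_a -/lam -/mu -/(bda lam mu n) -/(bdb lam mu n.+1); ring.
Qed.

End parameters.

(** * Support and masses of the orthogonality measure *)

Theorem corollary5p12 (R : realType) (q alpha : R)
  (mu : probability (measurableTypeR R) R) (zeta : nat -> R)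
  (hq0 : 0 < q) (hq1 : q < 1) (halpha : -1 < alpha)
  (hmu : orthogonality_measure q alpha mu)
  (hzeta : spectrum_enumeration (mql_a q alpha) (mql_b q alpha) zeta) :
  mu (~` positive_roots q alpha) = 0%E /\
  forall x : R, positive_roots q alpha x ->
    [/\ cvgn (series (fun n => (mql_P q alpha n).[x] ^+ 2)),
        mu [set x] =
          ((limn (series (fun n => (mql_P q alpha n).[x] ^+ 2)))^-1)%:E &
        (real_complex R (fine (mu [set x])) : Cplx R) =
          - weylW mu zeta (real_complex R x)
            * (derive1 (charF zeta) (real_complex R x))^-1].
Proof.
have q01 : 0 < q < 1 by rewrite hq0.
have B01 := q_powR01 hq0 hq1 halpha.
set B := q `^ (alpha + 1) in B01.
pose lam := mql_lambda q alpha; pose bet := mql_mu q alpha.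
pose phi x := limn (series (fun k => bessel_coef q B k x)).
have lamE : lam = wlam q B by exact: mql_lambdaE.
have betE : bet = wmu q B by exact: mql_muE.
have [c [C G]] : exists c C, geometric_chain lam bet q c C.
  by rewrite lamE betE; exact: modified_chain.
have pi_phi x : bdpi lam bet n x @[n --> \oo] --> phi x.
  by rewrite lamE betE; exact: bdpi_bessel_cvg.
have PE n x : (mql_P q alpha n).[x] = bdP lam bet n x by exact: mql_PE.
have orth i j : (\int[mu]_x (bdP lam bet i x * bdP lam bet j x)%:E = ((i == j)%:R : R)%:E)%E.
  by rewrite -hmu; apply: eq_integral => x _; rewrite !PE.
have rootsE x : positive_roots q alpha x <-> phi x = 0.
  rewrite positive_rootsE//; split=> [[]//|px]; split=> //.
  exact: (bdroot_gt0 G pi_phi px).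
have a0 n : 0 < bda lam bet n by apply: bda_gt0; [exact: chain_lam_gt0 G|exact: chain_mu_gt0 G].
have [z0 zlt zspec] := hzeta.
have zinj : injective zeta.
  move=> i j ij; case: (ltngtP i j) => // h; have := zlt _ _ h; by rewrite ij ltxx.
have zroot k : phi (zeta k) = 0.
  apply/eqP/negPn/negP => nz.
  have : jacobi_spectrum (bda lam bet) (bdb lam bet) (real_complex R (zeta k)).
    by rewrite zspec; exists k.
  by apply; exact: (nonroot_resolvent G pi_phi orth).
have rootz x : phi x = 0 -> exists k, zeta k = x.
  move=> px.
  have : jacobi_spectrum (bda lam bet) (bdb lam bet) (real_complex R x).
    apply: (@eigenvalue_spectrum _ _ _ x (fun n => bdP lam bet n x) (bdnorm lam bet x)).
    - exact: bdP0.
    - by move=> n; exact: (real_jacobi_bdP G).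
    - by move=> N; exact: (bdnorm_ge G pi_phi).
  by rewrite zspec => -[k _ [<-]]; exists k.
have zsum K := sum_inv_roots_le G pi_phi orth K zinj zroot.
have ZE : positive_roots q alpha = [set x | phi x = 0].
  by apply/seteqP; split => x /rootsE.
split; first by rewrite ZE; exact: (measure_nonroots G pi_phi orth).
move=> x /rootsE px.
have PxE : (fun n => (mql_P q alpha n).[x] ^+ 2) = (fun n => bdP lam bet n x ^+ 2).
  by apply/funext => n; rewrite PE.
rewrite PxE; split.
- exact: (bdP_root_series G pi_phi px).
- exact: (measure_root G pi_phi orth px).
have [k <-] := rootz x px.
(* The distance from zeta_k to its neighbours; the least zero has none on its left, where any
   positive number will do. *)
pose d := Num.min (zeta k.+1 - zeta k) (if k is j.+1 then zeta k - zeta j else 1).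
have d0 : 0 < d.
  rewrite lt_min subr_gt0 zlt//=; case: (k) => [|j]; first exact: ltr01.
  by rewrite subr_gt0 zlt.
have zle i j : (i <= j)%N -> zeta i <= zeta j.
  by rewrite leq_eqVlt => /orP[/eqP -> //|/zlt /ltW].
apply: (@weyl_mass R mu [set x | phi x = 0] _ _ zeta _ k d z0 zinj zsum d0).
- exact: (measurable_roots pi_phi).
- exact: (measure_nonroots G pi_phi orth).
move=> t /= /rootz[j <-] jk; rewrite ge_min.
have [kj|kj|kj] := ltngtP k j.
- apply/orP; left; apply: le_trans _ (ler_norm _).
  by rewrite lerD2r zle.
- apply/orP; right; rewrite distrC; apply: le_trans _ (ler_norm _).
  by case: (k) kj => // i ji; rewrite lerD2l lerN2 zle.
- by move: jk; rewrite kj eqxx.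
Qed.
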